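(* Let $\lambda_k=\pi/k!$ for $k\ge1$ and $C^\lambda(t)=\prod_{k=1}^\infty\cos(\lambda_k t)$, $t\in\mathbb{R}$. Let $X$ be the real stationary Gaussian process with reduced covariance $C^\lambda$, $\mu^\lambda$ its spectral measure, and $Z=\{t\in\mathbb{R}:X(t)=0\}$ its zero set. Then: (a) $(-1)^{n+1}C^\lambda(n!)\to1$ as $n\to\infty$; (b) $Z$ is completely predictable, hence maximally rigid; (c) $\mu^\lambda$ is purely singular (with respect to Lebesgue measure) without atoms, hence $X$ and $Z$ are weakly mixing; (d) $\sup_{t\in\mathbb{R}}|X(t)|=\infty$ almost surely.
   Context: $X$ is a (centered) Gaussian process with continuous (in fact analytic) sample paths and $\mathrm{Cov}(X(t),X(s))=C^\lambda(t-s)$. The spectral measure $\mu^\lambda$ is characterized by $C^\lambda(t)=\int_{\mathbb{R}}e^{ixt}\mu^\lambda(dx)$; it is the law of $\sum_{k\ge1}\lambda_k\varepsilon_k$ with $(\varepsilon_k)$ i.i.d. Rademacher variables. Let $\mathscr{N}(\mathbb{R})$ be the space of locally finite subsets of $\mathbb{R}$ with the $\sigma$-algebra $\mathscr{B}(\mathscr{N}(\mathbb{R}))$ generated by the maps $Z\mapsto\#(Z\cap A)$, $A$ Borel; a point process is a random element of this space. For Borel $A$, $\sigma(Z\cap A)$ is the $\sigma$-algebra generated by the restriction $Z\cap A$. All $\sigma$-algebras below are understood as completed by the $\mathbf{P}$-null sets. $Z$ is completely predictable if $\sigma(Z)=\bigcap_{t\in\mathbb{R}}\sigma(Z\cap(-\infty,t))$.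 $Z$ is maximally rigid if for every bounded measurable $\varphi:\mathscr{N}(\mathbb{R})\to\mathbb{R}$ and every $T>0$, $\varphi(Z\cap[-T,T])$ is $\sigma(Z\cap[-T,T]^c)$-measurable. A stationary process $X$ with continuous paths is weakly mixing if for all events $A,B\in\sigma(X)$, $\lim_{T\to\infty}T^{-1}\int_0^T|\mathbf{P}(A\cap(B+t))-\mathbf{P}(A)\mathbf{P}(B)|\,dt=0$, where $B+t$ is the event $B$ translated by $t$ (the same condition applied to the time-shifted process). A stationary point process $Z$ is weakly mixing if for all $A,B\in\mathscr{B}(\mathscr{N}(\mathbb{R}))$, $\lim_{T\to\infty}T^{-1}\int_0^T|\mathbf{P}(Z\in A,\,Z+t\in B)-\mathbf{P}(Z\in A)\mathbf{P}(Z\in B)|\,dt=0$. *)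

(* Defs.v *)
From HB Require Import structures.
From mathcomp Require Import all_boot all_order all_algebra.
From mathcomp Require Import all_classical all_reals all_analysis.
From mathcomp Require Import measurable_realfun.
Set Implicit Arguments.
Unset Strict Implicit.
Unset Printing Implicit Defensive.
Import Order.TTheory GRing.Theory Num.Theory.
Import numFieldNormedType.Exports.
Local Open Scope classical_set_scope.
Local Open Scope ring_scope.

Section covariance_function.
Context {R : realType}.

(* The value at k = 0 is irrelevant: indices start at 1. *)
Definition lambda_ (k : nat) : R := pi / (k`!)%:R.

Definition cos_product (l : nat -> R) (t : R) : R :=
  limn (fun n => \prod_(1 <= k < n.+1) cos (l k * t)).

(* [C t] is the integral of [exp (i x t)] against [mu], written as its real and
   imaginary parts. *)
Definition is_spectral_measure
    (mu : {finite_measure set (measurableTypeR R) -> \bar R}) (C : R -> R) :=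
  forall t : R, (\int[mu]_x (cos (x * t))%:E = (C t)%:E /\
                 \int[mu]_x (sin (x * t))%:E = 0)%E.

Definition purely_singular (mu : set (measurableTypeR R) -> \bar R) :=
  exists N : set (measurableTypeR R),
    [/\ measurable N, lebesgue_measure N = 0%E & mu (~` N) = 0%E].

Definition atomless (mu : set (measurableTypeR R) -> \bar R) :=
  forall x : R, mu [set x] = 0%E.

End covariance_function.

Section point_configurations.
Context {R : realType}.

Definition locally_finite (Z : set R) :=
  forall a b : R, finite_set (Z `&` `[a, b]).

Lemma locally_finite0 : locally_finite set0.
Proof. by move=> a b; rewrite set0I; exact: finite_set0. Qed.

Lemma locally_finiteI (A Z : set R) :
  locally_finite Z -> locally_finite (Z `&` A).
Proof.
move=> fZ a b; apply: sub_finite_set (fZ a b).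
by move=> x [[Zx _] abx]; split.
Qed.

Lemma locally_finite_shift (t : R) (Z : set R) :
  locally_finite Z -> locally_finite [set x + t | x in Z].
Proof.
move=> fZ a b.
apply: (@sub_finite_set _ _ ((+%R^~ t) @` (Z `&` `[a - t, b - t]))).
  move=> _ [[x Zx <-]] /=; rewrite in_itv/= => abx.
  by exists x => //; split => //=; rewrite in_itv/= lerBlDr lerBrDr.
exact: finite_image.
Qed.

Record configuration := Configuration {
  points :> set R;
  points_locally_finite : locally_finite points }.

HB.instance Definition _ := gen_eqMixin configuration.
HB.instance Definition _ := gen_choiceMixin configuration.
HB.instance Definition _ :=
  isPointed.Build configuration (Configuration locally_finite0).

Definition config_restrict (A : set R) (Z : configuration) : configuration :=
  Configuration (locally_finiteI A (points_locally_finite Z)).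

Definition config_shift (t : R) (Z : configuration) : configuration :=
  Configuration (locally_finite_shift t (points_locally_finite Z)).

(* The zero set of [f]; the value at those [f] whose zero set is not locally
   finite is a mere convention. *)
Definition zeros (f : R -> R) : configuration :=
  if pselect (locally_finite [set t | f t = 0]) is left h
  then Configuration h else point.

Definition count_events : set (set configuration) :=
  \bigcup_(A in @measurable _ (measurableTypeR R))
    preimage_set_system setT
      (fun Z : configuration => counting (points Z `&` A) : \bar R)
      (@measurable _ (\bar R)).

End point_configurations.
Arguments configuration R : clear implicits.
Arguments count_events R : clear implicits.

Notation point_space R := (g_sigma_algebraType (count_events R)).

Definition coordinate_events (R : realType) : set (set (R -> R)) :=
  \bigcup_(t in [set: R])
    preimage_set_system setT (fun f : R -> R => f t)
      (@measurable _ (measurableTypeR R)).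

Arguments coordinate_events R : clear implicits.

Notation path_space R := (g_sigma_algebraType (coordinate_events R)).

Section processes.
Context {R : realType} {d : measure_display} {Omega : measurableType d}.
Variable P : probability Omega R.

(* A constant counts as Gaussian; it is listed separately because
   [normal_prob m 0] is not a Dirac mass. *)
Definition gaussian_rv (Y : Omega -> R) :=
  exists m s : R, forall A : set (measurableTypeR R), measurable A ->
    P (Y @^-1` A) = if s == 0 then \d_m A else normal_prob m s A.

Definition gaussian_process (X : R -> Omega -> R) :=
  forall (n : nat) (t a : 'I_n -> R),
    gaussian_rv (fun w => \sum_(i < n) a i * X (t i) w).

Definition sigma_completed d' (T : measurableType d') (f : Omega -> T) :
    set (set Omega) :=
  <<s preimage_set_system setT f measurable `|` P.-negligible >>.

Definition completely_predictable (Z : Omega -> point_space R) :=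
  sigma_completed Z =
  \bigcap_(t in [set: R])
    sigma_completed (fun w => config_restrict `]-oo, t[ (Z w) : point_space R).

Definition maximally_rigid (Z : Omega -> point_space R) :=
  forall phi : point_space R -> measurableTypeR R,
    measurable_fun setT phi ->
    (exists M : R, forall z, `|phi z| <= M) ->
  forall T : R, 0 < T ->
  forall B : set (measurableTypeR R), measurable B ->
    sigma_completed (fun w => config_restrict (~` `[- T, T]) (Z w) : point_space R)
      [set w | B (phi (config_restrict `[- T, T] (Z w)))].

Definition mean_to_zero (g : R -> \bar R) :=
  ((T^-1)%:E * \int[lebesgue_measure]_(t in `[0%R, T]) `|g t|)%E
    @[T --> +oo%R] --> 0%E.

(* The events of the sigma-algebra of X are the [X \in A] for A measurable in
   the path space; translating [X \in B] by t amounts to replacing X by the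
   process X(. - t), whose zero set is that of X translated by t. *)
Definition weakly_mixing_process (X : R -> Omega -> R) :=
  forall A B : set (path_space R), measurable A -> measurable B ->
  mean_to_zero (fun t =>
    P [set w | A (fun s => X s w) /\ B (fun s => X (s - t)%R w)]
    - P [set w | A (fun s => X s w)] * P [set w | B (fun s => X s w)])%E.

Definition weakly_mixing_points (Z : Omega -> point_space R) :=
  forall A B : set (point_space R), measurable A -> measurable B ->
  mean_to_zero (fun t =>
    P [set w | A (Z w) /\ B (config_shift t (Z w))]
    - P [set w | A (Z w)] * P [set w | B (Z w)])%E.

End processes.

(* Main.v *)
Require Import Defs.
From HB Require Import structures.
From mathcomp Require Import all_boot all_order all_algebra.
From mathcomp Require Import all_classical all_reals all_analysis.
From mathcomp Require Import measurable_realfun.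
From mathcomp Require Import ring lra zify.
Set Implicit Arguments.
Unset Strict Implicit.
Unset Printing Implicit Defensive.
Import Order.TTheory GRing.Theory Num.Theory.
Import numFieldNormedType.Exports.
Local Open Scope classical_set_scope.
Local Open Scope ring_scope.

(* The identity n! lambda_k = pi n! / k! makes n! an almost period of C up to the sign
   (-1) ^ (n + 1), with a summable error O(1 / n ^ 2). Hence X (p - n!) converges to X p, up to
   these signs, almost surely for each dyadic p, and cos (n! x), up to the same signs, converges
   to 1 for mu-almost every x; the latter set is Lebesgue-null because the cos (n! x) are
   orthogonal on periods.

   Predictability. By Borel-Cantelli, almost every path is away from zero at the dyadic points
   of level n, by much more than its second differences at that level; this forces two dyadic
   neighbours with equal signs to have no zero between them. So the zero set is determined by
   the relative signs of X at pairs of dyadic points, which can be read off the zeros near the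
   remote past points p - n! by counting sign changes modulo 2.

   Mixing. C vanishes at all differences of the points (2 j + 2)! / 2. On the spectral side
   the corresponding exponentials are orthonormal, which excludes atoms; for the process,
   Bessel's inequality for the translates of C shows that C ^ 2 has mean zero over long
   intervals. For finite trigonometric functionals of a Gaussian path the decorrelation is
   bounded by the covariances, and such functionals are dense in L^1 of the path law. Weak
   mixing makes the shift invariant event [sup |X| <= M] have probability 0 or 1, and it is not
   1 since X 0 is unbounded. *)

(** * Recurrence and zeros of the covariance *)

(** The past reveals zeros and never a value of X, so only relative signs can be recovered; the
    unknown factors (-1) ^ (n + 1) then cancel, their squares being 1. As n! is an integer, p - n!
    lies on the same dyadic grid as p, so a single family of grids serves near the origin and in the
    remote past. The level from which a path is generic depends on the window and is not controlled
    along the points p - n!; the formula that reads signs off the past therefore lets the refinement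
    level depend on n.

    Paths are only assumed continuous. Smoothness enters through second differences alone, whose
    variance is O(h ^ 4) because the finite products are averages of cosines with frequencies in
    [-2 pi, 2 pi]; zeros are controlled without any derivative of X.

    C does not tend to 0, since |C (n!)| tends to 1. Decorrelation can thus hold only in mean, and
    what replaces decay of C is one infinite orthonormal family of translates: for i < j, (2 j + 2)!
    is an even multiple of (2 i + 2)!, which makes the factor of index 2 i + 2 the cosine of an odd
    multiple of pi / 2. *)

Section trigonometric_bounds.
Context {R : realType}.
Implicit Types x y t : R.

Lemma MVT_lipschitz (f df : R -> R) (M : R) x y :
  (forall z, is_derive z (1 : R) f (df z)) -> (forall z, `|df z| <= M) ->
  `|f x - f y| <= M * `|x - y|.
Proof.
move=> dfE dfM.
wlog xy : x y / x < y.
  move=> H; case: (ltgtP x y) => [xy|yx|->]; first exact: H.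
    by rewrite distrC (distrC x); exact: H.
  by rewrite !subrr normr0 mulr0.
have cf : continuous f.
  move=> z; apply: differentiable_continuous; apply/derivable1_diffP.
  by case: (dfE z).
have [|c _ E] := @MVT _ f df x y xy (fun z _ => dfE z).
  exact: continuous_subspaceT.
by rewrite distrC E normrM (distrC x) ler_wpM2r.
Qed.

Lemma ler_norm_sinB x y : `|sin x - sin y| <= `|x - y|.
Proof.
rewrite -[leRHS]mul1r; apply: (@MVT_lipschitz _ (fun z => cos z)) => z.
by rewrite ler_norml cos_geN1 cos_le1.
Qed.

Lemma ler_norm_sin x : `|sin x| <= `|x|.
Proof. by have := ler_norm_sinB x 0; rewrite sin0 !subr0. Qed.

Lemma cos_norm_le1 x : `|cos x| <= 1.
Proof. by rewrite ler_norml cos_geN1 cos_le1. Qed.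

Lemma sin_norm_le1 x : `|sin x| <= 1.
Proof. by rewrite ler_norml sin_geN1 sin_le1. Qed.

Lemma onem_cosE x : 1 - cos x = 2 * sin (x / 2) ^+ 2.
Proof.
have {1}-> : x = (x / 2) *+ 2 by rewrite -mulr_natr -mulrA mulVf ?mulr1.
by rewrite cos_mulr2n cos2sin2 mulr2n; ring.
Qed.

Lemma onem_cos_le x : 1 - cos x <= x ^+ 2 / 2.
Proof.
rewrite onem_cosE -(real_normK (num_real (sin _))).
have h : `|sin (x / 2)| <= `|x / 2| by exact: ler_norm_sin.
have -> : x ^+ 2 / 2 = 2 * `|x / 2| ^+ 2 by rewrite real_normK ?num_real//; field.
by rewrite ler_pM2l// ler_pXn2r ?nnegrE.
Qed.

Lemma cosDcosB x y : cos x * cos y = (cos (x + y) + cos (x - y)) / 2.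
Proof. by rewrite cosD cosB; field. Qed.

Lemma cos_natpi n x : cos (x + n%:R * pi) = (-1) ^+ n * cos x.
Proof.
elim: n => [|n IH]; first by rewrite mul0r addr0 mul1r.
by rewrite -natr1 mulrDl mul1r addrA cosDpi IH exprS !mulNr mul1r.
Qed.

Lemma cos_odd_pihalf n : odd n -> cos (n%:R * pi / 2 : R) = 0.
Proof.
move=> on; rewrite -(odd_double_half n) on add1n.
have -> : n./2.*2.+1%:R * pi / 2 = pi / 2 + n./2%:R * pi :> R.
  by rewrite -natr1 -muln2 natrM; field.
by rewrite cos_natpi cos_pihalf mulr0.
Qed.

End trigonometric_bounds.

Section dyadic_convergence.
Context {R : realType}.

(** Serves twice: for the existence of the infinite product and, started at index n, for the rate of
    its tail at n!. *)
Lemma dyadic_series_cvg (u : R^nat) (A : R) (N : nat) :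
  (forall k, (N <= k)%N -> `|u k.+1 - u k| <= A * 2^-1 ^+ (k - N)) ->
  cvgn u /\ `|limn u - u N| <= 2 * A.
Proof.
move=> uA.
have A0 : 0 <= A.
  have := uA N (leqnn N); rewrite subnn expr0 mulr1.
  exact: le_trans.
(* The subtracted tail is what lets the induction on m close. *)
have bnd k m : (N <= k)%N ->
   `|u (k + m)%N - u k| <= 2 * A * 2^-1 ^+ (k - N) - 2 * A * 2^-1 ^+ (k + m - N).
  move=> Nk; elim: m => [|m IH]; first by rewrite addn0 !subrr normr0.
  have -> : u (k + m.+1)%N - u k = (u (k + m).+1 - u (k + m)%N) + (u (k + m)%N - u k).
    by rewrite addnS; ring.
  apply: (le_trans (ler_normD _ _)).
  have := uA _ (leq_trans Nk (leq_addr m k)).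
  move/lerD => /(_ _ _ IH) /le_trans; apply.
  rewrite addnS subSn ?(leq_trans Nk (leq_addr m k))// exprS.
  by have -> : forall a b c : R, a * b + (2 * a * c - 2 * a * b) <= 2 * a * c - 2 * a * (2^-1 * b) by move=> a b c; lra.
have small : (fun m => 2 * A * 2^-1 ^+ m : R) @ \oo --> (0 : R).
  rewrite -[X in _ --> X](mulr0 (2 * A)); apply: cvgMr; apply: cvg_expr.
  by rewrite ger0_norm ?invr_ge0// invf_lt1// ltr1n.
(* Adding the geometric majorant makes the sequence nonincreasing and bounded below, so monotone
   convergence applies. *)
pose w m := u (N + m)%N + 2 * A * 2^-1 ^+ m.
have wN m : w m.+1 <= w m.
  rewrite /w addnS exprS; have := uA (N + m)%N (leq_addr _ _).
  rewrite addKn ler_norml => /andP[_].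
  by set d := 2^-1 ^+ m; move=> ?; lra.
have cw : cvgn w.
  apply: nonincreasing_is_cvgn; first exact/nonincreasing_seqP.
  exists (u N - 2 * A) => _ [m _ <-]; rewrite /w.
  have := bnd N m (leqnn N); rewrite subnn expr0 addKn mulr1 ler_norml => /andP[+ _].
  have : 0 <= 2 * A * 2^-1 ^+ m by rewrite mulr_ge0 ?mulr_ge0// exprn_ge0// invr_ge0.
  by lra.
have cu : (fun m => u (m + N)%N) @ \oo --> limn w.
  rewrite -[X in _ --> X]subr0.
  have -> : (fun m => u (m + N)%N) = (fun m => w m - 2 * A * 2^-1 ^+ m).
    by apply/funext => m; rewrite /w addnC addrK.
  exact: cvgB cw small.
have lu : u @ \oo --> limn w by move: cu; rewrite cvg_shiftn.
have -> : limn u = limn w by apply/cvg_lim.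
split; first exact: lu.
have cn : (fun m => `|u (m + N)%N - u N|) @ \oo --> `|limn w - u N|.
  by apply: cvg_norm; apply: cvgB => //; exact: cvg_cst.
rewrite -(cvg_lim _ cn)//; apply: limr_le; first by apply/cvg_ex; eexists; exact: cn.
apply: nearW => m; rewrite addnC; apply: (le_trans (bnd N m (leqnn N))).
by rewrite subnn expr0 mulr1 addKn gerBl mulr_ge0 ?mulr_ge0// exprn_ge0// invr_ge0.
Qed.

End dyadic_convergence.

Section covariance_facts.
Context {R : realType}.
Notation lam := (@lambda_ R).
Notation C := (cos_product (@lambda_ R)).

Definition cos_partial (n : nat) (t : R) : R :=
  \prod_(1 <= k < n.+1) cos (lam k * t).

Lemma cos_partialS n t : cos_partial n.+1 t = cos_partial n t * cos (lam n.+1 * t).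
Proof. by rewrite /cos_partial big_nat_recr. Qed.

Lemma cos_partial0 t : cos_partial 0 t = 1.
Proof. by rewrite /cos_partial big_geq. Qed.

Lemma cos_partial_norm_le1 n t : `|cos_partial n t| <= 1.
Proof.
elim: n => [|n IH]; first by rewrite cos_partial0 normr1.
by rewrite cos_partialS normrM mulr_ile1 ?cos_norm_le1.
Qed.

Lemma cos_partialB n t :
  `|cos_partial n.+1 t - cos_partial n t| <= (lam n.+1 * t) ^+ 2 / 2.
Proof.
rewrite cos_partialS -[X in _ - X]mulr1 -mulrBr normrM distrC.
rewrite -[leRHS]mul1r ler_pM// ?cos_partial_norm_le1//.
by rewrite ger0_norm ?onem_cos_le// subr_ge0 cos_le1.
Qed.

Lemma lambda_ge0 n : 0 <= lam n :> R.
Proof. by rewrite /lambda_ divr_ge0 ?pi_ge0. Qed.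

(** Beyond n + 1 each of the m further factors of (n + m + 1)! is at least 2. Hence n! lambda_(n + m
    + 1) decays geometrically in m, with the prefactor pi / (n + 1) that yields the rate 1 / n ^ 2
    after squaring. *)
Lemma fact_geometric n m : (n`! * (n.+1 * 2 ^ m) <= (n + m).+1`!)%N.
Proof.
elim: m => [|m IH]; first by rewrite addn0 expn0 muln1 factS mulnC.
rewrite addnS factS expnS (mulnCA n.+1) mulnCA.
by rewrite leq_mul.
Qed.

Lemma lambda_geometric n m :
  lam (n + m).+1 * n`!%:R <= pi / n.+1%:R * 2^-1 ^+ m :> R.
Proof.
rewrite /lambda_ -!mulrA ler_pM2l ?pi_gt0// exprVn mulrC -natrX -invfM -natrM.
rewrite ler_pdivrMr ?ltr0n ?fact_gt0// mulrC ler_pdivlMr ?ltr0n ?muln_gt0 ?expn_gt0//.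
by rewrite -natrM ler_nat fact_geometric.
Qed.

Lemma sqr_half_exp (m : nat) : (2^-1 ^+ m : R) ^+ 2 <= 2^-1 ^+ m.
Proof.
rewrite expr2 -[leRHS]mulr1 ler_pM ?exprn_ge0 ?invr_ge0//.
by rewrite exprn_ile1// ?invr_ge0// invf_le1// ler1n.
Qed.

Lemma cos_partial_fact_step n m :
  `|cos_partial (n + m).+1 n`!%:R - cos_partial (n + m) n`!%:R| <=
  (pi / n.+1%:R) ^+ 2 / 2 * 2^-1 ^+ m.
Proof.
apply: (le_trans (cos_partialB _ _)).
have h : (lam (n + m).+1 * n`!%:R) ^+ 2 <= (pi / n.+1%:R) ^+ 2 * 2^-1 ^+ m :> R.
  apply: (@le_trans _ _ ((pi / n.+1%:R * 2^-1 ^+ m) ^+ 2)).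
    rewrite ler_pXn2r ?nnegrE ?mulr_ge0 ?lambda_ge0 ?pi_ge0 ?exprn_ge0 ?invr_ge0//.
    exact: lambda_geometric.
  by rewrite exprMn ler_wpM2l ?sqr_ge0 ?sqr_half_exp.
by rewrite [leRHS]mulrAC ler_pM2r ?invr_gt0.
Qed.

Lemma cos_partial_cvg t : cos_partial ^~ t @ \oo --> C t.
Proof.
suff [] : cvgn (cos_partial ^~ t) /\ `|limn (cos_partial ^~ t) - cos_partial 0 t| <=
    2 * ((pi * t) ^+ 2 / 2) by [].
apply: (@dyadic_series_cvg R (cos_partial ^~ t)) => k _; rewrite subn0.
apply: (le_trans (cos_partialB _ _)).
have := lambda_geometric 0 k; rewrite fact0 mulr1 divr1 add0n => h.
rewrite [leRHS]mulrAC ler_pM2r ?invr_gt0// (exprMn _ (lam _)) (exprMn _ pi t) [leRHS]mulrAC.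
rewrite ler_wpM2r ?sqr_ge0//.
apply: (@le_trans _ _ ((pi * 2^-1 ^+ k) ^+ 2)).
  by rewrite ler_pXn2r ?nnegrE ?mulr_ge0 ?lambda_ge0 ?pi_ge0 ?exprn_ge0 ?invr_ge0.
by rewrite exprMn ler_wpM2l ?sqr_ge0 ?sqr_half_exp.
Qed.

(** At (n + 2)! the factors of index at most n are cosines of even multiples of pi; the last two are
    cos ((n + 2) pi) and cos pi, which produce the sign. *)
Lemma cos_partial_fact n :
  cos_partial n.+2 n.+2`!%:R = (-1) ^+ n.+3 :> R.
Proof.
rewrite !cos_partialS.
have -> : cos_partial n n.+2`!%:R = 1 :> R.
  rewrite /cos_partial big_nat_cond big1// => k /andP[/andP[_ kn] _].
  have [q Eq] : exists q, n.+2`! = (k`! * q.*2)%N.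
    have /dvdnP[q Eq] : (k`! %| n`!)%N by rewrite (@fact_split n k) ?dvdn_mulr// -ltnS.
    (* One of two consecutive integers is even. *)
    have /dvdnP[r Er] : (2 %| n.+2 * n.+1)%N.
      by rewrite dvdn2 oddM /= negbK andbC; case: odd.
    by exists (q * r)%N; rewrite !factS mulnA Er Eq -muln2; ring.
  rewrite Eq /lambda_ natrM.
  have -> : pi / k`!%:R * (k`!%:R * q.*2%:R) = 0 + q.*2%:R * pi :> R.
    have : k`!%:R != 0 :> R by rewrite pnatr_eq0 -lt0n fact_gt0.
    by move=> ?; field.
  by rewrite cos_natpi cos0 mulr1 -muln2 mulnC exprM sqrrN expr1n expr1n.
have k0 k : k`!%:R != 0 :> R by rewrite pnatr_eq0 -lt0n fact_gt0.
have -> : lam n.+1 * n.+2`!%:R = 0 + n.+2%:R * pi :> R.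
  by rewrite /lambda_ (factS n.+1) natrM; have := k0 n.+1 => ?; field.
have -> : lam n.+2 * n.+2`!%:R = 0 + 1%:R * pi :> R.
  by rewrite /lambda_; have := k0 n.+2 => ?; field.
by rewrite !cos_natpi cos0 mul1r !mulr1 expr1 -exprSr.
Qed.

Lemma cos_partial_lim_le (a : R) (t : R) (F : R -> R) :
  continuous F -> (forall n, F (cos_partial n t) <= a) -> F (C t) <= a.
Proof.
move=> cF H; have h : (fun n => F (cos_partial n t)) @ \oo --> F (C t).
  by apply: continuous_cvg; [exact: cF|exact: cos_partial_cvg].
rewrite -(cvg_lim _ h)//; apply: limr_le; last exact: nearW.
by apply/cvg_ex; eexists; exact: h.
Qed.

Lemma cosprod_norm_le1 t : `|C t| <= 1.
Proof.
apply: (@cos_partial_lim_le 1 t (fun x => `|x|)); first exact: norm_continuous.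
by move=> n; exact: cos_partial_norm_le1.
Qed.

Lemma cosprod0 : C 0 = 1 :> R.
Proof.
apply/cvg_lim => //.
rewrite (_ : (fun n => _) = cst 1); first exact: cvg_cst.
by apply/funext => n; rewrite big1// => k _; rewrite mulr0 cos0.
Qed.

Lemma cosprodN t : C (- t) = C t :> R.
Proof.
congr (limn _); apply/funext => n; apply: eq_bigr => k _.
by rewrite mulrN cosN.
Qed.

Lemma cosprod_eq0 (k : nat) (t : R) : (0 < k)%N -> cos (lam k * t) = 0 -> C t = 0.
Proof.
move=> k0 ck; apply/cvg_lim => //.
rewrite -(cvg_shiftn k) (_ : (fun n => _) = cst 0); first exact: cvg_cst.
apply/funext => n; rewrite (big_cat_nat (n := k))//=; last first.
  by rewrite (leq_trans (leq_addl n k)).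
by rewrite [X in _ * X]big_ltn ?ltnS ?leq_addl// ck mul0r mulr0.
Qed.

Lemma measurable_cosprod : measurable_fun setT (C : R -> R).
Proof.
apply: (@measurable_fun_cvg _ _ _ _ (cos_partial : nat -> R -> R)) => [n|x _].
  rewrite /cos_partial; apply: measurable_prod => k _.
  apply: (@continuous_measurable_fun _ (fun t => cos (lam k * t))) => x.
  apply: continuous_comp; last exact: continuous_cos.
  by apply: continuousM; [exact: cst_continuous|exact: cvg_id].
exact: cos_partial_cvg.
Qed.

(* Constant in the recurrence rate: [pi ^+ 2] bounds the tail of the product for [n >= 2],
   the summand [8] covers [n < 2]. *)
Definition rate_cst : R := pi ^+ 2 + 8.

Lemma cosprod_fact n : 1 - (-1) ^+ n.+1 * C n`!%:R <= rate_cst / n.+1%:R ^+ 2 :> R.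
Proof.
have small : (n < 2)%N -> 1 - (-1) ^+ n.+1 * C n`!%:R <= rate_cst / n.+1%:R ^+ 2 :> R.
  move=> n2; apply: (@le_trans _ _ 2).
    have := cosprod_norm_le1 n`!%:R.
    have -> : `|C n`!%:R| = `|(-1) ^+ n.+1 * C n`!%:R| :> R by rewrite normrM normr_sign mul1r.
    by rewrite ler_norml => /andP[h _]; lra.
  rewrite ler_pdivlMr ?exprn_gt0//; apply: (@le_trans _ _ 8).
    have : n.+1%:R ^+ 2 <= 2 ^+ 2 :> R by rewrite ler_pXn2r ?nnegrE// ler_nat.
    by lra.
  by rewrite /rate_cst; have := sqr_ge0 (pi : R); lra.
case: n small => [|[|n]] small; [exact: small|exact: small|].
(* The partial product stopped at n + 2 is exactly the sign, so the tail from there on is the whole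
   error; summing the geometric increments doubles the bound (pi / (n + 3)) ^ 2 / 2. *)
have step k : (n.+2 <= k)%N ->
  `|cos_partial k.+1 n.+2`!%:R - cos_partial k n.+2`!%:R| <=
    (pi / n.+3%:R) ^+ 2 / 2 * 2^-1 ^+ (k - n.+2) :> R.
  by move=> nk; have := cos_partial_fact_step n.+2 (k - n.+2); rewrite subnKC.
have [_] := dyadic_series_cvg step.
rewrite -/(C _) cos_partial_fact => h.
have -> : 1 - (-1) ^+ n.+3 * C n.+2`!%:R = - ((-1) ^+ n.+3 * (C n.+2`!%:R - (-1) ^+ n.+3)) :> R.
  by rewrite mulrBr -expr2 sqrr_sign; ring.
apply: (le_trans (ler_norm _)); rewrite normrN normrM normr_sign mul1r.
apply: (le_trans h); rewrite expr_div_n /rate_cst [leRHS]mulrDl.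
by rewrite mulrCA divff// mulr1 lerDl divr_ge0 ?exprn_ge0.
Qed.

Definition orth_time (j : nat) : R := j.*2.+2`!%:R / 2.

Lemma cosprod_orth_time i j : i != j -> C (orth_time i - orth_time j) = 0 :> R.
Proof.
wlog ij : i j / (i < j)%N.
  move=> H nij; have := nij; rewrite neq_ltn => /orP[ij|ji]; first exact: H.
  by rewrite -opprB cosprodN; apply: H => //; rewrite eq_sym.
move=> _; apply: (@cosprod_eq0 i.*2.+2) => //.
(* The factor 2 j + 2 of the larger factorial makes the quotient even; after subtracting 1 the
   multiple of pi / 2 is odd. *)
have [Q EQ] : exists Q, j.*2.+2`! = (i.*2.+2`! * Q.*2)%N.
  have -> : j.*2 = (j.-1.*2).+2 by rewrite -doubleS prednK// (leq_ltn_trans _ ij).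
  set m := j.-1.*2; have h : (i.*2.+2 <= m.+2)%N by rewrite /m; lia.
  rewrite (factS m.+3) (factS m.+2) (@fact_split m.+2 i.*2.+2)//.
  have -> : m.+4 = (j.-1.+2).*2 by rewrite /m; lia.
  set P := (\prod_(_ <= k < _) k)%N.
  exists (j.-1.+2 * (m.+3 * P))%N.
  by rewrite (mulnCA m.+3) mulnCA doubleMl.
have k0 : i.*2.+2`!%:R != 0 :> R by rewrite pnatr_eq0 -lt0n fact_gt0.
rewrite /orth_time /lambda_ EQ -cosN.
have [Q0|Q0] := posnP Q.
  by have := fact_gt0 j.*2.+2; rewrite EQ Q0 muln0.
have -> : - (pi / i.*2.+2`!%:R * (i.*2.+2`!%:R / 2 - (i.*2.+2`! * Q.*2)%:R / 2)) =
   Q.*2.-1%:R * pi / 2 :> R.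
  have -> : Q.*2.-1%:R = Q.*2%:R - 1 :> R.
    by rewrite -[in RHS](@prednK Q.*2) ?double_gt0// -natr1 addrK.
  by rewrite natrM; field.
by apply: cos_odd_pihalf; rewrite -subn1 oddB ?double_gt0// odd_double.
Qed.

(** All signed sums of lambda_1, ..., lambda_n, with multiplicity: the values of the finite
    Rademacher sum, each of weight 2 ^ - n. *)
Fixpoint frequencies (n : nat) : seq R :=
  if n is m.+1 then
    [seq s + lam n | s <- frequencies m] ++ [seq s - lam n | s <- frequencies m]
  else [:: 0].

Lemma cos_partial_frequencies n t :
  cos_partial n t = 2^-1 ^+ n * \sum_(s <- frequencies n) cos (s * t).
Proof.
elim: n => [|n IH]; first by rewrite cos_partial0 big_seq1 mul0r cos0 mulr1.
rewrite cos_partialS IH big_cat/= !big_map -big_split/= exprS.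
rewrite -(mulrA (2^-1 ^+ n)) [in RHS](mulrC 2^-1) -[in RHS](mulrA (2^-1 ^+ n)).
congr (2^-1 ^+ n * _).
rewrite mulr_suml mulr_sumr; apply: eq_bigr => s _.
by rewrite cosDcosB [RHS]mulrC; congr ((cos _ + cos _) / 2); ring.
Qed.

Lemma size_frequencies n : size (frequencies n) = (2 ^ n)%N.
Proof. by elim: n => [//|n IH]; rewrite size_cat !size_map IH addnn -mul2n expnS. Qed.

Lemma frequencies_bound n s : s \in frequencies n -> `|s| <= 2 * pi.
Proof.
(* Strengthened by a geometric remainder, which the next lambda_(n + 1) <= pi / 2 ^ n halves. *)
suff H : s \in frequencies n -> `|s| <= 2 * pi - 2 * pi * 2^-1 ^+ n.
  move=> /H /le_trans; apply; rewrite gerBl !mulr_ge0 ?pi_ge0//.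
elim: n s => [|n IH] s; first by rewrite inE => /eqP->; rewrite normr0 expr0 mulr1 subrr.
rewrite mem_cat => sn.
have [r [rn rs]] : exists r, r \in frequencies n /\ `|s| <= `|r| + lam n.+1.
  case/orP: sn => /mapP[r rn ->]; exists r; split => //.
    by rewrite (le_trans (ler_normD _ _))// (ger0_norm (lambda_ge0 _)).
  by rewrite (le_trans (ler_normB _ _))// (ger0_norm (lambda_ge0 _)).
have := IH _ rn; have := lambda_geometric 0 n; rewrite fact0 mulr1 divr1 add0n.
by move: rs; rewrite exprS; set e := 2^-1 ^+ n; lra.
Qed.

Lemma frequencies_mean n (c : R) : 2^-1 ^+ n * \sum_(s <- frequencies n) c = c.
Proof.
rewrite big_const_seq count_predT size_frequencies iter_addr_0 -(mulr_natr c) natrX.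
by rewrite mulrCA -exprMn mulVf// expr1n mulr1.
Qed.

(** The left side is the variance of X (x + h) - 2 X x + X (x - h). For a finite product it is the
    average over the frequencies s of 4 (1 - cos (s h)) ^ 2 <= (s h) ^ 4, with |s| <= 2 pi. *)
Lemma cosprod_diff4 h :
  6 - 8 * C h + 2 * C (2 * h) <= (2 * pi * h) ^+ 4 :> R.
Proof.
have H n : 6 - 8 * cos_partial n h + 2 * cos_partial n (2 * h) <= (2 * pi * h) ^+ 4.
  rewrite !cos_partial_frequencies.
  have -> : 6 - 8 * (2^-1 ^+ n * \sum_(s <- frequencies n) cos (s * h)) +
     2 * (2^-1 ^+ n * \sum_(s <- frequencies n) cos (s * (2 * h))) =
     2^-1 ^+ n * \sum_(s <- frequencies n) (4 * (1 - cos (s * h)) ^+ 2).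
    rewrite -[in LHS](frequencies_mean n 6).
    rewrite (mulrCA 8) (mulrCA 2 (_ ^+ n)) -mulrBr -mulrDr; congr (_ * _).
    rewrite !big_distrr/= -sumrB -big_split/=; apply: eq_bigr => s _.
    have -> : s * (2 * h) = (s * h) *+ 2 by rewrite -mulr_natr; ring.
    by rewrite cos_mulr2n -mulr_natr; ring.
  rewrite -[leRHS](frequencies_mean n).
  rewrite ler_wpM2l ?exprn_ge0 ?invr_ge0// big_seq [leRHS]big_seq ler_sum// => s sn.
  have c0 : 0 <= 1 - cos (s * h) by rewrite subr_ge0 cos_le1.
  apply: (@le_trans _ _ (4 * ((s * h) ^+ 2 / 2) ^+ 2)).
    rewrite ler_pM2l// ler_pXn2r ?nnegrE ?onem_cos_le//.
    by rewrite divr_ge0// sqr_ge0.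
  have -> : 4 * ((s * h) ^+ 2 / 2) ^+ 2 = `|s * h| ^+ 4.
    by rewrite -[4%N]/(2 * 2)%N exprM real_normK ?num_real//; field.
  have -> : (2 * pi * h) ^+ 4 = `|2 * pi * h| ^+ 4.
    by rewrite -[4%N]/(2 * 2)%N !exprM real_normK ?num_real.
  rewrite ler_pXn2r ?nnegrE// !normrM ler_wpM2r// -normrM.
  by rewrite (le_trans (frequencies_bound sn))// ler_norm.
have cv : (fun n => 6 - 8 * cos_partial n h + 2 * cos_partial n (2 * h)) @ \oo -->
    6 - 8 * C h + 2 * C (2 * h).
  apply: cvgD; last by apply: cvgMr; exact: cos_partial_cvg.
  by apply: cvgB; [exact: cvg_cst|apply: cvgMr; exact: cos_partial_cvg].
rewrite -(cvg_lim _ cv)//; apply: limr_le; last exact: nearW.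
by apply/cvg_ex; eexists; exact: cv.
Qed.

End covariance_facts.

(** * Gaussian laws on the line *)

Lemma cvgn_ler (R : realType) (u : nat -> R) (l a : R) :
  u n @[n --> \oo] --> l -> (forall n, u n <= a) -> l <= a.
Proof.
move=> ul ua; rewrite -(cvg_lim _ ul)//; apply: limr_le; last exact: nearW.
by apply/cvg_ex; exists l.
Qed.

Lemma cvgn0_le (R : realType) (u v : nat -> R) :
  (forall n, `|u n| <= v n) -> v n @[n --> \oo] --> (0 : R) -> u n @[n --> \oo] --> (0 : R).
Proof.
move=> uv v0; apply: norm_cvg0.
apply: (@squeeze_cvgr _ _ _ _ (cst 0) _ _ _ _ _ v0); last exact: cvg_cst.
by apply: nearW => n; rewrite /= normr_ge0 uv.
Qed.

Section bounded_integration.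
Context d (T : measurableType d) (R : realType) (mu : {measure set T -> \bar R}).

Lemma Rdominated_cvg (D : set T) (f_ : nat -> T -> R) (f g : T -> R) :
  measurable D ->
  (forall n, measurable_fun D (f_ n)) ->
  (forall x, D x -> f_ n x @[n --> \oo] --> f x) ->
  mu.-integrable D (EFin \o g) ->
  (forall n x, D x -> `|f_ n x| <= g x) ->
  (\int[mu]_(x in D) f_ n x)%R @[n --> \oo] --> (\int[mu]_(x in D) f x)%R.
Proof.
move=> mD mf ff ig fg.
have intn n : mu.-integrable D (EFin \o f_ n).
  apply: le_integrable ig => //; first exact/measurable_EFinP.
  by move=> x Dx; rewrite /= lee_fin (le_trans (fg n x Dx))// ler_norm.
have mlim : measurable_fun D f by apply: (measurable_fun_cvg mf).
have fg' x : D x -> `|f x| <= g x.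
  move=> Dx; apply: (@cvgn_ler _ (fun n => `|f_ n x|)); last by move=> n; exact: fg.
  by apply: cvg_norm; exact: ff.
have intf : mu.-integrable D (EFin \o f).
  apply: le_integrable ig => //; first exact/measurable_EFinP.
  by move=> x Dx; rewrite /= lee_fin (le_trans (fg' x Dx))// ler_norm.
apply: fine_cvg; rewrite fineK ?integrable_fin_num//.
apply: (@dominated_cvg _ _ _ mu D mD (fun n => EFin \o f_ n) (EFin \o f) (EFin \o g)) => //.
- by move=> n; exact/measurable_EFinP.
- by move=> x Dx; apply: cvg_EFin; [exact: nearW|exact: ff].
Qed.

End bounded_integration.

Lemma finite_bounded_integrable d (T : measurableType d) (R : realType)
    (mu : {measure set T -> \bar R}) (f : T -> R) (M : R) : (mu setT < +oo)%E ->
  measurable_fun setT f -> (forall x, `|f x| <= M) -> mu.-integrable setT (EFin \o f).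
Proof.
move=> mufin mf fM; apply: measurable_bounded_integrable => //.
exists M; split; first exact: num_real.
by move=> N MN x _; rewrite /= (le_trans (fM x))// ltW.
Qed.

Lemma bounded_integrable d (T : measurableType d) (R : realType)
    (mu : {finite_measure set T -> \bar R}) (f : T -> R) (M : R) :
  measurable_fun setT f -> (forall x, `|f x| <= M) -> mu.-integrable setT (EFin \o f).
Proof.
by apply: finite_bounded_integrable; rewrite ltey_eq fin_num_measure.
Qed.

Section gaussian_calculus.
Context {R : realType}.
Notation leb := (@lebesgue_measure R).

(** Exhausts the line by [-n, n]: the fundamental theorem of calculus gives the limit 0 and
    dominated convergence the full integral. This is integration by parts with the boundary terms
    already discarded. *)
Lemma integral_derivative_eq0 (G g : R -> R) :
  (forall x, is_derive x (1 : R) G (g x)) -> continuous g ->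
  leb.-integrable setT (EFin \o g) ->
  G n%:R @[n --> \oo] --> (0 : R) -> G (- n%:R) @[n --> \oo] --> (0 : R) ->
  (\int[leb]_x g x)%R = 0.
Proof.
move=> dG cg ig Gy GNy.
have cG : continuous G.
  by move=> z; apply/differentiable_continuous/derivable1_diffP; case: (dG z).
have FTC n : (\int[leb]_(x in `[- n.+1%:R, n.+1%:R]) g x)%R = G n.+1%:R - G (- n.+1%:R).
  rewrite /Rintegral (@continuous_FTC2 _ g G)//.
  - by rewrite (@lt_trans _ _ 0)// ?oppr_lt0.
  - exact: continuous_subspaceT.
  - split.
    + by move=> x _; case: (dG x).
    + by apply: cvg_at_right_filter; exact: cG.
    + by apply: cvg_at_left_filter; exact: cG.
  - by move=> x _; rewrite derive1E; exact: derive_val.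
have h1 : (\int[leb]_(x in `[- n.+1%:R, n.+1%:R]) g x)%R @[n --> \oo] --> (0 : R).
  rewrite (_ : (fun n => _) = (fun n => G n.+1%:R - G (- n.+1%:R))); last first.
    by apply/funext => n; exact: FTC.
  rewrite -[X in _ --> X](subr0 0); apply: cvgB.
    by rewrite (cvg_shiftS (fun n => G n%:R)).
  by rewrite (cvg_shiftS (fun n => G (- n%:R))).
have h2 : (\int[leb]_(x in `[- n.+1%:R, n.+1%:R]) g x)%R @[n --> \oo] --> (\int[leb]_x g x)%R.
  rewrite (_ : (fun n => _) = fun n => \int[leb]_x (g \_ `[- n.+1%:R, n.+1%:R]) x)%R; last first.
    by apply/funext => n; rewrite Rintegral_mkcond.
  apply: (@Rdominated_cvg _ _ _ leb setT (fun n => g \_ `[- n.+1%:R, n.+1%:R]) g (fun x => `|g x|)) => //.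
  - move=> n; apply: (measurable_restrictT _ _).1 => //.
    by apply: measurable_funTS; exact: continuous_measurable_fun.
  - move=> x _; apply: cvg_near_cst.
    near=> n; rewrite patchE mem_set//= in_itv/= -ler_norml.
    apply: (@le_trans _ _ n%:R); last by rewrite ler_nat.
    by near: n; apply: nbhs_infty_ger.
  - exact: integrable_norm.
  - by move=> n x _; rewrite patchE; case: ifP => //= _; rewrite normr0.
by apply: cvg_unique h1 => //.
Unshelve. all: by end_near. Qed.

Lemma is_derive_mul (f g : R -> R) (x a b : R) :
  is_derive x (1 : R) f a -> is_derive x (1 : R) g b ->
  is_derive x (1 : R) (fun y => f y * g y) (f x * b + g x * a).
Proof. by move=> fa gb; exact: is_deriveM. Qed.

Lemma is_derive_comp (f g : R -> R) (x a b : R) :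
  is_derive (g x) (1 : R) f a -> is_derive x (1 : R) g b ->
  is_derive x (1 : R) (fun y => f (g y)) (a * b).
Proof. by move=> fa gb; exact: is_derive1_comp. Qed.

Lemma is_derive_center (x m : R) : is_derive x (1 : R) (fun y => y - m) 1.
Proof.
apply: (is_derive_eq (is_deriveB (is_derive_id x 1) (is_derive_cst m x 1))).
by rewrite subr0.
Qed.

Lemma is_derive_affine (x m u b : R) : is_derive x (1 : R) (fun y => u * (y - m) + b) u.
Proof.
apply: (is_derive_eq (is_deriveD (is_derive_mul (is_derive_cst u x 1) (is_derive_center x m))
  (is_derive_cst b x 1))).
by rewrite /cst mulr1 mulr0 !addr0.
Qed.

Context (m s : R) (s0 : s != 0).
Notation p := (normal_pdf m s).

Let s2 : 0 < s ^+ 2. Proof. by rewrite exprn_even_gt0. Qed.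

Lemma normal_pdfEx x : p x = normal_peak s * expR (- (x - m) ^+ 2 / (s ^+ 2 *+ 2)).
Proof. by rewrite normal_pdfE. Qed.

Lemma is_derive_normal_pdf (x : R) :
  is_derive x (1 : R) p (- (x - m) / s ^+ 2 * p x).
Proof.
have -> : p = (fun y => normal_peak s * expR ((y - m) * (y - m) * (- (s ^+ 2 *+ 2)^-1))).
  by apply/funext => y; rewrite normal_pdfEx expr2 mulNr mulrN.
have := is_derive_mul (is_derive_cst (normal_peak s) x 1) (is_derive_comp (is_derive_expR _)
  (is_derive_mul (is_derive_mul (is_derive_center x m) (is_derive_center x m))
    (is_derive_cst (- (s ^+ 2 *+ 2)^-1) x 1))).
move/is_derive_eq; apply; rewrite /cst.
move: (expR _) (normal_peak s) => E q; field; exact: s0.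
Qed.

(** The square root of the density up to normalisation: one copy absorbs quadratic factors, the
    other remains as an integrable majorant. *)
Definition gauss_tail (x : R) := expR (- ((x - m) ^+ 2 / (s ^+ 2 *+ 4))).

Lemma normal_pdf_tail (x : R) :
  (1 + (x - m) ^+ 2) * p x <= normal_peak s * (1 + 4 * s ^+ 2) * gauss_tail x.
Proof.
set w := (x - m) ^+ 2 / (s ^+ 2 *+ 4).
have w0 : 0 <= w by rewrite divr_ge0 ?sqr_ge0// pmulrn_lge0// ltW.
have zE : (x - m) ^+ 2 = 4 * s ^+ 2 * w.
  by rewrite /w -mulr_natl; field; rewrite s0.
have -> : p x = normal_peak s * (gauss_tail x * gauss_tail x).
  rewrite normal_pdfEx /gauss_tail -expRD; congr (_ * expR _).
  by field; rewrite s0.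
rewrite mulrCA -mulrA ler_pM2l ?normal_peak_gt0// mulrA ler_pM2r ?expR_gt0// zE.
rewrite /gauss_tail -/w -(@ler_pM2r _ (expR w)) ?expR_gt0// -(mulrA _ (expR (- w))) -expRD addNr expR0 mulr1.
have := expR_ge1Dx w; nra.
Qed.

Lemma gauss_tail_cvg (c : R) : `|c| = 1 -> gauss_tail (c * n%:R) @[n --> \oo] --> (0 : R).
Proof.
move=> c1; pose k := (s ^+ 2 *+ 8)^-1.
have k0 : 0 < k by rewrite invr_gt0 pmulrn_lgt0.
have c2 : c ^+ 2 = 1 by rewrite -real_normK ?num_real// c1 expr1n.
apply: (@cvgn0_le _ _ (fun n => expR (m ^+ 2 / (s ^+ 2 *+ 4)) * expR (- k) ^+ n)).
- move=> n; rewrite ger0_norm ?expR_ge0//= /gauss_tail -expRM_natl -expRD ler_expR.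
  have n2 : n%:R <= n%:R ^+ 2 :> R by rewrite -natrX ler_nat; case: n => // n; rewrite leq_pmulr.
  have h : (n%:R / 2 - m ^+ 2) <= (c * n%:R - m) ^+ 2.
    have := sqr_ge0 (c * n%:R / 2 - m); rewrite !sqrrB !exprMn c2 !mul1r.
    have := sqr_ge0 (c * n%:R - 2 * m); rewrite !sqrrB !exprMn c2 !mul1r.
    by lra.
  have -> : m ^+ 2 / (s ^+ 2 *+ 4) + n%:R * - k = - ((n%:R / 2 - m ^+ 2) / (s ^+ 2 *+ 4)).
    by rewrite /k; field; rewrite s0.
  by rewrite lerN2 ler_pM2r// invr_gt0 pmulrn_lgt0.
- rewrite -[X in _ --> X](mulr0 (expR (m ^+ 2 / (s ^+ 2 *+ 4)))); apply: cvgMr.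
  apply: cvg_expr; rewrite ger0_norm ?expR_ge0// expR_lt1 oppr_lt0//.
Qed.

Lemma normal_pdf_integrable2 :
  leb.-integrable setT (EFin \o (fun x => (1 + (x - m) ^+ 2) * p x)).
Proof.
(* Doubling the variance halves the exponent, so this normal density is [gauss_tail] up to a
   constant. *)
pose s' := Num.sqrt 2 * s.
have s'0 : s' != 0 by rewrite mulf_neq0// sqrtr_eq0 -ltNge.
have := @integrable_normal_pdf R m s'.
move/(integrableZl measurableT (normal_peak s * (1 + 4 * s ^+ 2) / normal_peak s')).
apply: le_integrable => //.
  apply/measurable_EFinP; apply: measurable_funM; last exact: measurable_normal_pdf.
  apply: measurable_funD => //; apply: measurable_funX.
  exact: measurable_funB.
move=> x _; rewrite /= !lee_fin ger0_norm; last first.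
  by rewrite mulr_ge0 ?normal_pdf_ge0// addr_ge0 ?sqr_ge0.
apply: (le_trans (normal_pdf_tail x)); apply: le_trans (ler_norm _).
have -> : normal_pdf m s' x = normal_peak s' * normal_fun m s' x by rewrite normal_pdfE.
rewrite [leRHS]mulrA divfK; last by rewrite gt_eqF// normal_peak_gt0.
rewrite /gauss_tail /normal_fun.
suff -> : - ((x - m) ^+ 2 / (s ^+ 2 *+ 4)) = - (x - m) ^+ 2 / (s' ^+ 2 *+ 2) by [].
rewrite /s' exprMn sqr_sqrtr//; field; exact: s0.
Qed.

Lemma normal_pdf_dominated (h : R -> R) (K : R) :
  measurable_fun setT h -> (forall x, `|h x| <= K * (1 + (x - m) ^+ 2)) ->
  leb.-integrable setT (EFin \o (fun x => h x * p x)).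
Proof.
move=> mh hK.
have := integrableZl measurableT K normal_pdf_integrable2.
apply: le_integrable => //.
  by apply/measurable_EFinP; apply: measurable_funM => //; exact: measurable_normal_pdf.
move=> x _; rewrite /= !lee_fin; apply: le_trans (ler_norm _).
by rewrite normrM (ger0_norm (normal_pdf_ge0 _ _ _)) mulrA ler_wpM2r// normal_pdf_ge0.
Qed.

(** Stein's identity: s ^ 2 h p has derivative s ^ 2 h' p - (x - m) h p, and h of at most affine
    growth makes it vanish at infinity. It provides the mean, the variance and the characteristic
    function. *)
Lemma gaussian_integration_by_parts (h h' : R -> R) (K : R) :
  (forall x, is_derive x (1 : R) h (h' x)) -> continuous h' ->
  (forall x, `|h x| <= K * (1 + `|x - m|)) -> (forall x, `|h' x| <= K) ->
  (\int[leb]_x ((x - m) * h x * p x) = s ^+ 2 * \int[leb]_x (h' x * p x))%R.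
Proof.
move=> dh ch' hK h'K.
have K0 : 0 <= K by exact: le_trans (h'K 0).
have ch : continuous h.
  by move=> z; apply/differentiable_continuous/derivable1_diffP; case: (dh z).
have mh : measurable_fun setT h by exact: continuous_measurable_fun.
have mh' : measurable_fun setT h' by exact: continuous_measurable_fun.
have i1 : leb.-integrable setT (EFin \o (fun x => h' x * p x)).
  apply: (@normal_pdf_dominated _ K) => // x; apply: (le_trans (h'K x)).
  by rewrite -[leLHS]mulr1 ler_wpM2l// lerDl sqr_ge0.
have mxm : measurable_fun setT (fun x : R => x - m) by exact: measurable_funB.
have i2 : leb.-integrable setT (EFin \o (fun x => (x - m) * h x * p x)).
  apply: (@normal_pdf_dominated _ (K * 2)); first exact: measurable_funM.
  move=> x; rewrite normrM; apply: (@le_trans _ _ (`|x - m| * (K * (1 + `|x - m|)))).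
    by rewrite ler_wpM2l.
  have -> : (x - m) ^+ 2 = `|x - m| ^+ 2 by rewrite real_normK ?num_real.
  have := normr_ge0 (x - m); set y := `|x - m| => y0.
  rewrite mulrCA -mulrA ler_wpM2l//.
  by have := sqr_ge0 (y - 1); rewrite sqrrB expr1n; nra.
pose G x := s ^+ 2 * h x * p x.
pose g x := s ^+ 2 * (h' x * p x) - (x - m) * h x * p x.
have dG (x : R) : is_derive x (1 : R) G (g x).
  have := is_derive_mul (is_derive_mul (is_derive_cst (s ^+ 2) x 1) (dh x)) (is_derive_normal_pdf x).
  move/is_derive_eq; apply; rewrite /g /cst.
  by move: (p x) (h x) (h' x) => P H H'; field; exact: s0.
have cxm : continuous (fun x : R => x - m).
  by move=> x; apply: cvgB; [exact: cvg_id|exact: cvg_cst].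
have cp := continuous_normal_pdf (m := m) s0.
have cg : continuous g.
  move=> x; apply: cvgB.
    by apply: cvgM; [exact: cvg_cst|apply: cvgM; [exact: ch'|exact: cp]].
  by apply: cvgM; [apply: cvgM; [exact: cxm|exact: ch]|exact: cp].
have ig : leb.-integrable setT (EFin \o g).
  have := integrableB measurableT (integrableZl measurableT (s ^+ 2) i1) i2.
  by apply: eq_integrable.
have Gtail x : `|G x| <= s ^+ 2 * K * 2 * (normal_peak s * (1 + 4 * s ^+ 2)) * gauss_tail x.
  rewrite -[leRHS]mulrA; apply: le_trans (ler_wpM2l _ (normal_pdf_tail x)); last first.
    by rewrite mulr_ge0// mulr_ge0// sqr_ge0.
  rewrite /G normrM (ger0_norm (normal_pdf_ge0 _ _ _)) mulrA.
  rewrite ler_wpM2r ?normal_pdf_ge0// normrM (ger0_norm (sqr_ge0 s)).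
  have -> : s ^+ 2 * K * 2 * (1 + (x - m) ^+ 2) = s ^+ 2 * (K * (2 * (1 + (x - m) ^+ 2))) by ring.
  rewrite ler_wpM2l ?sqr_ge0//.
  apply: (le_trans (hK x)); rewrite ler_wpM2l//.
  have -> : (x - m) ^+ 2 = `|x - m| ^+ 2 by rewrite real_normK ?num_real.
  have := normr_ge0 (x - m); set y := `|x - m| => y0.
  by have := sqr_ge0 (y - 1); rewrite sqrrB expr1n; nra.
have Gcvg c : `|c| = 1 -> G (c * n%:R) @[n --> \oo] --> (0 : R).
  move=> c1; apply: (@cvgn0_le _ _
    (fun n => s ^+ 2 * K * 2 * (normal_peak s * (1 + 4 * s ^+ 2)) * gauss_tail (c * n%:R))).
    by move=> n; exact: Gtail.
  rewrite -[X in _ --> X](mulr0 (s ^+ 2 * K * 2 * (normal_peak s * (1 + 4 * s ^+ 2)))); apply: cvgMr.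
    exact: gauss_tail_cvg.
have /eqP : (\int[leb]_x g x)%R = 0.
  apply: (@integral_derivative_eq0 G g) => //.
    by have := Gcvg 1; rewrite normr1; under eq_fun do rewrite mul1r; apply.
  by have := Gcvg (-1); rewrite normrN1; under eq_fun do rewrite mulN1r; apply.
rewrite RintegralB//; last first.
  by have := integrableZl measurableT (s ^+ 2) i1; apply: eq_integrable.
by rewrite RintegralZl// subr_eq0 => /eqP.
Qed.

Notation N := (normal_prob m s).

Lemma integral_normal_prob (f : R -> R) : N.-integrable setT (EFin \o f) ->
  (\int[N]_x f x = \int[leb]_x (f x * p x))%R.
Proof.
move=> fi; congr fine; have /measurable_int mf := fi.
rewrite -(Radon_Nikodym_change_of_variables (normal_prob_dominates m s))//=.
apply: ae_eq_integral => //.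
- apply: emeasurable_funM => //; apply: (measurable_int leb).
  by apply: Radon_Nikodym_integrable; exact: normal_prob_dominates.
- apply/measurable_EFinP; apply: measurable_funM; last exact: measurable_normal_pdf.
  exact/measurable_EFinP.
- under [X in ae_eq _ _ _ X]eq_fun do rewrite EFinM.
  apply: ae_eqe_mul2l => /=.
  rewrite Radon_NikodymE//=; first exact: normal_prob_dominates.
  move=> Nmu; case: cid => /= h [h1 h2 h3].
  apply: integral_ae_eq => //=.
  + by apply/measurable_EFinP; exact: measurable_normal_pdf.
  + by move=> E E01 mE; rewrite -h3.
Qed.

Lemma integral_normal_pdf1 : (\int[leb]_x p x)%R = 1.
Proof. by rewrite /Rintegral integral_normal_pdf. Qed.

Lemma normal_prob_mean : N.-integrable setT (EFin \o (fun x => x)) -> (\int[N]_x x)%R = m.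
Proof.
move=> /integral_normal_prob ->.
have mxm : measurable_fun setT (fun x : R => x - m) by exact: measurable_funB.
have [i1 i2] : leb.-integrable setT (EFin \o (fun x => (x - m) * 1 * p x)) /\
    leb.-integrable setT (EFin \o (fun x => m * p x)).
  split; last by have := integrableZl measurableT m (integrable_normal_pdf m s); apply: eq_integrable.
  under eq_fun do rewrite mulr1.
  apply: (@normal_pdf_dominated _ 1) => // x; rewrite mul1r.
  have -> : (x - m) ^+ 2 = `|x - m| ^+ 2 by rewrite real_normK ?num_real.
  by have := sqr_ge0 (`|x - m| - 1); rewrite sqrrB expr1n; have := normr_ge0 (x - m); nra.
have -> : (\int[leb]_x (x * p x) = \int[leb]_x ((x - m) * 1 * p x + m * p x))%R.
  by apply: eq_Rintegral => x _; ring.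
have z : (\int[leb]_x (0 * p x))%R = 0.
  by under eq_Rintegral do rewrite mul0r; rewrite Rintegral_cst// mul0r.
rewrite RintegralD// (@gaussian_integration_by_parts (fun=> 1) (fun=> 0) 1) //.
- rewrite [X in _ + X]RintegralZl//; last exact: integrable_normal_pdf.
  by rewrite integral_normal_pdf1 mulr1 z mulr0 add0r.
- by move=> x; exact: cst_continuous.
- by move=> x; rewrite mul1r normr1 lerDl.
- by move=> x; rewrite normr0.
Qed.

Lemma normal_prob_var : N.-integrable setT (EFin \o (fun x => (x - m) ^+ 2)) ->
  (\int[N]_x ((x - m) ^+ 2))%R = s ^+ 2.
Proof.
move=> /integral_normal_prob ->.
under eq_Rintegral do rewrite expr2.
rewrite (@gaussian_integration_by_parts (fun x => x - m) (fun=> 1) 1 (fun x => is_derive_center x m))//.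
- under eq_Rintegral do rewrite mul1r.
  by rewrite integral_normal_pdf1 mulr1.
- by move=> x; exact: cst_continuous.
- by move=> x; rewrite mul1r lerDr.
- by move=> x; rewrite normr1.
Qed.

(** The phase b treats the real and imaginary parts of the characteristic function together. *)
Let theta (b u : R) := (\int[leb]_x (cos (u * (x - m) + b) * p x))%R.

Let continuous_affine (u b : R) : continuous (fun x : R => u * (x - m) + b).
Proof.
move=> x; apply: cvgD; last exact: cvg_cst.
by apply: cvgMr; apply: cvgB; [exact: cvg_id|exact: cvg_cst].
Qed.

(** Differentiating under the integral brings down - (x - m) sin, which Stein's identity converts
    back into - s ^ 2 u times the cosine: a linear equation in u. *)
Let is_derive_theta (b u : R) :
  is_derive u (1 : R) (theta b) (- (s ^+ 2 * u * theta b u)).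
Proof.
pose f v x := cos (v * (x - m) + b) * p x.
have df v x : is_derive v (1 : R) (f^~ x) (- ((x - m) * sin (v * (x - m) + b) * p x)).
  have da : is_derive v (1 : R) (fun v => v * (x - m) + b) (x - m).
    apply: is_derive_eq (is_deriveD (is_derive_mul (is_derive_id v 1) (is_derive_cst (x - m) v 1))
      (is_derive_cst b v 1)) _.
    by rewrite mulr0 mulr1 add0r addr0.
  apply: is_derive_eq (is_derive_mul (is_derive_comp (is_derive_cos _) da) (is_derive_cst (p x) v 1)) _.
  by rewrite /cst mulr0 add0r; ring.
have mc v : measurable_fun setT (fun x : R => cos (v * (x - m) + b)).
  apply: continuous_measurable_fun => x; apply: continuous_comp; first exact: continuous_affine.
  exact: continuous_cos.
have ms v : measurable_fun setT (fun x : R => sin (v * (x - m) + b)).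
  apply: continuous_measurable_fun => x; apply: continuous_comp; first exact: continuous_affine.
  exact: continuous_sin.
have intf v : leb.-integrable setT (EFin \o f v).
  apply: (@normal_pdf_dominated _ 1) => // x; rewrite mul1r.
  by rewrite (le_trans (cos_norm_le1 _))// lerDl sqr_ge0.
pose G x := `|x - m| * p x.
have G0 x : 0 <= G x by rewrite mulr_ge0// normal_pdf_ge0.
have iG : leb.-integrable setT (EFin \o G).
  apply: (@normal_pdf_dominated _ 1) => [|x].
    by apply: measurableT_comp => //; exact: measurable_funB.
  have -> : (x - m) ^+ 2 = `|x - m| ^+ 2 by rewrite real_normK ?num_real.
  by have := sqr_ge0 (`|x - m| - 1); rewrite normr_id sqrrB expr1n; have := normr_ge0 (x - m); nra.
have Iu : u \in `]u - 1, u + 1[ by rewrite in_itv/= ltrBlDr ltrDl ltr01.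
have d1f v x : partial1of2 f v x = - ((x - m) * sin (v * (x - m) + b) * p x).
  by rewrite partial1of2E; apply: derive_val.
have dom v x : `|partial1of2 f v x| <= G x.
  rewrite d1f normrN !normrM (ger0_norm (normal_pdf_ge0 _ _ _)) ler_wpM2r ?normal_pdf_ge0//.
  by rewrite -[leRHS]mulr1 ler_wpM2l// sin_norm_le1.
have dd v x : derivable (f^~ x) v 1 by case: (df v x).
have D := @derivable_under_integral _ _ _ leb f setT measurableT u (u - 1) (u + 1) Iu
  (fun v _ => intf v) (fun v x _ _ => dd v x) G G0 iG (fun v x _ _ => dom v x).
have E := @differentiation_under_integral _ _ _ leb f setT measurableT u (u - 1) (u + 1) Iu
  (fun v _ => intf v) (fun v x _ _ => dd v x) G G0 iG (fun v x _ _ => dom v x).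
apply: DeriveDef; first exact: D.
rewrite -derive1E [LHS]E.
have -> : (\int[leb]_x (partial1of2 f u x))%R =
    (-1 * \int[leb]_x ((x - m) * sin (u * (x - m) + b) * p x))%R.
  rewrite -RintegralZl//; first by apply: eq_Rintegral => x _; rewrite d1f mulN1r.
  apply: (@normal_pdf_dominated _ 1) => [|x].
    by apply: measurable_funM => //; exact: measurable_funB.
  rewrite normrM; apply: (@le_trans _ _ `|x - m|).
    by rewrite -[leRHS]mulr1 ler_wpM2l// sin_norm_le1.
  have -> : (x - m) ^+ 2 = `|x - m| ^+ 2 by rewrite real_normK ?num_real.
  by have := sqr_ge0 (`|x - m| - 1); rewrite sqrrB expr1n; have := normr_ge0 (x - m); nra.
have dsin (x : R) : is_derive x (1 : R) (fun x => sin (u * (x - m) + b)) (u * cos (u * (x - m) + b)).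
  apply: is_derive_eq (is_derive_comp (is_derive_sin _) (is_derive_affine _ _ _ _)) _.
  by rewrite mulrC.
rewrite (@gaussian_integration_by_parts (fun x => sin (u * (x - m) + b)) (fun x => u * cos (u * (x - m) + b)) (1 + `|u|) dsin).
- under eq_Rintegral do rewrite -mulrA.
  by rewrite RintegralZl//; [rewrite mulN1r mulrA|exact: intf].
- move=> x; apply: cvgMr; apply: continuous_comp; first exact: continuous_affine.
  exact: continuous_cos.
- move=> x; apply: (le_trans (sin_norm_le1 _)).
  by rewrite -[leLHS]mulr1 ler_pM// ?lerDl.
- move=> x; rewrite normrM; apply: (@le_trans _ _ `|u|); last by rewrite lerDr.
  by rewrite -[leRHS]mulr1 ler_wpM2l// cos_norm_le1.
Qed.

Lemma normal_prob_cos (b u : R) :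
  (\int[N]_x cos (u * (x - m) + b))%R = cos b * expR (- (s ^+ 2 * u ^+ 2 / 2)).
Proof.
have mc v : measurable_fun setT (fun x : R => cos (v * (x - m) + b)).
  apply: continuous_measurable_fun => x; apply: continuous_comp; first exact: continuous_affine.
  exact: continuous_cos.
rewrite integral_normal_prob; last first.
  apply: (@bounded_integrable _ _ R (normal_prob m s) _ 1); first exact: mc.
  by move=> x; exact: cos_norm_le1.
rewrite -/(theta b u).
(* Dividing by the expected Gaussian solution leaves a function of zero derivative, evaluated at
   0. *)
pose k (v : R) := theta b v * expR (s ^+ 2 * v ^+ 2 / 2).
have dk (v : R) : is_derive v (1 : R) k 0.
  have dq : is_derive v (1 : R) (fun v => s ^+ 2 * v ^+ 2 / 2) (s ^+ 2 * v).
    have -> : (fun v : R => s ^+ 2 * v ^+ 2 / 2) = (fun v => s ^+ 2 / 2 * (v * v)).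
      by apply/funext => y; field.
    apply: is_derive_eq (is_derive_mul (is_derive_cst (s ^+ 2 / 2) v 1)
      (is_derive_mul (is_derive_id v 1) (is_derive_id v 1))) _.
    by rewrite /cst; field.
  apply: is_derive_eq (is_derive_mul (is_derive_theta b v) (is_derive_comp (is_derive_expR _) dq)) _.
  by move: (expR _) (theta b v) => E t; ring.
have : k u = k 0 by exact: is_derive_0_is_cst.
rewrite /k expr0n/= mulr0 mul0r expR0 mulr1.
have -> : theta b 0 = cos b.
  rewrite /theta; under eq_Rintegral do rewrite mul0r add0r.
  by rewrite RintegralZl ?integral_normal_pdf1 ?mulr1//; exact: integrable_normal_pdf.
by move=> <-; rewrite -[RHS]mulrA -expRD subrr expR0 mulr1.
Qed.

Lemma normal_prob_itv_le (a e : R) : 0 <= e ->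
  (N `[(a - e)%R, (a + e)%R]%classic <= (normal_peak s * (2 * e))%:E)%E.
Proof.
move=> e0; rewrite /normal_prob.
apply: (@le_trans _ _ (\int[leb]_(x in `[(a - e)%R, (a + e)%R]) (normal_peak s)%:E)%E).
  apply: ge0_le_integral => //.
  - by move=> x _; rewrite lee_fin normal_pdf_ge0.
  - by apply/measurable_EFinP; apply: measurable_funTS; exact: measurable_normal_pdf.
  - by move=> x _; rewrite lee_fin normal_pdf_ub.
rewrite [leLHS]integral_cst// [X in (_ * X)%E]lebesgue_measure_itv/= lte_fin.
case: ifP => _; last by rewrite mule0 lee_fin mulr_ge0 ?normal_peak_ge0// mulr_ge0.
by rewrite -EFinB -EFinM lee_fin ler_wpM2l ?normal_peak_ge0//; lra.
Qed.

Lemma normal_prob_itv_gt0 (a b : R) : a < b -> (0 < N `[a, b]%classic)%E.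
Proof.
(* On [a, b] one has |x - m| <= |a - m| + |b - m|, hence this lower bound of the density. *)
move=> ab; pose c := normal_peak s * expR (- ((`|a - m| + `|b - m|) ^+ 2 / (s ^+ 2 *+ 2))).
have c0 : 0 < c by rewrite mulr_gt0 ?normal_peak_gt0 ?expR_gt0.
apply: (@lt_le_trans _ _ (\int[leb]_(x in `[a, b]) c%:E)%E).
  rewrite [ltRHS]integral_cst// [X in (_ * X)%E]lebesgue_measure_itv/= lte_fin ab.
  by rewrite -EFinB -EFinM lte_fin mulr_gt0 ?subr_gt0.
rewrite /normal_prob; apply: ge0_le_integral => //.
- by move=> x _; rewrite lee_fin ltW.
- by apply/measurable_EFinP; apply: measurable_funTS; exact: measurable_normal_pdf.
- move=> x /=; rewrite in_itv/= => /andP[ax xb].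
  rewrite lee_fin normal_pdfEx ler_wpM2l ?normal_peak_ge0// ler_expR mulNr lerN2.
  rewrite ler_wpM2r ?invr_ge0 ?pmulrn_lge0 ?(ltW s2)//.
  rewrite -(real_normK (num_real (x - m))) ler_pXn2r ?nnegrE ?addr_ge0// ler_norml.
  have := ler_norm (b - m); have := ler_norm (- (a - m)); rewrite normrN.
  by have := normr_ge0 (b - m); have := normr_ge0 (a - m); move=> *; apply/andP; split; lra.
Qed.

End gaussian_calculus.

Section gaussian_random_variables.
Context {R : realType} {d : measure_display} {Omega : measurableType d}.
Variable P : probability Omega R.
Variable Y : {RV P >-> measurableTypeR R}.
Variable v : R.
Hypotheses (gaussY : gaussian_rv P Y)
  (iY : P.-integrable setT (EFin \o Y)) (EY : (\int[P]_w Y w)%R = 0)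
  (iY2 : P.-integrable setT (EFin \o (fun w => Y w ^+ 2))) (EY2 : (\int[P]_w (Y w ^+ 2))%R = v).

Lemma gaussian_rv_law : exists s : R, s ^+ 2 = v /\
  forall A : set (measurableTypeR R), measurable A ->
  P (Y @^-1` A) = if s == 0 then \d_(0 : R) A else normal_prob 0 s A.
Proof.
case: gaussY => m [s lawY].
have transfer (f : R -> R) : measurable_fun setT f ->
    P.-integrable setT (EFin \o (f \o Y)) ->
    (\int[P]_w f (Y w))%R = (\int[distribution P Y]_x f x)%R.
  move=> mf fi; congr fine.
  rewrite (@integral_distribution _ _ _ _ _ P Y (EFin \o f))//.
  by apply/measurable_EFinP.
have [s0|s0] := eqVneq s 0.
  have law0 (f : R -> R) : measurable_fun setT f ->
      (\int[distribution P Y]_x f x)%R = f m.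
    move=> mf; rewrite /Rintegral (@eq_measure_integral _ _ _ _ (\d_(m : measurableTypeR R))).
      rewrite integral_dirac//=; last exact/measurable_EFinP.
      by rewrite indicE in_setT mul1r.
    by move=> A mA _; rewrite /= /distribution /pushforward lawY// s0 eqxx.
  have m0 : m = 0 by rewrite -EY (transfer id)// law0.
  exists 0; split; last by move: lawY; rewrite s0 m0; exact.
  rewrite -EY2 (transfer (fun x => x ^+ 2))// ?law0// ?m0//; exact: exprn_measurable.
have lawN (f : R -> R) : (\int[distribution P Y]_x f x)%R = (\int[normal_prob m s]_x f x)%R.
  congr fine; apply: eq_measure_integral => A mA _.
  by rewrite /= /distribution /pushforward lawY// (negbTE s0).
have intN (f : R -> R) : measurable_fun setT f ->
    P.-integrable setT (EFin \o (f \o Y)) -> (normal_prob m s).-integrable setT (EFin \o f).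
  move=> mf /integrableP[_ fi]; apply/integrableP; split; first exact/measurable_EFinP.
  rewrite -(@eq_measure_integral _ _ _ _ _ (distribution P Y)).
    rewrite ge0_integral_distribution//; do 2 apply: measurableT_comp => //.
  by move=> A mA _; rewrite /= /distribution /pushforward lawY// (negbTE s0).
have mE : m = 0.
  rewrite -EY (transfer id)// lawN normal_prob_mean//.
  by apply: intN => //; exact: measurable_id.
subst m; have m2 : measurable_fun setT (fun x : R => (x - 0) ^+ 2).
  by apply: measurable_funX; exact: measurable_funB.
exists s; split; last exact: lawY.
have iY2' : P.-integrable setT (EFin \o ((fun x : R => (x - 0) ^+ 2) \o Y)).
  by rewrite /comp/=; under eq_fun do rewrite subr0.
have -> : v = (\int[P]_w (Y w - 0) ^+ 2)%R.
  by rewrite -EY2; apply: eq_Rintegral => w _; rewrite subr0.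
have iN := intN _ m2 iY2'.
by rewrite (transfer _ m2 iY2') lawN (normal_prob_var s0 iN).
Qed.

Lemma gaussian_rv_cos b : (\int[P]_w cos (Y w + b))%R = cos b * expR (- (v / 2)).
Proof.
have [s [sv lawY]] := gaussian_rv_law.
have mcb : measurable_fun setT (fun x : R => cos (x + b)).
  apply: continuous_measurable_fun => x; apply: continuous_comp; last exact: continuous_cos.
  by apply: cvgD; [exact: cvg_id|exact: cvg_cst].
have -> : (\int[P]_w cos (Y w + b))%R = (\int[distribution P Y]_x cos (x + b))%R.
  congr fine; rewrite (@integral_distribution _ _ _ _ _ P Y (fun x => (cos (x + b))%:E))//.
    by apply/measurable_EFinP.
  have : P.-integrable setT (EFin \o (fun w => cos (Y w + b))) => //.
  apply: (@bounded_integrable _ _ _ P _ 1); last by move=> w; exact: cos_norm_le1.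
  apply: (measurableT_comp mcb). exact: (measurable_funP Y).
have [s0|s0] := eqVneq s 0.
  rewrite /Rintegral (@eq_measure_integral _ _ _ _ (\d_(0 : measurableTypeR R))); last first.
    by move=> A mA _; rewrite /= /distribution /pushforward lawY// s0 eqxx.
  rewrite integral_dirac//=; last exact/measurable_EFinP.
  by rewrite indicE in_setT mul1r add0r -sv s0 expr0n/= mul0r oppr0 expR0 mulr1.
rewrite /Rintegral (@eq_measure_integral _ _ _ _ (normal_prob 0 s)); last first.
  by move=> A mA _; rewrite /= /distribution /pushforward lawY// (negbTE s0).
have := normal_prob_cos 0 s0 b 1; rewrite expr1n mulr1 sv => <-.
by congr fine; apply: eq_integral => x _; rewrite mul1r subr0.
Qed.

(** The standard normal density is at most 1 / sqrt (2 pi) <= 1 / 2, so an interval of length 2 e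
    has mass at most e. *)
Lemma gaussian_rv_small_ball (e : R) : v = 1 -> 0 <= e ->
  (P [set w | `|Y w : R| <= e]%R <= e%:E)%E.
Proof.
move=> v1 e0; have [s [sv lawY]] := gaussian_rv_law.
have s0 : s != 0 by rewrite -sqrf_eq0 sv v1 oner_neq0.
have -> : [set w | `|Y w : R| <= e]%R = Y @^-1` `[- e, e]%classic.
  by apply/seteqP; split => w /=; rewrite in_itv/= ler_norml.
rewrite lawY// (negbTE s0); have := @normal_prob_itv_le _ 0 s s0 0 e e0.
rewrite sub0r add0r => /le_trans; apply; rewrite lee_fin.
rewrite /normal_peak sv v1 mul1r -[leRHS]mul1r mulrA ler_wpM2r//.
have q0 : 0 < Num.sqrt (pi *+ 2) :> R by rewrite sqrtr_gt0 pmulrn_lgt0// pi_gt0.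
rewrite ler_pdivrMl// mulr1.
have -> : 2 = Num.sqrt (2 ^+ 2) :> R by rewrite sqrtr_sqr ger0_norm.
apply: ler_wsqrtr.
by have := pi_ge2 R; rewrite expr2; lra.
Qed.

Lemma gaussian_rv_unbounded (M : R) : v = 1 -> (0 < P [set w | M < (Y w : R)]%R)%E.
Proof.
move=> v1; have [s [sv lawY]] := gaussian_rv_law.
have s0 : s != 0 by rewrite -sqrf_eq0 sv v1 oner_neq0.
have M12 : M + 1 < M + 2 by rewrite ltrD2l ltr1n.
apply: (lt_le_trans (normal_prob_itv_gt0 0 s0 M12)).
have := lawY `[M + 1, M + 2]%classic; rewrite (negbTE s0) => <-//.
apply: le_measure; rewrite ?inE//.
- by rewrite -[X in measurable X]setTI; exact: measurable_funP.
- rewrite (_ : [set w | _] = Y @^-1` `]M, +oo[%classic).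
    by rewrite -[X in measurable X]setTI; exact: measurable_funP.
  by apply/seteqP; split => w /=; rewrite in_itv/= andbT.
- move=> w /=; rewrite in_itv/= => /andP[h _]; apply: lt_le_trans h.
  by rewrite ltrDl.
Qed.

End gaussian_random_variables.

(** * Linear combinations of a Gaussian process *)

Section path_combinations.
Context {R : realType}.

(** Combinations are lists of pairs (coefficient, time), so that sums, opposites and translates
    become list operations. *)
Definition path_comb (s : seq (R * R)) (f : R -> R) : R :=
  \sum_(p <- s) p.1 * f p.2.

Definition cov_form (K : R -> R) (s s' : seq (R * R)) : R :=
  \sum_(p <- s) \sum_(q <- s') p.1 * q.1 * K (p.2 - q.2).

Definition comb_opp (s : seq (R * R)) := [seq (- p.1, p.2) | p <- s].

Definition comb_shift (t : R) (s : seq (R * R)) := [seq (p.1, p.2 - t) | p <- s].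

Lemma path_comb_cat s s' f : path_comb (s ++ s') f = path_comb s f + path_comb s' f.
Proof. exact: big_cat. Qed.

Lemma path_comb_opp s f : path_comb (comb_opp s) f = - path_comb s f.
Proof.
by rewrite /path_comb big_map -sumrN; apply: eq_bigr => p _; rewrite mulNr.
Qed.

Lemma path_comb_shift t s f :
  path_comb (comb_shift t s) f = path_comb s (fun u => f (u - t)).
Proof. by rewrite /path_comb big_map. Qed.

Lemma cov_form_catl K s1 s2 s : cov_form K (s1 ++ s2) s = cov_form K s1 s + cov_form K s2 s.
Proof. exact: big_cat. Qed.

Lemma cov_form_catr K s1 s2 s : cov_form K s (s1 ++ s2) = cov_form K s s1 + cov_form K s s2.
Proof. by rewrite /cov_form -big_split/=; apply: eq_bigr => p _; rewrite big_cat. Qed.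

Lemma cov_form_oppl K s s' : cov_form K (comb_opp s) s' = - cov_form K s s'.
Proof.
rewrite /cov_form big_map -sumrN; apply: eq_bigr => p _.
by rewrite -sumrN; apply: eq_bigr => q _; rewrite !mulNr.
Qed.

Lemma cov_form_oppr K s s' : cov_form K s (comb_opp s') = - cov_form K s s'.
Proof.
rewrite /cov_form -sumrN; apply: eq_bigr => p _.
by rewrite big_map -sumrN; apply: eq_bigr => q _; rewrite mulrN mulNr.
Qed.

Lemma cov_formC K s s' : (forall t, K (- t) = K t) -> cov_form K s s' = cov_form K s' s.
Proof.
move=> KN; rewrite /cov_form exchange_big/=; apply: eq_bigr => q _.
by apply: eq_bigr => p _; rewrite -(KN (p.2 - q.2)) opprB (mulrC p.1).
Qed.

Lemma cov_form_shift K t s : cov_form K (comb_shift t s) (comb_shift t s) = cov_form K s s.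
Proof.
rewrite /cov_form big_map; apply: eq_bigr => p _; rewrite big_map.
by apply: eq_bigr => q _ /=; rewrite opprB addrA subrK.
Qed.

End path_combinations.

Lemma Rintegral_sum d (T : measurableType d) (R : realType) (mu : {measure set T -> \bar R})
    (D : set T) (I : Type) (r : seq I) (f : I -> T -> R) : measurable D ->
  (forall i, mu.-integrable D (EFin \o f i)) ->
  (\int[mu]_(x in D) \sum_(i <- r) f i x = \sum_(i <- r) \int[mu]_(x in D) f i x)%R.
Proof.
move=> mD fi; elim: r => [|a r IH].
  by under eq_Rintegral do rewrite big_nil; rewrite big_nil /Rintegral integral0.
under eq_Rintegral do rewrite big_cons.
rewrite RintegralD//; first by rewrite IH big_cons.
have := integrable_sum mD r (P := xpredT) (h := fun i => EFin \o f i) (fun i _ => fi i).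
by apply: eq_integrable => // w _; rewrite /= sumEFin.
Qed.

Section stationary_gaussian.
Context {R : realType} {d : measure_display} {Omega : measurableType d}.
Variable P : probability Omega R.
Variable X : R -> {RV P >-> measurableTypeR R}.
Variable K : R -> R.
Hypotheses (X_gaussian : gaussian_process P X)
  (X_centered : forall t : R, ('E_P[X t] = 0)%E)
  (X_covariance : forall t s : R, covariance P (X t) (X s) = (K (t - s))%:E).

Lemma process_product_expectation t s : (\int[P]_w (X t w * X s w)%:E = (K (t - s))%:E)%E.
Proof.
rewrite -X_covariance covariance.unlock !X_centered expectation.unlock/=.
apply: eq_integral => w _; congr (_%:E).
transitivity ((X t w - 0) * (X s w - 0)); first by rewrite !subr0.
by [].
Qed.

Lemma measurable_process t : measurable_fun setT (X t : Omega -> R).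
Proof. exact: (measurable_funP (X t)). Qed.

Lemma integrable_process_sqr t : P.-integrable setT (EFin \o (fun w => X t w ^+ 2)).
Proof.
apply/integrableP; split.
  by apply/measurable_EFinP; apply: measurable_funX; exact: measurable_process.
rewrite (eq_integral (fun w => (X t w * X t w)%:E)).
  by rewrite process_product_expectation ltry.
by move=> w _ /=; rewrite ger0_norm ?sqr_ge0// expr2.
Qed.

Lemma integrable_process_product t s :
  P.-integrable setT (EFin \o (fun w => X t w * X s w)).
Proof.
have := integrableD measurableT (integrable_process_sqr t) (integrable_process_sqr s).
apply: le_integrable => //.
  by apply/measurable_EFinP; apply: measurable_funM; exact: measurable_process.
move=> w _ /=; rewrite !lee_fin.
rewrite [leRHS]ger0_norm ?addr_ge0 ?sqr_ge0// normrM -(real_normK (num_real (X t w))).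
rewrite -(real_normK (num_real (X s w))).
have := normr_ge0 (X t w); have := normr_ge0 (X s w).
have := sqr_ge0 (`|X t w| - `|X s w|).
by rewrite sqrrB; set a := `|X t w|; set b := `|X s w|; nra.
Qed.

Lemma integrable_process t : P.-integrable setT (EFin \o (fun w => X t w : R)).
Proof.
have i1 : P.-integrable setT (EFin \o cst (1 : R)) by exact: finite_measure_integrable_cst.
have := integrableD measurableT i1 (integrable_process_sqr t).
apply: le_integrable => //; first by apply/measurable_EFinP; exact: measurable_process.
move=> w _ /=; rewrite !lee_fin.
rewrite [leRHS]ger0_norm ?addr_ge0 ?sqr_ge0// -(real_normK (num_real (X t w))).
have := sqr_ge0 (`|X t w| - 1); have := normr_ge0 (X t w).
by rewrite sqrrB expr1n; set a := `|X t w|; nra.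
Qed.

Definition lin (s : seq (R * R)) (w : Omega) : R := path_comb s (fun t => X t w).

Lemma measurable_lin s : measurable_fun setT (lin s).
Proof.
apply: measurable_sum => p; apply: measurable_funM => //.
exact: measurable_process.
Qed.

Lemma integrable_lin s : P.-integrable setT (EFin \o lin s).
Proof.
have := integrable_sum measurableT s (P := xpredT)
  (h := fun p w => (p.1%:E * (X p.2 w)%:E)%E)
  (fun p _ => integrableZl measurableT p.1 (integrable_process p.2)).
by apply: eq_integrable => // w _; rewrite /= /lin /path_comb -sumEFin.
Qed.

Lemma Rintegral_lin s : (\int[P]_w lin s w)%R = 0.
Proof.
rewrite /lin /path_comb Rintegral_sum//; last first.
  by move=> p; have := integrableZl measurableT p.1 (integrable_process p.2); apply: eq_integrable.
apply: big1 => p _; rewrite RintegralZl//; last exact: integrable_process.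
have := X_centered p.2; rewrite unlock /Rintegral => ->.
by rewrite mulr0.
Qed.

Lemma lin_product s s' w : lin s w * lin s' w =
  \sum_(p <- s) \sum_(q <- s') p.1 * q.1 * (X p.2 w * X q.2 w).
Proof.
rewrite /lin /path_comb mulr_suml; apply: eq_bigr => p _; rewrite mulr_sumr.
by apply: eq_bigr => q _; ring.
Qed.

Let integrable_term (p q : R * R) :
  P.-integrable setT (EFin \o (fun w => p.1 * q.1 * (X p.2 w * X q.2 w))).
Proof.
by have := integrableZl measurableT (p.1 * q.1) (integrable_process_product p.2 q.2); apply: eq_integrable.
Qed.

Let integrable_row (p : R * R) s' :
  P.-integrable setT (EFin \o (fun w => \sum_(q <- s') p.1 * q.1 * (X p.2 w * X q.2 w))).
Proof.
have := integrable_sum measurableT s' (P := xpredT) (fun q _ => integrable_term p q).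
by apply: eq_integrable => // w _; rewrite /= sumEFin.
Qed.

Lemma integrable_lin_product s s' : P.-integrable setT (EFin \o (fun w => lin s w * lin s' w)).
Proof.
have := integrable_sum measurableT s (P := xpredT) (fun p _ => integrable_row p s').
by apply: eq_integrable => // w _; rewrite /= sumEFin lin_product.
Qed.

Lemma Rintegral_lin_product s s' : (\int[P]_w (lin s w * lin s' w))%R = cov_form K s s'.
Proof.
under eq_Rintegral do rewrite lin_product.
rewrite Rintegral_sum//.
apply: eq_bigr => p _; rewrite Rintegral_sum//.
apply: eq_bigr => q _; rewrite RintegralZl//; last exact: integrable_process_product.
by rewrite /Rintegral process_product_expectation.
Qed.

Lemma gaussian_lin s : gaussian_rv P (lin s).
Proof.
have := X_gaussian (fun i : 'I_(size s) => (nth (0, 0) s i).2) (fun i => (nth (0, 0) s i).1).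
rewrite (_ : (fun w => _) = lin s)//; apply/funext => w.
by rewrite /lin /path_comb (big_nth (0, 0)) big_mkord.
Qed.

Lemma lin_cos s b :
  (\int[P]_w cos (lin s w + b))%R = cos b * expR (- (cov_form K s s / 2)).
Proof.
have mlin : measurable_fun setT (lin s : Omega -> measurableTypeR R) by exact: measurable_lin.
pose Y : {RV P >-> measurableTypeR R} :=
  @mfun_Sub _ _ Omega (measurableTypeR R) (lin s) (mem_set mlin).
have YE : (Y : Omega -> R) = lin s by [].
rewrite -(@gaussian_rv_cos _ _ _ P Y (cov_form K s s))//.
- exact: gaussian_lin.
- exact: integrable_lin.
- exact: Rintegral_lin.
- by have := integrable_lin_product s s; apply: eq_integrable.
- exact: Rintegral_lin_product.
Qed.

(** Positive semidefiniteness read off a second moment; a well chosen list turns it into Bessel's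
    inequality. *)
Lemma cov_form_ge0 s : 0 <= cov_form K s s.
Proof.
rewrite -Rintegral_lin_product; apply: Rintegral_ge0 => w _.
by rewrite -expr2 sqr_ge0.
Qed.

End stationary_gaussian.

(** * Approximation of events in L^1 *)

Section threshold_polynomials.
Context {R : realType}.

(* Polynomials converging pointwise on [0, 1] to the indicator of ]1/2, 1]; the second
   factor alone is the one used for the Stone-Weierstrass theorem and has limit [1 - 1/e] at
   1/2, the first factor corrects it there. *)
Definition threshold_poly (n : nat) (z : R) : R :=
  (1 - (4 * (z * (1 - z))) ^+ n) * (1 - (1 - z ^+ n) ^+ (2 ^ n)).

Lemma bernoulli_ineq (x : R) n : -1 <= x -> 1 + n%:R * x <= (1 + x) ^+ n.
Proof.
move=> x1; elim: n => [|n IH]; first by rewrite mul0r addr0 expr0.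
have x2 : 0 <= 1 + x by lra.
rewrite exprS; apply: le_trans (ler_wpM2l x2 IH).
have n0 : (0 : R) <= n%:R by [].
have := sqr_ge0 x; rewrite -natr1; nra.
Qed.

Lemma threshold_poly_cvg z : 0 <= z <= 1 ->
  threshold_poly n z @[n --> \oo] --> ((1 / 2 < z)%R%:R : R).
Proof.
move=> /andP[z0 z1].
have z41 : 0 <= 4 * (z * (1 - z)) <= 1.
  have h : 0 <= z * (1 - z) by rewrite mulr_ge0// subr_ge0.
  by apply/andP; split; [lra|have := sqr_ge0 (z - 1 / 2); nra].
have zn1 n : 0 <= 1 - z ^+ n <= 1.
  by rewrite subr_ge0 exprn_ile1//= gerBl exprn_ge0.
have [zh|zh|zh] := ltgtP (1 / 2) z.
- have a1 : 4 * (z * (1 - z)) < 1 by nra.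
  rewrite -[X in _ --> X](_ : (1 - 0) * (1 - 0) = _); last by rewrite subr0 mulr1.
  apply: cvgM; apply: cvgB; try exact: cvg_cst.
    by apply: cvg_expr; rewrite ger0_norm//; case/andP: z41.
  (* Bernoulli gives (2 z) ^ n <= (1 + z ^ n) ^ (2 ^ n), and (1 - z ^ n) (1 + z ^ n) <= 1. *)
  apply: (@cvgn0_le _ _ (fun n => (2 * z)^-1 ^+ n)).
    move=> n; rewrite ger0_norm ?exprn_ge0//; last by case/andP: (zn1 n).
    have z20 : 0 < 2 * z by lra.
    rewrite exprVn -[leRHS]mul1r ler_pdivlMr ?exprn_gt0//.
    case/andP: (zn1 n) => h1 h2.
    apply: (@le_trans _ _ ((1 - z ^+ n) ^+ (2 ^ n) * (1 + z ^+ n) ^+ (2 ^ n))).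
      rewrite ler_wpM2l ?exprn_ge0//.
      have := @bernoulli_ineq (z ^+ n) (2 ^ n).
      have zn0 : 0 <= z ^+ n by rewrite exprn_ge0.
      rewrite natrX -exprMn => h; apply: le_trans (h _); first by rewrite lerDr.
      by apply: le_trans zn0; rewrite lerN10.
    rewrite -exprMn exprn_ile1//.
      by rewrite mulr_ge0// addr_ge0// exprn_ge0.
    by rewrite -subr_sqr expr1n gerBl sqr_ge0.
  apply: cvg_expr; rewrite ger0_norm ?invr_ge0; last by lra.
  by rewrite invf_lt1; lra.
- rewrite -[X in _ --> X](_ : 0%:R = _)//.
  apply: (@cvgn0_le _ _ (fun n => (2 * z) ^+ n)); last first.
    by apply: cvg_expr; rewrite ger0_norm; lra.
  move=> n; case/andP: (zn1 n) => h1 h2; rewrite /threshold_poly normrM.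
  have h3 : 0 <= 1 - (4 * (z * (1 - z))) ^+ n <= 1.
    case/andP: z41 => a0 a1.
    by rewrite subr_ge0 exprn_ile1//= gerBl exprn_ge0.
  have h4 : 0 <= 1 - (1 - z ^+ n) ^+ (2 ^ n) by rewrite subr_ge0 exprn_ile1.
  rewrite (ger0_norm h4) ger0_norm; last by case/andP: h3.
  apply: (@le_trans _ _ (1 - (1 - z ^+ n) ^+ (2 ^ n))).
    by rewrite -[leRHS]mul1r ler_wpM2r//; case/andP: h3.
  rewrite lerBlDl -lerBlDr; apply: le_trans (@bernoulli_ineq (- z ^+ n) (2 ^ n) _).
    by rewrite mulrN natrX -exprMn.
  by rewrite lerN2 exprn_ile1.
- rewrite /threshold_poly -zh (_ : 4 * (1 / 2 * (1 - 1 / 2)) = 1); last by field.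
  under eq_fun do rewrite expr1n subrr mul0r.
  exact: cvg_cst.
Qed.

Lemma threshold_poly_norm_le1 n z : 0 <= z <= 1 -> `|threshold_poly n z| <= 1.
Proof.
move=> /andP[z0 z1].
have /andP[a0 a1] : 0 <= 4 * (z * (1 - z)) <= 1.
  have h : 0 <= z * (1 - z) by rewrite mulr_ge0// subr_ge0.
  by apply/andP; split; [lra|have := sqr_ge0 (z - 1 / 2); nra].
have [h1 h2] : 0 <= 1 - z ^+ n /\ 1 - z ^+ n <= 1.
  by rewrite subr_ge0 exprn_ile1//= gerBl exprn_ge0.
rewrite normrM mulr_ile1// ger0_norm ?subr_ge0 ?exprn_ile1// gerBl exprn_ge0//.
Qed.

End threshold_polynomials.

Section algebra_approximation.
Context d (T : measurableType d) (R : realType) (nu : {measure set T -> \bar R}).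
Hypothesis nu_fin : (nu setT < +oo)%E.
Variable Alg : (T -> R) -> Prop.
Hypotheses (Alg_measurable : forall F, Alg F -> measurable_fun setT F)
  (Alg_bounded : forall F, Alg F -> exists M : R, forall x, `|F x| <= M)
  (Alg_cst : forall c, Alg (fun=> c))
  (Alg_add : forall F G, Alg F -> Alg G -> Alg (fun x => F x + G x))
  (Alg_mul : forall F G, Alg F -> Alg G -> Alg (fun x => F x * G x)).

(** The bounded part of the L^1 closure of the algebra. Sup bounds belong to the record because the
    distance between two products is controlled by them. *)
Record approximable (g : T -> R) : Prop := Approximable {
  approximable_measurable : measurable_fun setT g ;
  approximable_bounded : exists M : R, forall x, `|g x| <= M ;
  approximableP : forall e, 0 < e -> exists2 F, Alg F & (\int[nu]_x `|g x - F x|)%R <= e }.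

Let bint (g : T -> R) : measurable_fun setT g -> (exists M : R, forall x, `|g x| <= M) ->
  nu.-integrable setT (EFin \o g).
Proof. by move=> mg [M gM]; exact: finite_bounded_integrable gM. Qed.

Let bnd_sub (g h : T -> R) : (exists M : R, forall x, `|g x| <= M) -> (exists M : R, forall x, `|h x| <= M) ->
  exists M : R, forall x, `| `|g x - h x| | <= M.
Proof.
move=> [M gM] [N hN]; exists (M + N) => x.
by rewrite normr_id (le_trans (ler_normB _ _))// lerD.
Qed.

Let dist_int (g h : T -> R) : measurable_fun setT g -> (exists M : R, forall x, `|g x| <= M) ->
  measurable_fun setT h -> (exists M : R, forall x, `|h x| <= M) ->
  nu.-integrable setT (EFin \o (fun x => `|g x - h x|)).
Proof.
move=> mg bg mh bh; apply: bint; last exact: bnd_sub.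
by apply: measurableT_comp => //; exact: measurable_funB.
Qed.

Lemma approximable_alg F : Alg F -> approximable F.
Proof.
move=> AF; split; [exact: Alg_measurable|exact: Alg_bounded|].
move=> e e0; exists F => //; under eq_Rintegral do rewrite subrr normr0.
by rewrite Rintegral_cst// mul0r ltW.
Qed.

Lemma approximable_add g h : approximable g -> approximable h ->
  approximable (fun x => g x + h x).
Proof.
move=> [mg bg ag] [mh bh ah]; split; first exact: measurable_funD.
  have [[M gM] [N hN]] := (bg, bh); exists (M + N) => x.
  by rewrite (le_trans (ler_normD _ _))// lerD.
move=> e e0; have e2 : 0 < e / 2 by rewrite divr_gt0.
have [F AF gF] := ag _ e2; have [G AG hG] := ah _ e2.
exists (fun x => F x + G x); first exact: Alg_add.
have [mF bF] := (Alg_measurable AF, Alg_bounded AF).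
have [mG bG] := (Alg_measurable AG, Alg_bounded AG).
rewrite (splitr e); apply: le_trans (lerD gF hG).
rewrite -RintegralD//; [|exact: dist_int|exact: dist_int].
apply: le_Rintegral => //.
- apply: dist_int.
  + exact: measurable_funD.
  + have [[M gM] [N hN]] := (bg, bh); exists (M + N) => x.
    by rewrite (le_trans (ler_normD _ _))// lerD.
  + exact: measurable_funD.
  + have [[M gM] [N hN]] := (bF, bG); exists (M + N) => x.
    by rewrite (le_trans (ler_normD _ _))// lerD.
- have := integrableD measurableT (dist_int mg bg mF bF) (dist_int mh bh mG bG).
  by apply: eq_integrable.
- by move=> x _; rewrite opprD addrACA ler_normD.
Qed.

Let bnd_mul (g h : T -> R) : (exists M : R, forall x, `|g x| <= M) -> (exists M : R, forall x, `|h x| <= M) ->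
  exists M : R, forall x, `|g x * h x| <= M.
Proof. by move=> [M gM] [N hN]; exists (M * N) => x; rewrite normrM ler_pM. Qed.

Lemma approximable_mul g h : approximable g -> approximable h ->
  approximable (fun x => g x * h x).
Proof.
move=> [mg bg ag] [mh bh ah]; split; [exact: measurable_funM|exact: bnd_mul|].
move=> e e0; have [M hM] := bh.
have M0 : 0 <= M by exact: le_trans (hM point).
have e1 : 0 < e / 2 / (M + 1) by rewrite !divr_gt0// ltr_wpDl.
have [F AF gF] := ag _ e1.
have [mF bF] := (Alg_measurable AF, Alg_bounded AF).
have [N FN] := bF; have N0 : 0 <= N by exact: le_trans (FN point).
(* G is chosen after F because the bound N of F enters its tolerance; the + 1 covers a zero
   bound. *)
have e2 : 0 < e / 2 / (N + 1) by rewrite !divr_gt0// ltr_wpDl.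
have [G AG hG] := ah _ e2; have [mG bG] := (Alg_measurable AG, Alg_bounded AG).
exists (fun x => F x * G x); first exact: Alg_mul.
apply: (@le_trans _ _ (\int[nu]_x (M * `|g x - F x| + N * `|h x - G x|))%R).
  apply: le_Rintegral => //.
  - by apply: dist_int; [exact: measurable_funM|exact: bnd_mul|exact: measurable_funM|exact: bnd_mul].
  - have := integrableD measurableT (integrableZl measurableT M (dist_int mg bg mF bF))
      (integrableZl measurableT N (dist_int mh bh mG bG)).
    by apply: eq_integrable.
  - move=> x _; have -> : g x * h x - F x * G x = h x * (g x - F x) + F x * (h x - G x) by ring.
    by rewrite (le_trans (ler_normD _ _))// !normrM lerD// ler_wpM2r.
rewrite RintegralD//; last 2 first.
- by have := integrableZl measurableT M (dist_int mg bg mF bF); apply: eq_integrable.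
- by have := integrableZl measurableT N (dist_int mh bh mG bG); apply: eq_integrable.
rewrite !RintegralZl//; [|exact: dist_int|exact: dist_int].
have h0 (a c : R) : 0 <= a -> a * (c / 2 / (a + 1)) <= c / 2 * (a / (a + 1)).
  by move=> a0; rewrite mulrCA.
have q (a : R) : 0 <= a -> a / (a + 1) <= 1.
  by move=> a0; rewrite ler_pdivrMr ?mul1r ?lerDl// ltr_wpDl.
rewrite (splitr e) lerD//.
- apply: le_trans (ler_wpM2l M0 gF) _; apply: le_trans (h0 _ _ M0) _.
  by rewrite ler_piMr ?q// ltW// divr_gt0.
- apply: le_trans (ler_wpM2l N0 hG) _; apply: le_trans (h0 _ _ N0) _.
  by rewrite ler_piMr ?q// ltW// divr_gt0.
Qed.

Lemma approximable_lim (g_ : nat -> T -> R) (g : T -> R) (M : R) :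
  (forall n, approximable (g_ n)) -> (forall n x, `|g_ n x| <= M) ->
  (forall x, g_ n x @[n --> \oo] --> g x) -> approximable g.
Proof.
move=> ag gM gg.
have mg_ n := approximable_measurable (ag n).
have mg : measurable_fun setT g by apply: (measurable_fun_cvg mg_) => x _; exact: gg.
have bg : exists M : R, forall x, `|g x| <= M.
  exists M => x; apply: (@cvgn_ler _ (fun n => `|g_ n x|)) => //.
  by apply: cvg_norm; exact: gg.
split => // e e0; have e2 : 0 < e / 2 by rewrite divr_gt0.
have h : (\int[nu]_x `|g_ n x - g x|)%R @[n --> \oo] --> (\int[nu]_x (cst 0 x : R))%R.
  have [N gN] := bg.
  apply: (@Rdominated_cvg _ _ _ nu setT _ _ (fun=> M + N)) => //.
  - by move=> n; apply: measurableT_comp => //; exact: measurable_funB.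
  - move=> x _; rewrite -[X in _ --> X](normr0 R) -(subrr (g x)).
    by apply: cvg_norm; apply: cvgB; [exact: gg|exact: cvg_cst].
  - by apply: bint => //; exists `|M + N|.
  - by move=> n x _; rewrite normr_id (le_trans (ler_normB _ _))// lerD.
move: h; rewrite Rintegral_cst// mul0r => /cvgr0_norm_lt/(_ _ e2)[n _ /(_ n (leqnn n))/= hn].
have [F AF gF] := approximableP (ag n) e2.
exists F => //; have [mF bF] := (Alg_measurable AF, Alg_bounded AF).
have bgn := approximable_bounded (ag n).
have hn' : (\int[nu]_x `|g_ n x - g x|)%R <= e / 2.
  by rewrite (le_trans (ler_norm _))// ltW.
rewrite (splitr e); apply: le_trans (lerD hn' gF).
rewrite -RintegralD//; [|exact: dist_int|exact: dist_int].
apply: le_Rintegral => //.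
- exact: dist_int.
- have := integrableD measurableT (dist_int (mg_ n) bgn mg bg) (dist_int (mg_ n) bgn mF bF).
  by apply: eq_integrable.
- by move=> x _; rewrite (distrC (g_ n x)) (le_trans _ (ler_normD _ _))// addrA subrK.
Qed.

Lemma approximable_cst c : approximable (fun=> c).
Proof. exact: approximable_alg. Qed.

Lemma approximable_exp g n : approximable g -> approximable (fun x => g x ^+ n).
Proof.
move=> ag; elim: n => [|n IH]; first exact: approximable_cst.
by under eq_fun do rewrite exprS; exact: approximable_mul.
Qed.

Lemma approximable_onem g : approximable g -> approximable (fun x => 1 - g x).
Proof.
move=> ag; have := approximable_add (approximable_cst 1) (approximable_mul (approximable_cst (-1)) ag).
by under eq_fun do rewrite mulN1r.
Qed.

Definition approximable_events : set (set T) :=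
  [set A : set T | approximable (fun x => (x \in A)%:R)].

(** Products of approximable functions are approximable, so the finite intersections of complements
    are reached; a countable union follows by a bounded pointwise limit. *)
Lemma approximable_events_sigma_algebra : sigma_algebra setT approximable_events.
Proof.
split.
- rewrite /approximable_events/=; under eq_fun do rewrite in_set0.
  exact: approximable_cst.
- move=> A aA; rewrite /approximable_events/= setTD.
  have -> : (fun x => (x \in ~` A)%:R) = (fun x => 1 - (x \in A)%:R) :> (T -> R).
    by apply/funext => x; rewrite in_setC; case: (x \in A); rewrite ?subr0 ?subrr.
  exact: approximable_onem.
- move=> F aF; pose g n x : R := \prod_(k < n) (1 - (x \in F k)%:R).
  have ag n : approximable (g n).
    rewrite /g; elim: n => [|n IH].
      by under eq_fun do rewrite big_ord0; exact: approximable_cst.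
    under eq_fun do rewrite big_ord_recr/=.
    by apply: approximable_mul => //; apply: approximable_onem; exact: aF.
  have g1 n x : `|g n x| <= 1.
    rewrite normr_prod prodr_ile1// => k _; rewrite normr_ge0/=.
    by case: (x \in F k); rewrite ?subrr ?normr0 ?subr0 ?normr1.
  apply: (@approximable_lim (fun n x => 1 - g n x) _ 2).
  + by move=> n; exact: approximable_onem.
  + by move=> n x; rewrite (le_trans (ler_normB _ _))// normr1 (_ : 2 = 1 + 1)// lerD2l.
  + move=> x; have [xF|xF] := boolP (x \in \bigcup_k F k).
      move: (xF); rewrite inE => -[k _ Fkx]; apply: cvg_near_cst.
      exists k.+1 => // n /= kn; rewrite /g (bigD1 (Ordinal kn))//= mem_set// subrr mul0r.
      by rewrite subr0.
    apply: cvg_near_cst; apply: nearW => n; rewrite /g big1 ?subrr// => k _.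
    rewrite memNset ?subr0// => Fkx; move: xF; rewrite notin_setE; apply.
    by exists k.
Qed.

(** Passes from functions to events: [threshold_poly] composed with g is a polynomial in g, hence
    approximable, and converges boundedly to the indicator. *)
Lemma approximable_threshold g : approximable g -> (forall x, 0 <= g x <= 1) ->
  approximable_events [set x | 1 / 2 < g x].
Proof.
move=> ag g01; apply: (@approximable_lim (fun n x => threshold_poly n (g x)) _ 1).
- move=> n; rewrite /threshold_poly; apply: approximable_mul; apply: approximable_onem.
    apply: approximable_exp; apply: approximable_mul; first exact: approximable_cst.
    by apply: approximable_mul => //; exact: approximable_onem.
  by apply: approximable_exp; apply: approximable_onem; exact: approximable_exp.
- by move=> n x; exact: threshold_poly_norm_le1.
- move=> x; have := threshold_poly_cvg (g01 x).
  by rewrite (_ : (x \in _) = (1 / 2 < g x))//; apply/idP/idP; rewrite inE.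
Qed.

End algebra_approximation.

Section measure_equality.
Context d (T : measurableType d) (R : realType).
Variables m1 m2 : {finite_measure set T -> \bar R}.

Variable Alg : (T -> R) -> Prop.
Hypotheses (Alg_measurable : forall F, Alg F -> measurable_fun setT F)
  (Alg_bounded : forall F, Alg F -> exists M : R, forall x, `|F x| <= M).

(** Approximating for the sum of the two measures yields one F that is close to the indicator for
    both. *)
Lemma approximable_measure_eq (A : set T) : measurable A ->
  (forall F, Alg F -> (\int[m1]_x F x = \int[m2]_x F x)%R) ->
  approximable_events (measure_add m1 m2) Alg A -> m1 A = m2 A.
Proof.
move=> mA m12 [mf bf aA]; suff : fine (m1 A) = fine (m2 A).
  by move=> E; rewrite -[LHS]fineK ?fin_num_measure// E fineK ?fin_num_measure.
have fineE (m : {finite_measure set T -> \bar R}) : fine (m A) = (\int[m]_x ((x \in A)%:R : R))%R.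
  rewrite /Rintegral -[in LHS](setIT A) -(integral_indic m measurableT mA).
  by congr fine; apply: eq_integral => x _; rewrite indicE.
apply/eqP; rewrite -subr_eq0 -normr_le0; apply/ler_addgt0Pr => e e0; rewrite add0r.
have [F AF] := aA _ e0.
have mF := Alg_measurable AF; have [M FM] := Alg_bounded AF.
have bfF x : `| `|(x \in A)%:R - F x| | <= 1 + M.
  rewrite normr_id (le_trans (ler_normB _ _))// lerD//.
  by case: (x \in A); rewrite ?normr1 ?normr0.
have mfF : measurable_fun setT (fun x => `|(x \in A)%:R - F x|).
  by apply: measurableT_comp => //; exact: measurable_funB.
have int (m : {finite_measure set T -> \bar R}) :
    m.-integrable setT (EFin \o (fun x => `|(x \in A)%:R - F x|)).
  exact: bounded_integrable bfF.
have -> : (\int[measure_add m1 m2]_x `|(x \in A)%:R - F x|)%R =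
   (\int[m1]_x `|(x \in A)%:R - F x|)%R + (\int[m2]_x `|(x \in A)%:R - F x|)%R.
  rewrite /Rintegral integral_measure_add//; [|exact: int..].
  by rewrite fineD//; apply: integrable_fin_num => //; exact: int.
apply: le_trans.
have dist (m : {finite_measure set T -> \bar R}) :
    `|fine (m A) - (\int[m]_x F x)%R| <= (\int[m]_x `|(x \in A)%:R - F x|)%R.
  rewrite fineE -RintegralB//.
  - apply: le_normr_Rintegral => //; apply: bounded_integrable (1 + M) _ _ => [|x].
      exact: measurable_funB.
    by have := bfF x; rewrite normr_id.
  - by case: bf => N bN; exact: bounded_integrable bN.
  - exact: bounded_integrable FM.
apply: le_trans (lerD (dist m1) (dist m2)); rewrite (m12 F AF).
rewrite (distrC (fine (m2 A))) (le_trans _ (ler_normD _ _))// addrA subrK//.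
Qed.

End measure_equality.

Section trigonometric_functionals.
Context {R : realType}.

(** The phase b includes sines and constants and, by the product-to-sum formula, makes the class
    closed under products. *)
Inductive trig_functional : (path_space R -> R) -> Prop :=
| trig_cos c s b : trig_functional (fun f => c * cos (path_comb s f + b))
| trig_add F G : trig_functional F -> trig_functional G -> trig_functional (fun f => F f + G f).

Lemma measurable_eval (t : R) : measurable_fun setT (fun f : path_space R => f t : measurableTypeR R).
Proof.
move=> _ B mB; rewrite setTI; apply: sub_sigma_algebra; exists t => //.
by exists B => //; rewrite setTI.
Qed.

Lemma measurable_path_comb s : measurable_fun setT (path_comb s : path_space R -> R).
Proof.
apply: measurable_sum => p; apply: measurable_funM => //.
exact: measurable_eval.
Qed.

Lemma trig_measurable F : trig_functional F -> measurable_fun setT F.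
Proof.
elim=> [c s b|{}F G _ mF _ mG]; last exact: measurable_funD.
apply: measurable_funM => //.
apply: (@measurableT_comp _ _ _ _ _ _ (cos : R -> R)).
  by apply: continuous_measurable_fun; exact: continuous_cos.
by apply: measurable_funD => //; exact: measurable_path_comb.
Qed.

Lemma trig_bounded F : trig_functional F -> exists M : R, forall f, `|F f| <= M.
Proof.
elim=> [c s b|{}F G _ [M FM] _ [N GN]].
  by exists `|c| => f; rewrite normrM ler_piMr// cos_norm_le1.
by exists (M + N) => f; rewrite (le_trans (ler_normD _ _))// lerD.
Qed.

Lemma trig_cst c : trig_functional (fun=> c).
Proof.
have := trig_cos c [::] 0; rewrite (_ : (fun=> _) = fun=> c)//.
by apply/funext => f; rewrite /path_comb big_nil addr0 cos0 mulr1.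
Qed.

Lemma trig_mul F G : trig_functional F -> trig_functional G ->
  trig_functional (fun f => F f * G f).
Proof.
elim=> [c s b|{}F F' _ IH _ IH'] tG; last first.
  by under eq_fun do rewrite mulrDl; apply: trig_add; [exact: IH|exact: IH'].
elim: tG => [c' s' b'|{}G G' _ IH _ IH']; last first.
  by under eq_fun do rewrite mulrDr; apply: trig_add; [exact: IH|exact: IH'].
have := trig_add (trig_cos (c * c' / 2) (s ++ s') (b + b'))
  (trig_cos (c * c' / 2) (s ++ comb_opp s') (b - b')).
rewrite (_ : (fun f => _ + _) = (fun f => c * cos (path_comb s f + b) * (c' * cos (path_comb s' f + b'))))//.
apply/funext => f; rewrite !path_comb_cat path_comb_opp mulrACA cosDcosB.
have -> : path_comb s f + path_comb s' f + (b + b') = path_comb s f + b + (path_comb s' f + b') by ring.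
have -> : path_comb s f - path_comb s' f + (b - b') = path_comb s f + b - (path_comb s' f + b') by ring.
by field.
Qed.

(** For large n the scaled argument lies in ]-pi, pi[, where the sine has the sign of its argument;
    thresholding (1 + sin) / 2 at 1 / 2 thus detects y > 0. *)
Lemma sin_scale_gt0_cvg (y : R) :
  ((1 / 2 < (1 + sin (n.+1%:R^-1 * y)) / 2)%R%:R : R) @[n --> \oo] --> ((0 < y)%R%:R : R).
Proof.
apply: cvg_near_cst.
have small : \forall n \near \oo, `|n.+1%:R^-1 * y| < pi.
  have h : (fun n : nat => n.+1%:R^-1 * y) @ \oo --> (0 : R).
    rewrite -[X in _ --> X](mul0r y); apply: cvgMl.
    exact: cvg_harmonic.
  by apply: (cvgr0_norm_lt _ h); exact: pi_gt0.
apply: filterS small => n; rewrite ltr_norml => /andP[h1 h2].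
have n0 : (0 : R) < n.+1%:R^-1 by rewrite invr_gt0.
congr (_%:R); congr (nat_of_bool _).
rewrite ltr_pM2r ?invr_gt0// ltrDl.
have [y0|y0] := ltP 0 y.
  by apply/sin_gt0_pi; rewrite h2 mulr_gt0.
apply/negbTE; rewrite -leNgt -oppr_ge0 -sinN; apply: sin_ge0_pi.
rewrite -mulrN mulr_ge0 ?oppr_ge0 ?(ltW n0)//= mulrN.
by rewrite ltW// ltrNl.
Qed.

(** The Borel sets whose preimage under evaluation at t is approximable form a sigma-algebra, so
    half-lines suffice; their indicators are limits of thresholded bounded sines, which are
    trigonometric functionals. *)
Lemma approximable_path_events (nu : {measure set (path_space R) -> \bar R})
  (A : set (path_space R)) : (nu setT < +oo)%E -> measurable A -> approximable_events nu trig_functional A.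
Proof.
move=> nuT; pose E := approximable_events nu trig_functional.
have sE : sigma_algebra setT E.
  exact: (approximable_events_sigma_algebra nuT trig_measurable trig_bounded trig_cst trig_add trig_mul).
move=> mA; suff : coordinate_events R `<=` E.
  by move=> /(smallest_sub sE); apply.
move=> _ [t _ [B mB <-]].
pose S := image_set_system setT (fun f : path_space R => f t) E.
have sS : sigma_algebra setT S by exact: sigma_algebra_image.
suff : S B by rewrite /S /image_set_system/= !setTI.
have mB' : (RGenOInfty.G (R:=R)).-sigma.-measurable B by rewrite -RGenOInfty.measurableE.
suff : RGenOInfty.G (R:=R) `<=` S by move=> /(smallest_sub sS); apply.
move=> _ [x ->]; rewrite /S /image_set_system/= setTI.
pose F n (f : path_space R) := (1 + sin (n.+1%:R^-1 * (f t - x))) / 2.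
have aF n : trig_functional (F n).
  have := trig_add (trig_cst (1 / 2)) (trig_cos (1 / 2) [:: (n.+1%:R^-1, t)] (- (n.+1%:R^-1 * x) - pi / 2)).
  rewrite (_ : (fun f => _ + _) = F n)//; apply/funext => f.
  rewrite /F /path_comb big_seq1/= addrA -mulrBr.
  by rewrite cosBpihalf; field.
have F01 n f : 0 <= F n f <= 1.
  have := sin_geN1 (n.+1%:R^-1 * (f t - x)); have := sin_le1 (n.+1%:R^-1 * (f t - x)).
  by rewrite /F; lra.
apply: (@approximable_lim _ _ _ _ nuT _ trig_measurable trig_bounded
  (fun n f => (f \in [set f : path_space R | 1 / 2 < F n f])%:R) _ 1).
- move=> n; apply: (approximable_threshold nuT trig_measurable trig_bounded trig_cst trig_add trig_mul) => //.
  by apply: approximable_alg => //; [exact: trig_measurable|exact: trig_bounded].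
- by move=> n f; case: (f \in _); rewrite ?normr1 ?normr0.
- move=> f; have := @sin_scale_gt0_cvg (f t - x).
  have -> : (f \in [eta (fun f0 : path_space R => f0 t)] @^-1` `]x, +oo[%classic) = (0 < f t - x) :> bool.
    by apply/idP/idP; rewrite inE/= in_itv/= andbT subr_gt0.
  apply: cvg_trans; apply: near_eq_cvg; apply: nearW => n.
  by congr (_%:R); congr (nat_of_bool _); apply/idP/idP; rewrite inE.
Qed.

End trigonometric_functionals.

(** * Decorrelation of trigonometric functionals *)

Lemma ler_expRNB (R : realType) (x y : R) : 0 <= x -> 0 <= y ->
  `|expR (- x) - expR (- y)| <= `|x - y|.
Proof.
wlog xy : x y / x <= y.
  move=> H x0 y0; case: (leP x y) => [xy|/ltW yx]; first exact: H.
  by rewrite distrC (distrC x); exact: H.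
move=> x0 y0; have -> : expR (- x) - expR (- y) = expR (- x) * (1 - expR (- (y - x))).
  by rewrite mulrBr mulr1 -expRD; congr (_ - expR _); ring.
have h : 0 <= 1 - expR (- (y - x)).
  by rewrite subr_ge0 expR_le1 oppr_le0 subr_ge0.
rewrite distrC (ger0_norm (_ : 0 <= y - x)) ?subr_ge0// ger0_norm ?mulr_ge0 ?expR_ge0//.
rewrite -[leRHS]mul1r ler_pM ?expR_ge0 ?expR_le1 ?oppr_le0//.
by have := expR_ge1Dx (- (y - x)); lra.
Qed.

Section cov_dominated.
Context {R : realType}.
Variable K : R -> R.

(** Domination by finitely many translates of |K| is stable under sums and multiples, and reduces
    smallness in mean to that of the translates of K. *)
Definition cov_dominated (D : R -> R) : Prop :=
  exists2 M : R, 0 <= M & exists us : seq R, forall t, `|D t| <= M * \sum_(u <- us) `|K (t + u)|.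

Lemma cov_dominated_le (D D' : R -> R) (c : R) : 0 <= c ->
  (forall t, `|D' t| <= c * `|D t|) -> cov_dominated D -> cov_dominated D'.
Proof.
move=> c0 D'D [M M0 [us DM]]; exists (c * M); first exact: mulr_ge0.
by exists us => t; rewrite (le_trans (D'D t))// -mulrA ler_wpM2l.
Qed.

Lemma cov_dominatedD (D D' : R -> R) : cov_dominated D -> cov_dominated D' ->
  cov_dominated (fun t => D t + D' t).
Proof.
move=> [M M0 [us DM]] [M' M'0 [us' D'M]]; exists (M + M'); first exact: addr_ge0.
exists (us ++ us') => t; rewrite big_cat/=.
have s0 (l : seq R) : 0 <= \sum_(u <- l) `|K (t + u)| by apply: sumr_ge0.
have := s0 us; have := s0 us'; have := DM t; have := D'M t.
by move=> h1 h2 h3 h4; rewrite (le_trans (ler_normD _ _))//; nra.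
Qed.

Lemma cov_dominated0 : cov_dominated (fun=> 0).
Proof. by exists 0 => //; exists [::] => t; rewrite normr0 mul0r. Qed.

Lemma cov_dominated_sum (I : Type) (r : seq I) (D : I -> R -> R) :
  (forall i, cov_dominated (D i)) -> cov_dominated (fun t => \sum_(i <- r) D i t).
Proof.
move=> DD; elim: r => [|i r IH].
  by under eq_fun do rewrite big_nil; exact: cov_dominated0.
by under eq_fun do rewrite big_cons; exact: cov_dominatedD.
Qed.

Lemma cov_dominated_shift c u : cov_dominated (fun t => c * K (t + u)).
Proof.
by exists `|c| => //; exists [:: u] => t; rewrite big_seq1 normrM.
Qed.

Lemma cov_dominated_form s s' :
  cov_dominated (fun t => cov_form K s (comb_shift t s')).
Proof.
rewrite /cov_form; under eq_fun do under eq_bigr do rewrite big_map.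
apply: cov_dominated_sum => p; apply: cov_dominated_sum => q.
have := cov_dominated_shift (p.1 * q.1) (p.2 - q.2).
by rewrite (_ : (fun t => _) = (fun t => p.1 * q.1 * K (p.2 - (q.2 - t))))//;
  apply/funext => t; congr (_ * K _); ring.
Qed.

End cov_dominated.

Section decorrelation.
Context {R : realType} {d : measure_display} {Omega : measurableType d}.
Variable P : probability Omega R.
Variable X : R -> {RV P >-> measurableTypeR R}.
Variable K : R -> R.
Hypotheses (X_gaussian : gaussian_process P X)
  (X_centered : forall t : R, ('E_P[X t] = 0)%E)
  (X_covariance : forall t s : R, covariance P (X t) (X s) = (K (t - s))%:E)
  (K_even : forall t, K (- t) = K t).

Definition path (w : Omega) : path_space R := fun s => X s w.

Definition path_shift (t : R) (w : Omega) : path_space R := fun s => X (s - t) w.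

Lemma path_shift0 : path_shift 0 = path.
Proof. by apply/funext => w; apply/funext => s; rewrite /path_shift subr0. Qed.

Lemma measurable_path_shift t : measurable_fun setT (path_shift t).
Proof.
apply: (@measurability _ _ Omega (path_space R) setT (path_shift t) (coordinate_events R)) => //.
move=> _ [_ [s _ [B mB <-]] <-]; rewrite !setTI.
have := measurable_funP (X (s - t)) measurableT B mB.
by rewrite setTI.
Qed.

Lemma measurable_path : measurable_fun setT path.
Proof. by rewrite -path_shift0; exact: measurable_path_shift. Qed.

Lemma measurable_path_event t (B : set (path_space R)) : measurable B ->
  measurable [set w | B (path_shift t w)].
Proof.
by move=> mB; have := measurable_path_shift t measurableT mB; rewrite setTI.
Qed.

Lemma trig_comp_measurable F t : trig_functional F ->
  measurable_fun setT (fun w => F (path_shift t w)).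
Proof.
move=> tF; apply: (@measurableT_comp _ _ _ _ _ _ F); first exact: trig_measurable.
exact: measurable_path_shift.
Qed.

Lemma trig_comp_integrable F t : trig_functional F ->
  P.-integrable setT (EFin \o (fun w => F (path_shift t w))).
Proof.
move=> tF; have [M FM] := trig_bounded tF.
by apply: (@bounded_integrable _ _ _ _ _ M) => //; exact: trig_comp_measurable.
Qed.

Lemma trig_product_integrable F G t : trig_functional F -> trig_functional G ->
  P.-integrable setT (EFin \o (fun w => F (path w) * G (path_shift t w))).
Proof.
move=> tF tG; have [M FM] := trig_bounded tF; have [N GN] := trig_bounded tG.
apply: (@bounded_integrable _ _ _ _ _ (M * N)).
  by rewrite -path_shift0; apply: measurable_funM; exact: trig_comp_measurable.
by move=> w; rewrite normrM ler_pM.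
Qed.

Lemma trig_expectation c s b t :
  (\int[P]_w (c * cos (path_comb s (path_shift t w) + b)))%R =
  c * (cos b * expR (- (cov_form K s s / 2))).
Proof.
have intc := trig_comp_integrable t (trig_cos 1 s b).
rewrite RintegralZl//; last first.
  by move: intc; apply: eq_integrable => // w _; rewrite /= mul1r.
congr (_ * _); rewrite -(cov_form_shift K t s) -(lin_cos X_gaussian X_centered X_covariance).
by apply: eq_Rintegral => w _; rewrite /lin path_comb_shift.
Qed.

Lemma trig_stationary F t : trig_functional F ->
  (\int[P]_w F (path_shift t w))%R = (\int[P]_w F (path w))%R.
Proof.
rewrite -path_shift0; elim=> [c s b|{}F G tF IHF tG IHG]; first by rewrite !trig_expectation.
rewrite !RintegralD//; [by rewrite IHF IHG|exact: trig_comp_integrable..].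
Qed.

(** By bilinearity only two cosines are compared. The product-to-sum formula gives variances a + 2 g
    and a - 2 g in place of a, with g the cross-covariance, and exp (- x) is 1-Lipschitz on x >=
    0. *)
Lemma trig_decorrelation F G : trig_functional F -> trig_functional G ->
  cov_dominated K (fun t => (\int[P]_w (F (path w) * G (path_shift t w)))%R -
    (\int[P]_w F (path w))%R * (\int[P]_w G (path w))%R).
Proof.
have int0 H : trig_functional H -> P.-integrable setT (EFin \o (fun w => H (path w))).
  by move=> tH; rewrite -path_shift0; exact: trig_comp_integrable.
move=> tF tG; elim: tF => [c s b|{}F F' tF IHF tF' IHF']; last first.
  have := cov_dominatedD IHF IHF'.
  rewrite (_ : (fun t => _ + _) = (fun t =>
   (\int[P]_w ((F (path w) + F' (path w)) * G (path_shift t w)))%R -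
    (\int[P]_w (F (path w) + F' (path w)))%R * (\int[P]_w G (path w))%R))//.
  apply/funext => t; under [in RHS]eq_Rintegral do rewrite mulrDl.
  rewrite !RintegralD//; first ring; try exact: int0; exact: trig_product_integrable.
elim: tG => [c' s' b'|{}G G' tG IHG tG' IHG']; last first.
  have := cov_dominatedD IHG IHG'.
  have tc := trig_cos c s b.
  rewrite (_ : (fun t => _ + _) = (fun t =>
   (\int[P]_w (c * cos (path_comb s (path w) + b) * (G (path_shift t w) + G' (path_shift t w))))%R -
    (\int[P]_w (c * cos (path_comb s (path w) + b)))%R * (\int[P]_w (G (path w) + G' (path w)))%R))//.
  apply/funext => t; under [in RHS]eq_Rintegral do rewrite mulrDr.
  have iG := trig_product_integrable t tc tG; have iG' := trig_product_integrable t tc tG'.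
  by rewrite !RintegralD//; [ring|exact: int0|exact: int0].
apply: cov_dominated_le (cov_dominated_form K s s') => [|t].
  exact: (normr_ge0 (c * c')).
(* The shift t enters through g alone: by stationarity the variance of the shifted combination is
   that of [s']. *)
set g := cov_form K s (comb_shift t s').
pose s1 := s ++ comb_shift t s'; pose s2 := s ++ comb_opp (comb_shift t s').
pose a := cov_form K s s + cov_form K s' s'.
have s1E : cov_form K s1 s1 = a + 2 * g.
  rewrite /s1 !cov_form_catl !cov_form_catr cov_form_shift (cov_formC (comb_shift t s') s)// -/g.
  by rewrite /a; ring.
have s2E : cov_form K s2 s2 = a - 2 * g.
  rewrite /s2 !cov_form_catl !cov_form_catr !cov_form_oppl !cov_form_oppr cov_form_shift.
  rewrite (cov_formC (comb_shift t s') s)// -/g /a; ring.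
have ge0 l := cov_form_ge0 X_centered X_covariance l.
have -> : (\int[P]_w (c * cos (path_comb s (path w) + b) *
    (c' * cos (path_comb s' (path_shift t w) + b'))))%R =
  c * c' / 2 * (cos (b + b') * expR (- (cov_form K s1 s1 / 2))) +
  c * c' / 2 * (cos (b - b') * expR (- (cov_form K s2 s2 / 2))).
  rewrite -!(trig_expectation _ _ _ 0) -RintegralD//; last 2 first.
  - exact: (trig_comp_integrable 0 (trig_cos (c * c' / 2) s1 (b + b'))).
  - exact: (trig_comp_integrable 0 (trig_cos (c * c' / 2) s2 (b - b'))).
  apply: eq_Rintegral => w _; rewrite path_shift0 /s1 /s2 !path_comb_cat path_comb_opp path_comb_shift.
  rewrite -/(path_shift t w); set u := path_comb s _; set v := path_comb s' _.
  rewrite mulrACA cosDcosB.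
  have -> : u + v + (b + b') = u + b + (v + b') by ring.
  have -> : u - v + (b - b') = u + b - (v + b') by ring.
  by field.
rewrite -path_shift0 !trig_expectation s1E s2E.
have -> : c * (cos b * expR (- (cov_form K s s / 2))) * (c' * (cos b' * expR (- (cov_form K s' s' / 2)))) =
  c * c' / 2 * (cos (b + b') * expR (- (a / 2))) + c * c' / 2 * (cos (b - b') * expR (- (a / 2))).
  rewrite mulrACA (mulrACA (cos b)) cosDcosB -expRD.
  have -> : - (cov_form K s s / 2) + - (cov_form K s' s' / 2) = - (a / 2) by rewrite /a; field.
  by field.
have h1 : `|expR (- ((a + 2 * g) / 2)) - expR (- (a / 2))| <= `|g|.
  have -> : `|g| = `|(a + 2 * g) / 2 - a / 2| by congr `|_|; field.
  by apply: ler_expRNB; rewrite divr_ge0//; [rewrite -s1E; exact: ge0|rewrite addr_ge0//; exact: ge0].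
have h2 : `|expR (- ((a - 2 * g) / 2)) - expR (- (a / 2))| <= `|g|.
  have -> : `|g| = `|(a - 2 * g) / 2 - a / 2| by rewrite -normrN; congr `|_|; field.
  by apply: ler_expRNB; rewrite divr_ge0//; [rewrite -s2E; exact: ge0|rewrite addr_ge0//; exact: ge0].
set e1 := expR (- ((a + 2 * g) / 2)) in h1 *; set e2 := expR (- ((a - 2 * g) / 2)) in h2 *.
set e0 := expR (- (a / 2)) in h1 h2 *.
have -> : c * c' / 2 * (cos (b + b') * e1) + c * c' / 2 * (cos (b - b') * e2) -
   (c * c' / 2 * (cos (b + b') * e0) + c * c' / 2 * (cos (b - b') * e0)) =
   c * c' * ((cos (b + b') * (e1 - e0) + cos (b - b') * (e2 - e0)) / 2) by field.
rewrite normrM ler_wpM2l// normrM (ger0_norm (_ : 0 <= 2^-1)) ?invr_ge0// ler_pdivrMr//.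
apply: (le_trans (ler_normD _ _)); rewrite !normrM mulr_natr mulr2n lerD//.
  by rewrite -[leRHS]mul1r ler_pM// cos_norm_le1.
by rewrite -[leRHS]mul1r ler_pM// cos_norm_le1.
Qed.

(** Trigonometric functionals determine a finite measure on path space, so equality of their
    expectations extends to all events. *)
Lemma path_law_stationary t (B : set (path_space R)) : measurable B ->
  P [set w | B (path_shift t w)] = P [set w | B (path w)].
Proof.
move=> mB; pose X0 : {RV P >-> path_space R} := mfun_Sub (mem_set measurable_path).
pose Xt : {RV P >-> path_space R} := mfun_Sub (mem_set (measurable_path_shift t)).
apply: (@approximable_measure_eq _ _ _ (distribution P Xt) (distribution P X0) _
  trig_measurable trig_bounded B mB); last first.
  apply: approximable_path_events => //.
  rewrite [X in (X < _)%E](measure_addE (distribution P Xt) (distribution P X0)).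
  by rewrite lte_add_pinfty// ltey_eq fin_num_measure.
move=> F tF; have tr (Y : {RV P >-> path_space R}) :
    (\int[distribution P Y]_x F x)%R = (\int[P]_w F (Y w))%R.
  congr fine; have [M FM] := trig_bounded tF.
  rewrite (@integral_distribution _ _ _ _ _ P Y (EFin \o F))//.
    by apply/measurable_EFinP; exact: trig_measurable.
  have : P.-integrable setT (EFin \o (fun w => F (Y w))) => //.
  apply: (@bounded_integrable _ _ _ _ _ M) => //.
  by apply: (@measurableT_comp _ _ _ _ _ _ F); [exact: trig_measurable|exact: measurable_funP].
by rewrite !tr /=; exact: trig_stationary.
Qed.

End decorrelation.

(** * Means over long intervals *)

Section cesaro_means.
Context {R : realType}.
Notation leb := (@lebesgue_measure R).

Lemma lebesgue_measure_shift (c : R) (A : set (measurableTypeR R)) : measurable A ->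
  leb A = pushforward leb ((fun t => t + c) : _ -> measurableTypeR R) A.
Proof.
have mc : measurable_fun setT ((fun t => t + c) : R -> measurableTypeR R).
  exact: measurable_funD.
move=> mA; apply: (@lebesgue_measure_unique _ (pushforward leb _)) => //= _ [[a b]] _ <-.
rewrite /pushforward (_ : _ @^-1` _ = `]a - c, b - c]%classic).
  rewrite !lebesgue_measure_itv/= !lte_fin ltrD2r; case: ifP => // _.
  by rewrite -!EFinB; congr (_%:E); ring.
by apply/seteqP; split => x /=; rewrite !in_itv/= ltrBlDr lerBrDr.
Qed.

Lemma integral_shift (f : R -> \bar R) (a b c : R) : measurable_fun setT f ->
  (forall x, 0 <= f x)%E ->
  (\int[leb]_(t in `[a, b]) f (t + c)%R = \int[leb]_(t in `[(a + c)%R, (b + c)%R]) f t)%E.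
Proof.
move=> mf f0.
have mc : measurable_fun setT ((fun t => t + c) : measurableTypeR R -> measurableTypeR R).
  exact: measurable_funD.
rewrite [RHS](@eq_measure_integral _ _ _ _ (pushforward leb ((fun t => t + c) : _ -> measurableTypeR R))); last first.
  by move=> A mA _; exact: lebesgue_measure_shift.
rewrite ge0_integral_pushforward//=; last exact: measurable_funTS.
congr integral; apply/seteqP; split => x /=; by rewrite !in_itv/= !lerD2r.
Qed.

(** Replacing h by its translate by [tau j] changes the integral over [0, T] by at most [tau j],
    while the m translates together integrate to at most T. The mean of h is therefore about 1 / m
    at most for large T. *)
Lemma orthonormal_mean_bound (h : R -> R) (tau : nat -> R) (m : nat) (T : R) :
  measurable_fun setT h -> (forall t, 0 <= h t <= 1) -> (forall j, 0 <= tau j) -> 0 <= T ->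
  (forall t, \sum_(j < m) h (t + tau j) <= 1) ->
  (m%:R%:E * \int[leb]_(t in `[0%R, T]) (h t)%:E <= (\sum_(j < m) tau j + T)%:E)%E.
Proof.
move=> mh h01 tau0 T0 hsum.
have mhE (D : set R) : measurable_fun D (EFin \o h).
  by apply/measurable_EFinP; exact: measurable_funTS.
have h0 x : (0 <= (h x)%:E)%E by rewrite lee_fin; case/andP: (h01 x).
have step j : (\int[leb]_(t in `[0%R, T]) (h t)%:E <=
    (tau j)%:E + \int[leb]_(t in `[0%R, T]) (h (t + tau j))%:E)%E.
  have -> : (\int[leb]_(t in `[0%R, T]) (h (t + tau j))%:E =
      \int[leb]_(t in `[(0 + tau j)%R, (T + tau j)%R]) (h t)%:E)%E.
    exact: (@integral_shift (EFin \o h)).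
  apply: (@le_trans _ _ (\int[leb]_(t in `[0%R, tau j] `|` (`]tau j, (T + tau j)%R])) (h t)%:E)%E).
    apply: ge0_subset_integral => //; [exact: measurableU|exact: mhE|].
    move=> x /=; rewrite !in_itv/= => /andP[x0 xT].
    have [xt|xt] := leP x (tau j); [left|right]; first by rewrite x0.
    by rewrite (le_trans xT)// lerDl.
  rewrite ge0_integral_setU//; [|exact: mhE|]; last first.
    by apply/disj_setPS => x [] /=; rewrite !in_itv/= => /andP[_ +] /andP[+ _]; rewrite leNgt => /negbTE ->.
  apply: leeD.
    apply: (@le_trans _ _ (\int[leb]_(t in `[0%R, tau j]) 1%:E)%E).
      apply: ge0_le_integral => //; first exact: mhE.
      by move=> x _; rewrite lee_fin; case/andP: (h01 x).
    rewrite [leLHS]integral_cst// [X in (_ * X)%E]lebesgue_measure_itv/= lte_fin mul1e.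
    by case: ifP => _; rewrite ?sube0// lee_fin.
  apply: ge0_subset_integral => //; first exact: mhE.
  by move=> x /=; rewrite !in_itv/= add0r => /andP[/ltW -> ->].
have sumE : (\sum_(j < m) (\int[leb]_(t in `[0%R, T]) (h (t + tau j))%:E) <= T%:E)%E.
  have mj (j : 'I_m) : measurable_fun `[0%R, T] (fun t => (h (t + tau j))%:E).
    apply/measurable_EFinP; apply: measurable_funTS; apply: (measurableT_comp mh).
    exact: measurable_funD.
  have <- : (\int[leb]_(t in `[0%R, T]) (\sum_(j < m) (h (t + tau j))%:E) =
      \sum_(j < m) (\int[leb]_(t in `[0%R, T]) (h (t + tau j))%:E))%E.
    by rewrite ge0_integral_sum.
  apply: (@le_trans _ _ (\int[leb]_(t in `[0%R, T]) 1%:E)%E).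
    apply: ge0_le_integral => //.
    - by move=> x _; apply: sume_ge0 => j _.
    - exact: emeasurable_sum.
    - by move=> x _; rewrite sumEFin lee_fin.
  rewrite [leLHS]integral_cst// [X in (_ * X)%E]lebesgue_measure_itv/= lte_fin mul1e.
  by case: ifP => _; rewrite ?sube0// lee_fin.
have -> : (m%:R%:E * \int[leb]_(t in `[0%R, T]) (h t)%:E =
    \sum_(j < m) \int[leb]_(t in `[0%R, T]) (h t)%:E)%E.
  by rewrite sumr_const card_ord muleC mule_natr.
apply: (@le_trans _ _ (\sum_(j < m) ((tau j)%:E + \int[leb]_(t in `[0%R, T]) (h (t + tau j))%:E))%E).
  by apply: lee_sum => j _; exact: step.
by rewrite big_split/= EFinD -sumEFin leeD2l.
Qed.

(** The integral of a nonnegative function is a supremum over simple functions below it, hence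
    monotone. It is applied to the mixing defect, whose measurability in t is never discussed. *)
Lemma ge0_le_integral_nonmeasurable (D : set R) (f g : R -> \bar R) : measurable D ->
  (forall x, 0 <= f x)%E -> (forall x, f x <= g x)%E ->
  (\int[leb]_(x in D) f x <= \int[leb]_(x in D) g x)%E.
Proof.
move=> mD f0 fg; rewrite !ge0_integralE//; last by move=> x _; exact: le_trans (fg x).
apply: le_ereal_sup => _ [h hf <-]; exists h => // x.
apply: (le_trans (hf x)); rewrite !patchE; by case: ifP.
Qed.

Lemma mean_to_zeroP (g : R -> \bar R) :
  (forall e : R, 0 < e -> exists T0 : R, forall T : R, T0 <= T -> 0 < T ->
    (\int[leb]_(t in `[0%R, T]) `|g t| <= (e * T)%:E)%E) -> mean_to_zero g.
Proof.
move=> H; have nn T : (0 <= \int[leb]_(t in `[0%R, T]) `|g t|)%E by exact: integral_ge0.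
apply/fine_cvgP; split.
  have [T0 HT0] := H _ ltr01.
  near=> T; rewrite fin_numM//; rewrite ge0_fin_numE//.
  apply: le_lt_trans (HT0 _ _ _) (ltry _); near: T.
    exact: (nbhs_pinfty_ge (num_real _)).
  exact: (nbhs_pinfty_gt (num_real _)).
apply/cvgr0Pnorm_le => e e0; have [T0 HT0] := H _ e0.
near=> T; have T00 : 0 < T by near: T; exact: (nbhs_pinfty_gt (num_real _)).
have hT : (\int[leb]_(t in `[0%R, T]) `|g t| <= (e * T)%:E)%E.
  by apply: HT0 => //; near: T; exact: (nbhs_pinfty_ge (num_real _)).
have fn : (\int[leb]_(t in `[0%R, T]) `|g t| \is a fin_num)%E.
  by rewrite ge0_fin_numE// (le_lt_trans hT) ?ltry.
rewrite /= fineM// /= ger0_norm; last by rewrite mulr_ge0 ?invr_ge0 ?(ltW T00)// fine_ge0.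
by rewrite ler_pdivrMl// mulrC -lee_fin fineK.
Unshelve. all: by end_near. Qed.

Lemma mean_to_zero_cst (c : R) : mean_to_zero (fun=> c%:E) -> c = 0.
Proof.
move=> H; apply/normr0_eq0.
have h : (fun T : R => `|c|%:E) @ pinfty_nbhs R --> (0 : R)%:E.
  move: H; apply: cvg_trans; apply: near_eq_cvg; near=> T.
  have T00 : 0 < T by near: T; exact: (nbhs_pinfty_gt (num_real _)).
  rewrite [X in (_ * X)%E]integral_cst// [X in (_ * (_ * X))%E]lebesgue_measure_itv/= lte_fin T00.
  by rewrite sube0 -!EFinM mulrCA mulVf ?mulr1// gt_eqF.
suff : (0 : R)%:E = `|c|%:E :> \bar R by move=> [].
transitivity (lim ((fun _ : R => `|c|%:E : \bar R) @ pinfty_nbhs R)).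
  by apply/esym/cvg_lim => //; exact: ereal_hausdorff.
by apply/cvg_lim; [exact: ereal_hausdorff|exact: cvg_cst].
Unshelve. all: by end_near. Qed.

(** The inequality |y| <= e / 2 + y ^ 2 / (2 e) trades the first power for the square, which is what
    the Bessel bound controls. *)
Lemma orthonormal_cesaro (K : R -> R) (tau : nat -> R) :
  measurable_fun setT K -> (forall j, 0 <= tau j) ->
  (forall m t, \sum_(j < m) K (t + tau j) ^+ 2 <= 1) ->
  forall u e : R, 0 < e -> exists T0 : R, forall T : R, T0 <= T -> 0 < T ->
    (\int[leb]_(t in `[0%R, T]) `|K (t + u)|%:E <= (e * T)%:E)%E.
Proof.
move=> mK tau0 bessel u e e0.
pose h t := K (t + u) ^+ 2.
have mKu : measurable_fun setT (fun t : R => K (t + u)).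
  by apply: (measurableT_comp mK); exact: measurable_funD.
have mh : measurable_fun setT h by exact: measurable_funX.
have h01 t : 0 <= h t <= 1.
  rewrite sqr_ge0/=; have := bessel 1%N (t + u - tau 0%N).
  by rewrite big_ord_recl big_ord0 addr0 subrK.
(* Since m > 2 / e ^ 2, the square part contributes at most e T / 4; the choice of T0 makes the loss
   [A] from the translations another e T / 4. *)
pose m := (Num.truncn (2 / e ^+ 2)).+1.
have m0 : (0 : R) < m%:R by [].
have mlt : 2 / e ^+ 2 < m%:R by exact: truncnS_gt.
pose A := \sum_(j < m) tau j.
exists (2 * A / (m%:R * e ^+ 2)) => T TA T0.
have hB : (\int[leb]_(t in `[0%R, T]) (h t)%:E <= ((A + T) / m%:R)%:E)%E.
  have := @orthonormal_mean_bound h tau m T mh h01 tau0 (ltW T0).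
  rewrite -lee_pdivlMl//; rewrite -EFinM mulrC; apply.
  by move=> t; under eq_bigr do rewrite /h addrAC; exact: bessel.
apply: (@le_trans _ _ (\int[leb]_(t in `[0%R, T]) ((e / 2)%:E + (2 * e)^-1%:E * (h t)%:E))%E).
  apply: ge0_le_integral => //.
  - by apply/measurable_EFinP; apply: measurable_funTS; exact: measurableT_comp.
  - by apply: emeasurable_funD => //; apply: measurable_funeM; apply/measurable_EFinP; exact: measurable_funTS.
  - move=> t _; rewrite -EFinM -EFinD lee_fin /h -(real_normK (num_real (K (t + u)))).
    set y := `|K (t + u)|.
    have -> : e / 2 + (2 * e)^-1 * y ^+ 2 = (e ^+ 2 + y ^+ 2) / (2 * e) by field; rewrite gt_eqF.
    rewrite ler_pdivlMr; last by rewrite mulr_gt0.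
    by have := sqr_ge0 (e - y); rewrite sqrrB; nra.
rewrite ge0_integralD//; last 3 first.
- by move=> t _; rewrite lee_fin divr_ge0// ltW.
- by move=> t _; rewrite -EFinM lee_fin mulr_ge0 ?sqr_ge0// invr_ge0 mulr_ge0// ltW.
- by apply: measurable_funeM; apply/measurable_EFinP; exact: measurable_funTS.
rewrite [X in (X + _)%E]integral_cst// [X in (_ * X + _)%E]lebesgue_measure_itv/= lte_fin T0 sube0.
rewrite ge0_integralZl//; last 3 first.
- by apply/measurable_EFinP; exact: measurable_funTS.
- by move=> t _; rewrite lee_fin sqr_ge0.
- by rewrite lee_fin invr_ge0 mulr_ge0// ltW.
apply: (@le_trans _ _ ((e / 2 * T)%:E + ((2 * e)^-1)%:E * ((A + T) / m%:R)%:E)%E).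
  by rewrite EFinM leeD2l// lee_wpmul2l// lee_fin invr_ge0 mulr_ge0// ltW.
rewrite -EFinM -EFinD lee_fin.
have -> : (2 * e)^-1 * ((A + T) / m%:R) = A / (2 * e * m%:R) + T / (2 * e * m%:R).
  by field; rewrite !gt_eqF.
have h1 : A / (2 * e * m%:R) <= e * T / 4.
  move: TA; rewrite ler_pdivrMr; last by rewrite mulr_gt0// exprn_gt0.
  rewrite ler_pdivrMr; last by rewrite !mulr_gt0.
  by lra.
have h2 : T / (2 * e * m%:R) <= e * T / 4.
  rewrite ler_pdivrMr; last by rewrite !mulr_gt0.
  move: mlt; rewrite ltr_pdivrMr ?exprn_gt0// => mlt.
  have : T * 2 <= T * (m%:R * e ^+ 2) by rewrite ler_wpM2l// ltW.
  by lra.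
by lra.
Qed.

End cesaro_means.

(** * Weak mixing *)

Section weak_mixing.
Context {R : realType} {d : measure_display} {Omega : measurableType d}.
Variable P : probability Omega R.
Variable X : R -> {RV P >-> measurableTypeR R}.
Variable K : R -> R.
Variable tau : nat -> R.
Hypotheses (X_gaussian : gaussian_process P X)
  (X_centered : forall t : R, ('E_P[X t] = 0)%E)
  (X_covariance : forall t s : R, covariance P (X t) (X s) = (K (t - s))%:E)
  (K_even : forall t, K (- t) = K t) (K0 : K 0 = 1) (mK : measurable_fun setT K)
  (tau0 : forall j, 0 <= tau j)
  (tau_orth : forall i j, i != j -> K (tau i - tau j) = 0).

(* Bessel's inequality for the orthonormal family X (tau j) in L^2. *)
Lemma bessel_cov m (t : R) : \sum_(j < m) K (t + tau j) ^+ 2 <= 1.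
Proof.
pose c j := K (t + tau j).
(* With the head (1, - t) this is the residual of X (- t) after projection onto the span of the X
   (tau j); its variance is 1 minus the sum of squares. *)
pose l := [seq (- c j, tau j) | j <- iota 0 m].
have := cov_form_ge0 X_centered X_covariance ((1, - t) :: l).
have q j : K (tau j - - t) = c j by rewrite opprK addrC.
have -> : cov_form K ((1, - t) :: l) ((1, - t) :: l) = 1 - \sum_(j < m) c j ^+ 2; last first.
  by rewrite subr_ge0.
rewrite -cat1s cov_form_catl !cov_form_catr.
have -> : cov_form K [:: (1, - t)] [:: (1, - t)] = 1.
  by rewrite /cov_form !big_seq1/= subrr K0 !mulr1.
have s1 : cov_form K l [:: (1, - t)] = - \sum_(j < m) c j ^+ 2.
  rewrite /cov_form big_map -sumrN -(big_mkord xpredT (fun j => - c j ^+ 2)) /index_iota subn0.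
  apply: eq_bigr => j _; rewrite big_seq1/= q; ring.
rewrite (cov_formC [:: (1, - t)] l)// s1.
have -> : cov_form K l l = \sum_(j < m) c j ^+ 2; last by ring.
rewrite /cov_form big_map -(big_mkord xpredT (fun j => c j ^+ 2)) /index_iota subn0.
rewrite big_seq [RHS]big_seq; apply: eq_bigr => i im; rewrite big_map.
rewrite (bigD1_seq i) ?iota_uniq//= subrr K0 big1 => [|j ji].
  by rewrite addr0 mulr1 mulrNN expr2.
by rewrite tau_orth ?mulr0// eq_sym.
Qed.

Lemma cov_dominated_mean (D : R -> R) : cov_dominated K D ->
  forall e : R, 0 < e -> exists T0 : R, forall T : R, T0 <= T -> 0 < T ->
    (\int[lebesgue_measure]_(t in `[0%R, T]) `|D t|%:E <= (e * T)%:E)%E.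
Proof.
move=> [M M0 [us DM]] e e0.
have H (l : seq R) : forall e : R, 0 < e -> exists T0 : R, forall T : R, T0 <= T -> 0 < T ->
    (\int[lebesgue_measure]_(t in `[0%R, T]) (\sum_(u <- l) `|K (t + u)|)%:E <= (e * T)%:E)%E.
  elim: l => [|u l IH] e' e'0.
    exists 0 => T _ T0; under eq_integral do rewrite big_nil.
    by rewrite integral0 lee_fin mulr_ge0// ltW.
  have e'2 : 0 < e' / 2 by rewrite divr_gt0.
  have [T1 HT1] := IH _ e'2.
  have [T2 HT2] := orthonormal_cesaro mK tau0 bessel_cov u e'2.
  exists (Num.max T1 T2) => T; rewrite ge_max => /andP[h1 h2] T0.
  under eq_integral do rewrite big_cons EFinD.
  have mKu (v : R) : measurable_fun setT (fun t : R => `|K (t + v)|).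
    by apply: measurableT_comp => //; apply: (measurableT_comp mK); exact: measurable_funD.
  rewrite ge0_integralD//.
  - rewrite [e' in leRHS]splitr mulrDl EFinD leeD//; [exact: HT2|exact: HT1].
  - by apply/measurable_EFinP; apply: measurable_funTS; exact: mKu.
  - by move=> t _; rewrite lee_fin; exact: sumr_ge0.
  - by apply/measurable_EFinP; apply: measurable_funTS; apply: measurable_sum.
have M1 : 0 < M + 1 by rewrite ltr_wpDl.
have eM : 0 < e / (M + 1) by rewrite divr_gt0.
have [T0 HT0] := H us _ eM; exists T0 => T TT0 Tpos.
have mS : measurable_fun setT (fun t : R => \sum_(u <- us) `|K (t + u)|).
  apply: measurable_sum => u; apply: measurableT_comp => //; apply: (measurableT_comp mK).
  exact: measurable_funD.
have S0 (t : R) : 0 <= \sum_(u <- us) `|K (t + u)| by exact: sumr_ge0.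
apply: (@le_trans _ _ (\int[lebesgue_measure]_(t in `[0%R, T])
    ((M + 1)%:E * (\sum_(u <- us) `|K (t + u)|)%:E))%E).
  apply: ge0_le_integral_nonmeasurable => // t.
  by rewrite -EFinM lee_fin (le_trans (DM t))// ler_wpM2r// lerDl.
rewrite ge0_integralZl//; last 3 first.
- by apply/measurable_EFinP; exact: measurable_funTS.
- by move=> t _; rewrite lee_fin.
- by rewrite lee_fin ltW.
apply: (@le_trans _ _ ((M + 1)%:E * (e / (M + 1) * T)%:E)%E).
  by rewrite lee_wpmul2l ?lee_fin ?(ltW M1)//; exact: HT0.
rewrite -EFinM lee_fin; have -> : (M + 1) * (e / (M + 1) * T) = e * T; last by [].
by field; rewrite gt_eqF.
Qed.

Notation path := (path X).
Notation path_shift := (path_shift X).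

(** Indicators are replaced by trigonometric functionals F and G close to them in L^1. Four errors
    of e / 4 arise: two in the joint expectation, two in the product of expectations. *)
Lemma path_events_decorrelation (A B : set (path_space R)) (e : R) :
  measurable A -> measurable B -> 0 < e ->
  exists2 D : R -> R, cov_dominated K D & forall t,
    (`| P [set w | A (path w) /\ B (path_shift t w)]
      - P [set w | A (path w)] * P [set w | B (path w)] | <= (e + `|D t|)%:E)%E.
Proof.
move=> mA mB e0.
pose X0 : {RV P >-> path_space R} := mfun_Sub (mem_set (measurable_path X)).
have e4 : 0 < e / 4 by rewrite divr_gt0.
have nuT : (distribution P X0 setT < +oo)%E by rewrite ltey_eq fin_num_measure.
have [mIA _ /(_ _ e4)[F tF FA]] := approximable_path_events nuT mA.
have [M FM] := trig_bounded tF.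
have M0 : 0 <= M by exact: le_trans (FM point).
have M1 : 0 < M + 1 by rewrite ltr_wpDl.
have e4M : 0 < e / 4 / (M + 1) by rewrite divr_gt0.
have [mIB _ /(_ _ e4M)[G tG GB]] := approximable_path_events nuT mB.
have [N GN] := trig_bounded tG.
exists (fun t => (\int[P]_w (F (path w) * G (path_shift t w)))%R -
    (\int[P]_w F (path w))%R * (\int[P]_w G (path w))%R).
  exact: trig_decorrelation.
move=> t.
pose IA (f : path_space R) : R := (f \in A)%:R; pose IB (f : path_space R) : R := (f \in B)%:R.
have IA01 f : `|IA f| <= 1 by rewrite /IA; case: (f \in A); rewrite ?normr1 ?normr0.
have IB01 f : `|IB f| <= 1 by rewrite /IB; case: (f \in B); rewrite ?normr1 ?normr0.
have [mF mG] := (trig_measurable tF, trig_measurable tG).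
have mcomp u (f : path_space R -> R) : measurable_fun setT f ->
    measurable_fun setT (fun w => f (path_shift u w)).
  by move=> mf; apply: (@measurableT_comp _ _ _ _ _ _ f) => //; exact: measurable_path_shift.
have icomp u (f : path_space R -> R) (L : R) : measurable_fun setT f -> (forall x, `|f x| <= L) ->
    P.-integrable setT (EFin \o (fun w => f (path_shift u w))).
  by move=> mf fL; apply: (@bounded_integrable _ _ _ _ _ L) => //; exact: mcomp.
(* The shifted path has the law of the path, so the two L^1 approximations hold at every shift. *)
have tr u (f : path_space R -> R) (L : R) : measurable_fun setT f -> (forall x, `|f x| <= L) ->
    (\int[P]_w f (path_shift u w))%R = (\int[distribution P X0]_x f x)%R.
  move=> mf fL; pose Xu : {RV P >-> path_space R} := mfun_Sub (mem_set (measurable_path_shift X u)).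
  transitivity (\int[distribution P Xu]_x f x)%R.
    congr fine; rewrite (@integral_distribution _ _ _ _ _ P Xu (EFin \o f))//.
      exact/measurable_EFinP.
    exact: (icomp u f L mf fL).
  congr fine; apply: eq_measure_integral => E mE _.
  exact: (path_law_stationary X_gaussian X_centered X_covariance u mE).
have mdA : measurable_fun setT (fun f => `|IA f - F f|).
  by apply: measurableT_comp => //; exact: measurable_funB.
have mdB : measurable_fun setT (fun f => `|IB f - G f|).
  by apply: measurableT_comp => //; exact: measurable_funB.
have bdA f : `| `|IA f - F f| | <= 1 + M by rewrite normr_id (le_trans (ler_normB _ _))// lerD.
have bdB f : `| `|IB f - G f| | <= 1 + N by rewrite normr_id (le_trans (ler_normB _ _))// lerD.
have distA u : (\int[P]_w `|IA (path_shift u w) - F (path_shift u w)|)%R <= e / 4.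
  by rewrite (tr u (fun f => `|IA f - F f|) _ mdA bdA).
have distB u : (\int[P]_w `|IB (path_shift u w) - G (path_shift u w)|)%R <= e / 4 / (M + 1).
  by rewrite (tr u (fun f => `|IB f - G f|) _ mdB bdB).
have MdB u : M * (\int[P]_w `|IB (path_shift u w) - G (path_shift u w)|)%R <= e / 4.
  apply: le_trans (ler_wpM2l M0 (distB u)) _.
  by rewrite mulrCA ler_piMr ?(ltW e4)// ler_pdivrMr// mul1r lerDl.
have probE (E : set Omega) : measurable E -> P E = ((\int[P]_w ((w \in E)%:R : R))%R)%:E.
  move=> mE; have -> : (\int[P]_w ((w \in E)%:R : R))%R = fine (P E).
    rewrite -[in RHS](setIT E) -(integral_indic P measurableT mE).
    by congr fine; apply: eq_integral => w _; rewrite indicE.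
  by rewrite fineK// fin_num_measure.
have mEA : measurable [set w | A (path w)].
  by have := measurable_path_event X 0 mA; rewrite path_shift0.
have mEB : measurable [set w | B (path w)].
  by have := measurable_path_event X 0 mB; rewrite path_shift0.
have mEAB : measurable [set w | A (path w) /\ B (path_shift t w)].
  by apply: measurableI => //; exact: measurable_path_event.
rewrite !probE// -EFinM -EFinB abse_EFin lee_fin.
have eA : (\int[P]_w ((w \in [set w | A (path w)])%:R : R) = \int[P]_w IA (path_shift 0 w))%R.
  apply: eq_Rintegral => w _; by rewrite path_shift0.
have eB : (\int[P]_w ((w \in [set w | B (path w)])%:R : R) = \int[P]_w IB (path_shift 0 w))%R.
  apply: eq_Rintegral => w _; by rewrite path_shift0.
have eAB : (\int[P]_w ((w \in [set w | A (path w) /\ B (path_shift t w)])%:R : R) =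
    \int[P]_w (IA (path_shift 0 w) * IB (path_shift t w)))%R.
  apply: eq_Rintegral => w _; rewrite path_shift0 /IA /IB -natrM mulnb; congr (_%:R).
  congr nat_of_bool; apply/idP/andP => [/set_mem[hA hB]|[/set_mem hA /set_mem hB]].
    by split; exact/mem_set.
  exact/mem_set.
rewrite eA eB eAB -path_shift0.
have iIA u : P.-integrable setT (EFin \o (fun w => IA (path_shift u w))) by exact: icomp IA01.
have iIB u : P.-integrable setT (EFin \o (fun w => IB (path_shift u w))) by exact: icomp IB01.
have iF u : P.-integrable setT (EFin \o (fun w => F (path_shift u w))) by exact: icomp FM.
have iG u : P.-integrable setT (EFin \o (fun w => G (path_shift u w))) by exact: icomp GN.
have idA u : P.-integrable setT (EFin \o (fun w => `|IA (path_shift u w) - F (path_shift u w)|)).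
  exact: icomp bdA.
have idB u : P.-integrable setT (EFin \o (fun w => `|IB (path_shift u w) - G (path_shift u w)|)).
  exact: icomp bdB.
have iAB : P.-integrable setT (EFin \o (fun w => IA (path_shift 0 w) * IB (path_shift t w))).
  apply: (@bounded_integrable _ _ _ _ _ 1); first by apply: measurable_funM; exact: mcomp.
  by move=> w; rewrite normrM mulr_ile1.
have iFG : P.-integrable setT (EFin \o (fun w => F (path_shift 0 w) * G (path_shift t w))).
  apply: (@bounded_integrable _ _ _ _ _ (M * N)); first by apply: measurable_funM; exact: mcomp.
  by move=> w; rewrite normrM ler_pM.
set EF := (\int[P]_w F _)%R; set EG := (\int[P]_w G _)%R; set EFG := (\int[P]_w (F _ * G _))%R.
set EA := (\int[P]_w IA _)%R; set EB := (\int[P]_w IB _)%R; set EAB := (\int[P]_w (IA _ * IB _))%R.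
have h1 : `|EAB - EFG| <= e / 4 + e / 4.
  rewrite /EAB /EFG -RintegralB//.
  apply: le_trans (le_normr_Rintegral measurableT _) _.
    by have := integrableB measurableT iAB iFG; apply: eq_integrable.
  apply: le_trans (lerD (distA 0) (MdB t)).
  rewrite -RintegralZl// -RintegralD//; last first.
    by have := integrableZl measurableT M (idB t); apply: eq_integrable.
  apply: le_Rintegral => //.
  - apply: integrable_norm.
    by have := integrableB measurableT iAB iFG; apply: eq_integrable.
  - have := integrableD measurableT (idA 0) (integrableZl measurableT M (idB t)).
    by apply: eq_integrable.
  - move=> w _; set a := IA _; set b := IB _; set f := F _; set g := G _.
    have -> : a * b - f * g = (a - f) * b + f * (b - g) by ring.
    apply: (le_trans (ler_normD _ _)); rewrite !normrM lerD//.
      by rewrite ler_piMr// IB01.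
    by rewrite ler_wpM2r// FM.
have h2 : `|EA - EF| <= e / 4.
  rewrite /EA /EF -RintegralB//; apply: le_trans (distA 0).
  apply: le_normr_Rintegral => //.
  by have := integrableB measurableT (iIA 0) (iF 0); apply: eq_integrable.
have h3 : M * `|EB - EG| <= e / 4.
  apply: le_trans (MdB 0); rewrite ler_wpM2l// /EB /EG -RintegralB//.
  apply: le_normr_Rintegral => //.
  by have := integrableB measurableT (iIB 0) (iG 0); apply: eq_integrable.
have mean1 (f : Omega -> R) (L : R) : P.-integrable setT (EFin \o f) -> (forall w, `|f w| <= L) ->
    `|(\int[P]_w f w)%R| <= L.
  move=> fi fL; apply: le_trans (le_normr_Rintegral measurableT fi) _.
  apply: (@le_trans _ _ (\int[P]_w (cst L w))%R).
    by apply: le_Rintegral => //; [exact: integrable_norm|exact: finite_measure_integrable_cst].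
  rewrite Rintegral_cst//; set m := fine _.
  by have -> : m = 1; [rewrite /m -[RHS]/(fine 1%E); congr fine; exact: probability_setT|rewrite mulr1].
have EF1 : `|EF| <= M by exact: mean1.
have EB1 : `|EB| <= 1 by exact: mean1.
have -> : EAB - EA * EB = (EAB - EFG) + (EFG - EF * EG) - EF * (EB - EG) - (EA - EF) * EB by ring.
apply: le_trans (ler_normB _ _) _; rewrite normrM.
have h4 : `|EA - EF| * `|EB| <= e / 4 by rewrite (le_trans _ h2)// ler_piMr.
have h5 : `|EF * (EB - EG)| <= e / 4 by rewrite normrM (le_trans _ h3)// ler_wpM2r.
have h6 := ler_normB (EAB - EFG + (EFG - EF * EG)) (EF * (EB - EG)).
have h7 := ler_normD (EAB - EFG) (EFG - EF * EG).
by lra.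
Qed.

Lemma weakly_mixing_stationary_gaussian : weakly_mixing_process P X.
Proof.
move=> A B mA mB; apply: mean_to_zeroP => e e0.
have e2 : 0 < e / 2 by rewrite divr_gt0.
have [D [M M0 [us DM]] HD] := path_events_decorrelation mA mB e2.
(* The dominating function is measurable by construction, so it is integrated in place of D. *)
pose S (t : R) := M * \sum_(u <- us) `|K (t + u)|.
have S0 t : 0 <= S t by rewrite mulr_ge0//; exact: sumr_ge0.
have SK : cov_dominated K S.
  by exists M => //; exists us => t; rewrite ger0_norm// S0.
have mS : measurable_fun setT S.
  apply: measurable_funM => //; apply: measurable_sum => u; apply: measurableT_comp => //.
  by apply: (measurableT_comp mK); exact: measurable_funD.
have [T0 HT0] := cov_dominated_mean SK e2.
exists T0 => T TT0 Tpos.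
apply: (@le_trans _ _ (\int[lebesgue_measure]_(t in `[0%R, T]) ((e / 2)%:E + `|S t|%:E))%E).
  apply: ge0_le_integral_nonmeasurable => // t.
  apply: (le_trans (HD t)); rewrite EFinD leeD2l// lee_fin (ger0_norm (S0 t)).
  exact: DM.
rewrite ge0_integralD//; last 2 first.
- by move=> t _; rewrite lee_fin ltW.
- by apply/measurable_EFinP; apply: measurable_funTS; exact: measurableT_comp.
rewrite [X in (X + _)%E]integral_cst// [X in (_ * X + _)%E]lebesgue_measure_itv/= lte_fin Tpos sube0.
by rewrite [e in leRHS]splitr mulrDl EFinD EFinM leeD2l//; exact: HT0.
Qed.

(** Rational times make this a path space event; for continuous paths it is boundedness at all
    times. *)
Definition bounded_path (M : R) : set (path_space R) :=
  [set f | forall q : rat, `|f (ratr q)| <= M].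

Lemma measurable_bounded_path M : measurable (bounded_path M).
Proof.
rewrite -[bounded_path M]setCK; apply: measurableC.
rewrite (_ : ~` _ = \bigcup_q [set f : path_space R | M < `|f (ratr q)|]); last first.
  apply/seteqP; split => [f /existsNP[q /negP]|f [q _ /= h] /(_ q)].
    by rewrite -ltNge => h; exists q.
  by rewrite leNgt h.
apply: bigcupT_measurable_rat => q.
have mq : measurable_fun setT (fun f : path_space R => `|f (ratr q)|).
  by apply: (measurableT_comp (f := @Num.norm R R)) => //; exact: measurable_eval.
have := mq measurableT `]M, +oo[%classic (measurable_itv _).
rewrite setTI (_ : _ @^-1` _ = [set f : path_space R | M < `|f (ratr q)|])//.
by apply/seteqP; split => f /=; rewrite in_itv/= andbT.
Qed.

Lemma bounded_path_continuous (f : R -> R) (M : R) : continuous f ->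
  bounded_path M f <-> forall t, `|f t| <= M.
Proof.
move=> cf; split => [h t|h q]; last exact: h.
rewrite leNgt; apply/negP => Mf.
have cn : continuous (fun t => `|f t|).
  by move=> x; apply: continuous_comp; [exact: cf|exact: norm_continuous].
have oO : open ((fun t => `|f t|) @^-1` `]M, +oo[%classic).
  by apply: open_comp => [x _|]; [exact: cn|exact: rray_open].
have [|x [/= + [q _ qx]]] := @dense_rat R _ _ oO.
  by exists t; rewrite /= in_itv/= Mf.
by rewrite in_itv/= andbT -qx ltNge h.
Qed.

Hypothesis X_continuous : forall w : Omega, continuous (fun t : R => X t w : R).

(** With p the probability of this event, invariance makes the mixing defect the constant p - p ^ 2,
    and a constant has mean zero only if it is 0. *)
Lemma bounded_path_null (M : R) : P [set w | bounded_path M (path w)] = 0%E.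
Proof.
have mB := measurable_bounded_path M.
have cpath w : continuous (path w : R -> R) by exact: X_continuous.
have cshift t w : continuous (path_shift t w : R -> R).
  move=> x; apply: (@continuous_comp _ _ _ (fun s => s - t) (path w)); last exact: cpath.
  by apply: cvgB; [exact: cvg_id|exact: cvg_cst].
(* Invariance under a real shift needs continuity, since the event only looks at rational times. *)
have shiftE t : [set w | bounded_path M (path w) /\ bounded_path M (path_shift t w)] =
    [set w | bounded_path M (path w)].
  apply/seteqP; split => w /=; first by case.
  move=> h; split => //; apply/(bounded_path_continuous _ (cshift t w)) => s.
  by have /(bounded_path_continuous _ (cpath w)) := h; apply.
have mE : measurable [set w | bounded_path M (path w)].
  by have := measurable_path_event X 0 mB; rewrite path_shift0.
pose p := fine (P [set w | bounded_path M (path w)]).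
have pE : P [set w | bounded_path M (path w)] = p%:E by rewrite /p fineK// fin_num_measure.
have : mean_to_zero (fun=> (p - p * p)%:E : \bar R).
  have := weakly_mixing_stationary_gaussian mB mB.
  rewrite (_ : (fun t => _) = fun=> (p - p * p)%:E)//; apply/funext => t.
  have := shiftE t; rewrite /path_shift /path => ->.
  by have := pE; rewrite /path => ->; rewrite -EFinM -EFinB.
move=> /mean_to_zero_cst/eqP; rewrite -{1}[p]mulr1 -mulrBr mulf_eq0 => /orP[/eqP p0|].
  by rewrite pE p0.
rewrite subr_eq0 => /eqP p1; exfalso.
have K00 : K (0 - 0) = 1 by rewrite subr0 K0.
have iX := integrable_process X_centered X_covariance 0.
have iX2 := integrable_process_sqr X_centered X_covariance 0.
have gX : gaussian_rv P (X 0).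
  have := gaussian_lin X_gaussian [:: (1, 0)].
  by rewrite (_ : lin X _ = X 0)//; apply/funext => w; rewrite /lin /path_comb big_seq1 mul1r.
have EX : (\int[P]_w (X 0 w : R))%R = 0.
  by have := X_centered 0; rewrite expectation.unlock /Rintegral => ->.
have EX2 : (\int[P]_w ((X 0 w : R) ^+ 2))%R = 1.
  under eq_Rintegral do rewrite expr2.
  by rewrite /Rintegral (process_product_expectation X_centered X_covariance) K00.
have /lt_eqF/negP := gaussian_rv_unbounded gX iX EX iX2 EX2 M erefl; apply.
rewrite eq_sym -measure_le0.
have mU : measurable [set w | M < (X 0 w : R)].
  have mX0 : measurable_fun setT (X 0 : Omega -> R) by have := measurable_process X 0.
  have := mX0 measurableT `]M, +oo[%classic (measurable_itv _).
  rewrite setTI (_ : _ @^-1` _ = [set w | M < (X 0 w : R)])//.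
  by apply/seteqP; split => w /=; rewrite in_itv/= andbT.
have -> : 0%E = P (~` [set w | bounded_path M (path w)]).
  by rewrite probability_setC// pE -p1 -EFinB subrr.
apply: le_measure; rewrite ?inE//; first exact: measurableC.
move=> w /= Mw h; have := h 0; rewrite rmorph0 => /(le_trans (ler_norm _)).
by rewrite leNgt Mw.
Qed.

Lemma sup_path_infinite :
  {ae P, forall w, ereal_sup [set (`|X t w|)%:E | t in [set: R]] = +oo%E}.
Proof.
pose E n := [set w | bounded_path n%:R (path w)].
have EN : P.-negligible (\bigcup_n E n).
  apply: negligible_bigcup => n; exists (E n); split => //.
    by have := measurable_path_event X 0 (measurable_bounded_path n%:R); rewrite path_shift0.
  exact: bounded_path_null.
apply: negligibleS EN => w /=.
set s := ereal_sup _ => sy; have s0 : (0 <= s)%E.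
  apply: (@le_trans _ _ (`|X 0 w|)%:E); first by rewrite lee_fin.
  by apply: ereal_sup_ubound; exists 0.
have sfin : s \is a fin_num.
  by rewrite ge0_fin_numE// ltey; apply/eqP.
exists (Num.truncn (fine s)).+1 => // q.
apply: (@le_trans _ _ (fine s)); last exact/ltW/truncnS_gt.
by rewrite -lee_fin fineK//; apply: ereal_sup_ubound; exists (ratr q).
Qed.

End weak_mixing.

(** * Measurability of random configurations *)

Section counting_points.
Import finmap.
Context {R : realType}.
Implicit Types (Z : set R) (a b : R) (k : nat).

(** Rational separators describe the presence of k points in ]a, b[ by countably many hitting events
    of open intervals, which is what makes counts measurable. *)
Fixpoint at_least Z k a b : Prop :=
  if k is k'.+1 then
    exists q : rat, [/\ ratr q < b, Z `&` `]a, ratr q[ !=set0 & at_least Z k' (ratr q) b]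
  else True.

Lemma at_leastP Z k a b : at_least Z k a b <->
  exists s : seq R, [/\ size s = k, sorted <%R s & forall x, x \in s -> (Z `&` `]a, b[) x].
Proof.
elim: k a => [|k IH] a; first by split => // _; exists [::].
split => /=.
  move=> [q [qb [x [Zx /=]]]]; rewrite in_itv/= => /andP[ax xq] /IH[s [sk ss Zs]].
  exists (x :: s); split => /=; first by rewrite sk.
    rewrite path_min_sorted//; apply/allP => y /Zs[_] /=; rewrite in_itv/= => /andP[qy _].
    exact: lt_trans qy.
  move=> y; rewrite in_cons => /orP[/eqP ->|/Zs[Zy /=]].
    by split => //=; rewrite in_itv/= ax (lt_trans xq).
  rewrite in_itv/= => /andP[qy yb]; split => //=.
  by rewrite in_itv/= yb andbT (lt_trans ax)// (lt_trans xq).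
move=> [[|x s] [//= [sk] xs Zs]].
have [Zx /=] := Zs x (mem_head _ _); rewrite in_itv/= => /andP[ax xb].
(* [head b s] is the next point, or b when x is the last one. *)
have xh : x < head b s.
  by case: s {sk Zs} xs => //= y s /andP[].
have [q /[!in_itv]/= /andP[xq qh]] := rat_in_itvoo xh.
have hb : head b s <= b.
  case: s {sk xs qh xh} Zs => //= y s Zs.
  by have [_ /=] := Zs y (mem_behead (s := [:: x, y & s]) (mem_head _ _)); rewrite in_itv/= => /andP[_ /ltW].
exists q; split; first exact: lt_le_trans qh hb.
  by exists x; split => //=; rewrite in_itv/= ax.
apply/IH; exists s; split => //; first exact: path_sorted xs.
move=> y ys; have [Zy /=] := Zs y (mem_behead (s := x :: s) ys).
rewrite in_itv/= => /andP[_ yb]; split => //=; rewrite in_itv/= yb andbT.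
apply: lt_le_trans qh _; case: s xs ys {sk Zs xh hb} => //= z s /andP[_ zs].
rewrite in_cons => /orP[/eqP ->//|ys].
by have /allP/(_ _ ys)/ltW := order_path_min lt_trans zs.
Qed.

Lemma at_least_fset Z a b (B : {fset R}) :
  [set` B] `<=` Z `&` `]a, b[ -> at_least Z #|` B| a b.
Proof.
move=> BZ; apply/at_leastP; exists (sort <=%R B); split.
- by rewrite size_sort.
- by rewrite sort_lt_sorted fset_uniq.
- by move=> x; rewrite mem_sort; exact: BZ.
Qed.

Lemma at_leastS Z k l a b : (k <= l)%N -> at_least Z l a b -> at_least Z k a b.
Proof.
move=> kl /at_leastP[s [sl ss Zs]]; apply/at_leastP; exists (take k s); split.
- by rewrite size_takel// sl.
- exact: take_sorted.
- by move=> x /mem_take; exact: Zs.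
Qed.

Lemma at_least_counting Z k a b : finite_set (Z `&` `]a, b[) ->
  at_least Z k a b <-> ((k%:R)%:E <= counting (Z `&` `]a, b[) :> \bar R)%E.
Proof.
move=> fZ; rewrite /counting asboolT// lee_fin ler_nat; split => [/at_leastP|h].
  move=> [s [<- ss Zs]].
  apply: uniq_leq_size; first exact: lt_sorted_uniq.
  by move=> x xs; rewrite in_fset_set//; apply/mem_set; exact: Zs.
apply: at_leastS h (at_least_fset _) => x /=.
by rewrite in_fset_set// => /set_mem.
Qed.

(** A countable form of local finiteness: an infinite set contains finite subsets of every size. *)
Lemma locally_finite_at_least Z :
  locally_finite Z <-> forall n : nat, exists k, ~ at_least Z k (- n%:R) n%:R.
Proof.
split => [lZ n|h a b].
  have fZ : finite_set (Z `&` `](- n%:R), n%:R[).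
    apply: sub_finite_set (lZ (- n%:R) n%:R) => x [Zx /=]; rewrite in_itv/= => /andP[h1 h2].
    by split => //=; rewrite in_itv/= !ltW.
  exists #|` fset_set (Z `&` `](- n%:R), n%:R[)|.+1 => /(at_least_counting _ fZ).
  by rewrite /counting asboolT// lee_fin ler_nat ltnn.
pose n := (Num.truncn `|a| + Num.truncn `|b|).+2.
have [k] := h n; apply: contra_notP => iZ.
have {}iZ : infinite_set (Z `&` `](- n%:R), n%:R[).
  apply: contra_not iZ; apply: sub_finite_set => x [Zx /=]; rewrite in_itv/= => /andP[ax xb].
  have h1 := truncnS_gt `|a|; have h2 := truncnS_gt `|b|.
  have nE : n%:R = (Num.truncn `|a|).+1%:R + (Num.truncn `|b|).+1%:R :> R.
    by rewrite -natrD addSn addnS.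
  have p1 : 0 <= (Num.truncn `|a|).+1%:R :> R by [].
  have p2 : 0 <= (Num.truncn `|b|).+1%:R :> R by [].
  split => //=; rewrite in_itv/= nE; have := ler_norm b; have := ler_norm (- a); rewrite normrN.
  by move=> h3 h4; apply/andP; split; lra.
have [B BZ kB] := infinite_set_fset k iZ.
exact: at_leastS kB (at_least_fset BZ).
Qed.

End counting_points.

Section random_points.
Context {R : realType} {d : measure_display} {T : measurableType d}.
Variable S : T -> set R.
Hypothesis S_meets : forall a b : R, measurable [set w | S w `&` `]a, b[ !=set0].

Lemma measurable_at_least k a b : measurable [set w | at_least (S w) k a b].
Proof.
elim: k a => [|k IH] a /=.
  by rewrite (_ : [set _ | True] = setT)//; apply/seteqP.
rewrite (_ : [set w | _] = \bigcup_(q : rat)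
    ([set _ | ratr q < b] `&` ([set w | S w `&` `]a, ratr q[ !=set0] `&`
     [set w | at_least (S w) k (ratr q) b]))); last first.
  apply/seteqP; split => w /=; first by move=> [q [? ? ?]]; exists q.
  by move=> [q _ [? [? ?]]]; exists q.
apply: bigcupT_measurable_rat => q; apply: measurableI; last by apply: measurableI.
by have [qb|qb] := pselect (ratr q < b :> R);
  [rewrite (_ : [set _ | _] = setT)|rewrite (_ : [set _ | _] = set0)] => //; apply/seteqP; split.
Qed.

Lemma measurable_locally_finite : measurable [set w | locally_finite (S w)].
Proof.
rewrite (_ : [set w | _] =
    \bigcap_n \bigcup_k ~` [set w | at_least (S w) k (- n%:R) n%:R]); last first.
  apply/seteqP; split => w /=.
    by move=> /locally_finite_at_least h n _; have [k] := h n; exists k.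
  by move=> h; apply/locally_finite_at_least => n; have [k _] := h n I; exists k.
apply: bigcapT_measurable => n; apply: bigcupT_measurable => k.
by apply: measurableC; exact: measurable_at_least.
Qed.

End random_points.

Section random_configuration.
Import finmap.
Context {R : realType} {d : measure_display} {T : measurableType d}.
Variable Z : T -> configuration R.
Hypothesis Z_meets : forall a b : R, measurable [set w | points (Z w) `&` `]a, b[ !=set0].

Let finZ w a b : finite_set (Z w `&` `]a, b[).
Proof.
apply: sub_finite_set (points_locally_finite (Z w) a b) => x [Zx /=].
by rewrite in_itv/= => /andP[h1 h2]; split => //=; rewrite in_itv/= !ltW.
Qed.

Let mZ w : measurable (points (Z w) : set (measurableTypeR R)).
Proof.
rewrite (_ : points (Z w) = \bigcup_n (Z w `&` `](- n%:R), n%:R[)).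
  apply: bigcupT_measurable => n; apply: countable_measurable; last first.
    by apply: finite_set_countable; exact: finZ.
  exact: measurable_set1.
apply/seteqP; split => [x Zx|x [n _ []]//].
have h := truncnS_gt `|x|; exists (Num.truncn `|x|).+1 => //; split => //=.
by rewrite in_itv/= -ltr_norml.
Qed.

(** Counts are cut to a bounded window, where they are finite, because the complement step of the
    Dynkin induction subtracts them. *)
Let window n : set (measurableTypeR R) := `](- n%:R), n%:R[%classic.

Let mwindow n : measurable (window n).
Proof. exact: measurable_itv. Qed.

Let count n (A : set (measurableTypeR R)) (w : T) : \bar R :=
  counting (points (Z w) `&` (window n `&` A)).

Let count_fin n A w : count n A w \is a fin_num.
Proof.
rewrite /count /counting asboolT//; rewrite setIA.
exact: sub_finite_set (finZ w (- n%:R) n%:R).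
Qed.

Let measurable_count_itv a b :
  measurable_fun setT (fun w => counting (points (Z w) `&` `]a, b[) : \bar R).
Proof.
pose f w : R := #|` fset_set (points (Z w) `&` `]a, b[)|%:R.
rewrite (_ : (fun w => _) = EFin \o f); last first.
  by apply/funext => w; rewrite /counting asboolT//; exact: finZ.
apply/measurable_EFinP; apply: (measurability _ (RGenCInfty.measurableE R)) => //.
move=> _ [_ [y ->] <-]; rewrite setTI.
have [k yk] : exists k : nat, forall m : nat, (y <= m%:R) = (k <= m)%N.
  have [y0|y0] := leP y 0.
    by exists 0%N => m; rewrite (le_trans y0).
  have c0 : 0 < Num.ceil y by rewrite ceil_gt0.
  exists `|Num.ceil y|%N => m; rewrite -[m%:R]/(m%:~R) -ceil_le_int -lez_nat.
  by rewrite gez0_abs// ltW.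
rewrite (_ : _ @^-1` _ = [set w | at_least (Z w) k a b]); first exact: measurable_at_least.
apply/seteqP; split => w /=; rewrite in_itv/= andbT yk.
  by move=> h; apply/at_least_counting; [exact: finZ|rewrite /counting asboolT ?lee_fin ?ler_nat].
by move=> /(at_least_counting _ (finZ w a b)); rewrite /counting asboolT ?lee_fin ?ler_nat.
Qed.

Let measurable_count n A : measurable A -> measurable_fun setT (count n A).
Proof.
have -> : @measurable _ (measurableTypeR R) = <<s @RGenInftyO.G R >>.
  exact: RGenInftyO.measurableE.
move: A; apply: (@dynkin_induction _ (measurableTypeR R) (@RGenInftyO.G R)
  (fun A => measurable_fun setT (count n A))).
- exact: RGenInftyO.measurableE.
- move=> _ _ [x ->] [y ->]; exists (Num.min x y); apply/seteqP.
  by split => z /=; rewrite !in_itv/= lt_min => /andP.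
- by rewrite /count setIT; exact: measurable_count_itv.
- move=> _ [x ->].
  rewrite /count (_ : window n `&` _ = `](- n%:R), (Num.min n%:R x)[%classic)//.
  rewrite /window; apply/seteqP; split => z /=; rewrite !in_itv/= lt_min.
    by move=> [/andP[-> ->]].
  by move=> /and3P[-> -> ->].
- move=> A mA cA.
  rewrite (_ : count n (~` A) = count n setT \- count n A)%E.
    by apply: emeasurable_funB => //; rewrite /count setIT; exact: measurable_count_itv.
  apply/funext => w /=; apply/esym.
  rewrite -(_ : count n (~` A) w + count n A w = count n setT w)%E ?addeK//.
  have mWB B : measurable B -> measurable (points (Z w) `&` (window n `&` B) : set (measurableTypeR R)).
    by move=> mB; apply: measurableI => //; apply: measurableI.
  pose mu : {measure set (measurableTypeR R) -> \bar R} := counting.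
  have := @measureU _ _ _ mu _ _ (mWB _ (measurableC mA)) (mWB _ mA) _.
  rewrite -!setIUr setvU => E; apply/esym/E.
  by apply/seteqP; split => // x [[_ [_ +]] [_ [_]]].
- move=> F mF tF cF.
  rewrite (_ : count n _ = fun w => (\sum_(k <oo) count n (F k) w)%E).
    by apply: ge0_emeasurable_sum => // k w _ _; exact: measure_ge0.
  apply/funext => w; rewrite /count !setI_bigcupr.
  have mWF k : measurable (points (Z w) `&` (window n `&` F k) : set (measurableTypeR R)).
    by apply: measurableI => //; apply: measurableI.
  pose mu : {measure set (measurableTypeR R) -> \bar R} := counting.
  apply: (@measure_semi_bigcup _ _ _ mu) => //; last exact: bigcupT_measurable.
  by apply: trivIset_setIl; exact: trivIset_setIl.
Qed.

(** Hitting events of open intervals are enough: they give counts on intervals, then on Borel sets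
    of a window by Dynkin induction, then on all Borel sets by increasing windows. *)
Lemma measurable_config : measurable_fun setT (Z : T -> point_space R).
Proof.
apply: (@measurability _ _ T (point_space R) setT Z (count_events R)) => //.
move=> _ [_ [A mA [B mB <-]] <-]; rewrite !setTI.
have mc : measurable_fun setT (fun w => counting (points (Z w) `&` A) : \bar R).
  apply: (emeasurable_fun_cvg (fun n => count n A)).
  - by move=> n; exact: measurable_count.
  - move=> w _.
    have -> : points (Z w) `&` A = \bigcup_n (Z w `&` (window n `&` A)).
      apply/seteqP; split => [x [Zx Ax]|x [n _ [Zx [_ Ax]]]]; last by split.
      have h := truncnS_gt `|x|; exists (Num.truncn `|x|).+1 => //; split => //; split => //=.
      by rewrite /window/= in_itv/= -ltr_norml.
    have mF n : measurable (points (Z w) `&` (window n `&` A) : set (measurableTypeR R)).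
      by apply: measurableI => //; apply: measurableI.
    apply: (@nondecreasing_cvg_mu _ (measurableTypeR R) R counting) => //.
      exact: bigcupT_measurable.
    move=> m n mn; apply/subsetPset => x [Zx []]; rewrite /window/= in_itv/= -ltr_norml => xm Ax.
    split => //; split => //; rewrite /window/= in_itv/= -ltr_norml (lt_le_trans xm)// ler_nat//.
by have := mc measurableT B mB; rewrite setTI.
Qed.

End random_configuration.

(** * Zero sets of continuous paths as path events *)

Section zero_set_events.
Context {R : realType}.

Lemma nbhs_ball_rat (x a b : R) (V : set R) : a < x < b -> nbhs x V ->
  exists q : rat, [/\ a < ratr q, ratr q < b & V (ratr q)].
Proof.
move=> /andP[ax xb] Vx; have : nbhs x (V `&` `]a, b[).
  by apply: filterI => //; apply: near_in_itvoo; rewrite in_itv/= ax.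
rewrite nbhsE => - [U [oU Ux] UV].
have [|y [Uy [q _ qy]]] := @dense_rat R U _ oU; first by exists x.
have [Vy /=] := UV _ Uy; rewrite in_itv/= => /andP[ay yb].
by exists q; rewrite qy.
Qed.

(** By compactness of a slightly smaller closed interval, a zero amounts to arbitrarily small values
    at rational points: a condition on countably many coordinates. *)
Lemma continuous_zero_itvP (f : R -> R) (a b : R) : continuous f ->
  ([set t | f t = 0] `&` `]a, b[) !=set0 <->
  exists k, forall n, exists r : rat,
    [/\ a + k.+1%:R^-1 <= ratr r, ratr r <= b - k.+1%:R^-1 & `|f (ratr r)| < n.+1%:R^-1].
Proof.
move=> cf; split.
  move=> [x [/= fx]]; rewrite in_itv/= => /andP[ax xb].
  have [k kx] : exists k, k.+1%:R^-1 < Num.min (x - a) (b - x).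
    have e0 : 0 < Num.min (x - a) (b - x) by rewrite lt_min !subr_gt0 ax.
    by have [N _ /(_ N (leqnn N))] := near_infty_natSinv_lt (PosNum e0); exists N.
  move: kx; rewrite lt_min => /andP[ka kb].
  exists k => n; have n0 : 0 < n.+1%:R^-1 :> R by [].
  have [||r [ar rb rn]] := @nbhs_ball_rat x (a + k.+1%:R^-1) (b - k.+1%:R^-1)
      [set r | `|f r| < n.+1%:R^-1].
  - by rewrite -ltrBrDl ka ltrBrDr -ltrBrDl kb.
  - by have /cvgrPdist_lt/(_ _ n0) := cf x; rewrite fx; under eq_near do rewrite sub0r normrN.
  - by exists r; rewrite !ltW.
move=> [k h]; have [r [ar rb _]] := h 0%N.
have cn : continuous (fun t => `|f t|).
  by move=> x; apply: continuous_comp; [exact: cf|exact: norm_continuous].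
(* A positive minimum of |f| would contradict the small values. *)
have [c cab cmin] := EVT_min (le_trans ar rb) (continuous_subspaceT cn).
move: (cab); rewrite in_itv/= => /andP[ac cb].
have k0 : 0 < k.+1%:R^-1 :> R by [].
exists c; split => /=; last first.
  by rewrite in_itv/= (lt_le_trans _ ac) ?ltrDl//= (le_lt_trans cb)// ltrBlDr ltrDl.
apply/eqP; rewrite -normr_le0 leNgt; apply/negP => fc.
have [N _ /(_ N (leqnn N)) /= Nf] := near_infty_natSinv_lt (PosNum fc).
have [s [as_ sb sN]] := h N.
have /cmin : ratr s \in `[a + k.+1%:R^-1, b - k.+1%:R^-1] by rewrite in_itv/= as_.
by rewrite leNgt (lt_trans sN).
Qed.

Lemma locally_finite_zeros (f : R -> R) :
  locally_finite [set t | f t = 0] -> points (zeros f) = [set t | f t = 0].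
Proof. by move=> lf; rewrite /zeros; case: pselect. Qed.

Lemma not_locally_finite_zeros (f : R -> R) :
  ~ locally_finite [set t | f t = 0] -> points (zeros f) = set0.
Proof. by move=> lf; rewrite /zeros; case: pselect. Qed.

(** Coordinate events see countably many times while a zero set involves all of them; the two are
    reconciled by asking for agreement with a coordinate event on continuous paths only. *)
Definition continuous_path_event (B : set (path_space R)) :=
  exists2 B' : set (path_space R), measurable B' &
    forall f : R -> R, continuous f -> B f <-> B' f.

Lemma sigma_algebra_continuous_path_event : sigma_algebra setT continuous_path_event.
Proof.
split.
- by exists set0.
- move=> B [B' mB' BB']; exists (~` B'); first exact: measurableC.
  by move=> f cf; rewrite setTD; split => h1 h2; apply: h1; apply/BB'.
- move=> B HB.
  have /choice[B' HB'] : forall n, exists B' : set (path_space R), measurable B' /\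
      forall f : R -> R, continuous f -> B n f <-> B' f.
    by move=> n; have [B' ? ?] := HB n; exists B'.
  exists (\bigcup_n B' n); first by apply: bigcupT_measurable => n; exact: (HB' n).1.
  by move=> f cf; split => -[n _ Bn]; exists n => //; apply/(HB' n).2.
Qed.

(** Taking these sets as the measurable ones allows [measurable_config] to be applied to the map
    [zeros] itself. *)
Let path_type := g_sigma_algebraType continuous_path_event.

Let measurable_pathE (B : set path_type) : measurable B = continuous_path_event B.
Proof.
rewrite /measurable/= (_ : <<s continuous_path_event >> = continuous_path_event)//.
exact: sigma_algebra_id sigma_algebra_continuous_path_event.
Qed.

Let zero_set (f : path_type) : set R := [set t | f t = 0].

Let measurable_zero_set_meets a b :
  measurable [set f : path_type | zero_set f `&` `]a, b[ !=set0].
Proof.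
rewrite measurable_pathE.
exists (\bigcup_k \bigcap_n \bigcup_(r in [set r : rat | a + k.+1%:R^-1 <= ratr r <= b - k.+1%:R^-1])
    [set f : path_space R | `|f (ratr r)| < n.+1%:R^-1]).
  apply: bigcupT_measurable => k; apply: bigcapT_measurable => n.
  rewrite bigcup_mkcond; apply: bigcupT_measurable_rat => r; case: ifPn => // _.
  have mr : measurable_fun setT (fun f : path_space R => `|f (ratr r)|).
    by apply: (measurableT_comp (f := @Num.norm R R)) => //; exact: measurable_eval.
  have := mr measurableT `]-oo, n.+1%:R^-1[%classic (measurable_itv _).
  by rewrite setTI (_ : _ @^-1` _ = [set f : path_space R | `|f (ratr r)| < n.+1%:R^-1]).
move=> f cf; split.
  move=> /(continuous_zero_itvP _ _ cf)[k h]; exists k => // n _.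
  by have [r [ar rb rn]] := h n; exists r => //=; rewrite ar.
move=> [k _ h]; apply/continuous_zero_itvP => //; exists k => n.
by have [r /= /andP[ar rb] rn] := h n I; exists r.
Qed.

Let measurable_zeros_meets a b :
  measurable [set f : path_type | points (zeros f) `&` `]a, b[ !=set0].
Proof.
rewrite (_ : [set f : path_type | _] = [set f : path_type | zero_set f `&` `]a, b[ !=set0] `&`
    [set f | locally_finite (zero_set f)]).
  apply: measurableI; first exact: measurable_zero_set_meets.
  by apply: measurable_locally_finite => p q; exact: measurable_zero_set_meets.
apply/seteqP; split => f /=; last by move=> [? /locally_finite_zeros ->].
have [lf|nlf] := pselect (locally_finite (zero_set f)).
  by rewrite locally_finite_zeros.
by rewrite not_locally_finite_zeros// set0I => -[].
Qed.

Lemma zeros_event (A : set (point_space R)) : measurable A ->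
  exists2 A' : set (path_space R), measurable A' &
    forall f : R -> R, continuous f -> A (zeros f) <-> A' f.
Proof.
move=> mA; have := measurable_config measurable_zeros_meets measurableT mA.
by rewrite setTI measurable_pathE.
Qed.

Lemma configP (Z1 Z2 : configuration R) : points Z1 = points Z2 -> Z1 = Z2.
Proof.
by case: Z1 Z2 => [Z1 h1] [Z2 h2] /= E; subst Z2; congr Configuration; exact: Prop_irrelevance.
Qed.

Lemma zeros_shift (f : R -> R) t :
  config_shift t (zeros f) = zeros (fun s => f (s - t)).
Proof.
pose Zf := [set s | f s = 0].
have shiftE : [set s | f (s - t) = 0] = [set x + t | x in Zf].
  apply/seteqP; split => [s /= fs|_ [x fx <-]]; last by rewrite /= addrK.
  by exists (s - t) => //; rewrite subrK.
have unshiftE : Zf = [set x + - t | x in [set s | f (s - t) = 0]].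
  apply/seteqP; split => [s /= fs|_ [x fx <-]//].
  by exists (s + t); rewrite /= addrK.
apply: configP; have [lf|nlf] := pselect (locally_finite Zf).
  rewrite /config_shift/= (locally_finite_zeros lf) locally_finite_zeros// shiftE.
  exact: locally_finite_shift.
rewrite /config_shift/= (not_locally_finite_zeros nlf) not_locally_finite_zeros ?image_set0//.
by apply: contra_not nlf => lf; rewrite unshiftE; exact: locally_finite_shift.
Qed.

End zero_set_events.

Lemma weakly_mixing_zeros (R : realType) (d : measure_display) (Omega : measurableType d)
    (P : probability Omega R) (X : R -> Omega -> R) :
  (forall w, continuous (fun t : R => X t w)) -> weakly_mixing_process P X ->
  weakly_mixing_points P (fun w => zeros (fun t => X t w) : point_space R).
Proof.
move=> cX wX A B mA mB.
have [A' mA' AA'] := zeros_event mA; have [B' mB' BB'] := zeros_event mB.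
have cXt t w : continuous (fun s : R => X (s - t) w).
  move=> x; apply: (@continuous_comp _ _ _ (fun s => s - t) (X^~ w)); last exact: cX.
  by apply: cvgB; [exact: cvg_id|exact: cvg_cst].
have := wX A' B' mA' mB'; congr (mean_to_zero _).
have eqP (Q Q' : Omega -> Prop) : (forall w, Q' w <-> Q w) -> P [set w | Q w] = P [set w | Q' w].
  by move=> h; congr (P _); apply/seteqP; split => w /h.
apply/funext => t; congr (_ - _ * _)%E; apply: eqP => w.
- by rewrite zeros_shift AA'// BB'.
- exact: AA'.
- exact: BB'.
Qed.

(** * Zeros of generic paths *)

Section generic_paths.
Context {R : realType}.
Implicit Types (f : R -> R) (a x : R) (n N j m : nat).

Definition mesh n : R := 2^-1 ^+ n.

Definition rho : R := 2 / 5.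

Definition dyadic n x := exists k : int, x = k%:~R * mesh n.

(* [rho] is such that both [2 * rho < 1] and [(2 * pi / 2 ^ n) ^ 4 / rho ^ (2 * n)] decays faster
   than [2 ^ - n], so that Borel-Cantelli applies at all dyadic points of a window. *)
Definition generic_at N n f := forall x, dyadic n x -> `|x| <= N%:R ->
  rho ^+ n < `|f x| /\ `|f (x + mesh n) - 2 * f x + f (x - mesh n)| <= rho ^+ n.

Definition generic_path f := forall N, exists n0, forall n, (n0 <= n)%N -> generic_at N n f.

Lemma mesh_gt0 n : 0 < mesh n. Proof. by rewrite exprn_gt0. Qed.

Lemma meshS n : mesh n = 2 * mesh n.+1.
Proof. by rewrite /mesh exprS mulrA mulfV// mul1r. Qed.

Lemma mesh_expn n j : (2 ^ j)%:R * mesh (n + j) = mesh n.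
Proof. by rewrite /mesh natrX exprD mulrCA -exprMn mulfV// expr1n mulr1. Qed.

Lemma mesh_le m n : (m <= n)%N -> mesh n <= mesh m.
Proof. by move=> mn; rewrite ler_wiXn2l//; lra. Qed.

Lemma mesh_small (e : R) : 0 < e -> exists j, mesh j < e.
Proof.
move=> e0; have : (fun j => mesh j) @ \oo --> (0 : R).
  by apply: cvg_expr; rewrite ger0_norm; lra.
move=> /cvgrPdist_lt/(_ _ e0)[j _ /(_ j (leqnn j))].
by rewrite sub0r normrN ger0_norm ?(ltW (mesh_gt0 _))// => ?; exists j.
Qed.

Lemma rho_gt0 : 0 < rho. Proof. by rewrite /rho; lra. Qed.

Lemma dyadicD n x m : dyadic n x -> dyadic n (x + m%:R * mesh n).
Proof. by move=> [k ->]; exists (k + m%:Z); rewrite intrD mulrDl. Qed.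

Lemma dyadic_refine n j x : dyadic n x -> dyadic (n + j) x.
Proof.
move=> [k ->]; exists (k * (2 ^ j)%N%:Z); rewrite intrM -(mesh_expn n j).
by rewrite mulrA.
Qed.

Lemma dyadic_floor n x : exists2 a, dyadic n a & a <= x < a + mesh n.
Proof.
have h0 := mesh_gt0 n; pose k := Num.floor (x / mesh n).
exists (k%:~R * mesh n); first by exists k.
have /andP[h1 h2] := floor_itv (x / mesh n).
rewrite -ler_pdivlMr// h1/= -[X in _ + X]mul1r -mulrDl -ltr_pdivrMr//.
by move: h2; rewrite intrD.
Qed.

Section positivity.
Variables (N n : nat) (f : R -> R) (a : R).
Hypothesis gf : forall j, generic_at N (n + j) f.
Hypothesis da : dyadic n a.
Hypothesis aN : - N%:R <= a.
Hypothesis aN' : a + mesh n <= N%:R.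

(** A new midpoint is at least the mean of its neighbours minus half the second difference, so each
    refinement costs at most rho ^ (n + j + 1) / 2. The budget is exact: rho ^ j / 3 - rho ^ (j + 1)
    / 2 = rho ^ (j + 1) / 3 for rho = 2 / 5. *)
Lemma generic_dyadic_ge : 0 < f a -> 0 < f (a + mesh n) ->
  forall j m, (m <= 2 ^ j)%N -> rho ^+ n * (2 / 3 + rho ^+ j / 3) <= f (a + m%:R * mesh (n + j)).
Proof.
move=> fa fa'; have h0 := mesh_gt0 n; have r0 := exprn_gt0 n rho_gt0.
have dN x : dyadic n x -> - N%:R <= x -> x <= N%:R -> 0 < f x -> rho ^+ n <= f x.
  move=> dx xN xN' fx; have : dyadic (n + 0) x by rewrite addn0.
  move=> /(@gf 0%N x)[|]; first by rewrite ler_norml xN.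
  by rewrite addn0 gtr0_norm// => /ltW.
elim=> [|j IH] m mj.
  rewrite addn0 expr0; have -> : 2 / 3 + 1 / 3 = 1 :> R by lra.
  rewrite mulr1; case: m mj => [|[|//]] _.
    by rewrite mul0r addr0; apply: dN => //; rewrite (le_trans _ aN')// lerDl ltW.
  rewrite mul1r; apply: dN => //; last by rewrite (le_trans aN)// lerDl ltW.
  by rewrite -[mesh n]mul1r; apply: (dyadicD 1).
pose i := m./2; have mE : m = (odd m + i.*2)%N by rewrite odd_double_half.
have rj := exprn_gt0 j rho_gt0.
have hS : mesh (n + j) = 2 * mesh (n + j.+1) by rewrite addnS; exact: meshS.
have h' := mesh_gt0 (n + j.+1).
case: (boolP (odd m)) => om; last first.
  have -> : m%:R * mesh (n + j.+1) = i%:R * mesh (n + j).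
    by rewrite hS mE (negbTE om) add0n -muln2 natrM mulrA.
  apply: le_trans (IH i _); last by rewrite expnS in mj; lia.
  by rewrite ler_wpM2l ?(ltW r0)// lerD2l ler_wpM2r// exprS ler_piMl ?(ltW rj)// /rho; lra.
set x := a + _.
have xE : x = a + (2 * i%:R + 1) * mesh (n + j.+1).
  by rewrite /x mE om /= -muln2 natrD natrM; ring.
have ij : (i.+1 <= 2 ^ j)%N by rewrite expnS in mj; lia.
have xl : x - mesh (n + j.+1) = a + i%:R * mesh (n + j) by rewrite xE hS; ring.
have xr : x + mesh (n + j.+1) = a + i.+1%:R * mesh (n + j).
  by rewrite xE hS -natr1; ring.
have := IH i (ltnW ij); rewrite -xl => fl.
have := IH i.+1 ij; rewrite -xr => fr.
have dx : dyadic (n + j.+1) x by apply: dyadicD; exact: dyadic_refine.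
have xN : `|x| <= N%:R.
  have x0 : 0 <= m%:R * mesh (n + j.+1) by rewrite mulr_ge0// ltW.
  have x1 : m%:R * mesh (n + j.+1) <= mesh n.
    by rewrite -(mesh_expn n j.+1) ler_wpM2r ?(ltW h')// ler_nat.
  by rewrite ler_norml /x (le_trans aN) ?lerDl//= (le_trans _ aN')// lerD2l.
have [_] := gf dx xN; rewrite ler_norml => /andP[_ sd].
move: sd fl fr; rewrite exprD !exprS => sd fl fr.
suff : rho ^+ n * (2 / 3 + rho * rho ^+ j / 3) <= f x by [].
have e : rho ^+ n * (rho * rho ^+ j) = 2 / 5 * (rho ^+ n * rho ^+ j) by rewrite /rho; ring.
move: sd fl fr; set A := rho ^+ n * rho ^+ j in e *.
have E1 : rho ^+ n * (2 / 3 + rho ^+ j / 3) = rho ^+ n * (2 / 3) + A / 3 by rewrite /A; ring.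
have E2 : rho ^+ n * (2 / 3 + rho * rho ^+ j / 3) = rho ^+ n * (2 / 3) + rho ^+ n * (rho * rho ^+ j) / 3 by ring.
rewrite E1 E2 e.
by lra.
Qed.

Hypothesis cf : continuous f.

(** The bound (2 / 3) rho ^ n is uniform over all finer dyadic points of the cell, so continuity
    extends positivity to every point. *)
Lemma generic_pos : 0 < f a -> 0 < f (a + mesh n) ->
  forall x, a <= x <= a + mesh n -> 0 < f x.
Proof.
move=> fa fa' x /andP[ax xa]; rewrite ltNge; apply/negP => fx.
have h0 := mesh_gt0 n; have r0 := exprn_gt0 n rho_gt0.
have e0 : 0 < rho ^+ n * (2 / 3) by rewrite mulr_gt0//; lra.
have /cvgrPdist_lt/(_ _ e0) := cf (x := x).
rewrite /= nearE/= -/(nbhs _ _) => /nbhs_ballP[d /= d0 hd].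
have [j jd] := mesh_small d0.
have hj := mesh_gt0 (n + j).
have hjd : mesh (n + j) < d by rewrite (le_lt_trans _ jd)// mesh_le// leq_addl.
pose u := (x - a) / mesh (n + j).
have u0 : 0 <= u by rewrite /u mulr_ge0 ?invr_ge0 ?(ltW hj)// subr_ge0.
pose m := Num.truncn u.
have mu : m%:R <= u by have := truncn_itv u0 => /andP[].
have um : u < m.+1%:R by exact: truncnS_gt.
have uE : u * mesh (n + j) = x - a by rewrite /u divfK// gt_eqF.
have mj : (m <= 2 ^ j)%N.
  rewrite -(ler_nat R) (le_trans mu)// ler_pdivrMr// mesh_expn.
  by rewrite lerBlDl.
have := generic_dyadic_ge fa fa' mj; set y := a + _ => fy.
have h1 : y <= x by rewrite /y -lerBrDl -uE ler_wpM2r// ltW.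
have h2 : x < y + mesh (n + j).
  by rewrite /y -addrA -ltrBlDl -uE (_ : _ + _ = m.+1%:R * mesh (n + j)) ?ltr_pM2r// -natr1 mulrDl mul1r.
have /hd : ball x d y by rewrite /ball/= ger0_norm ?subr_ge0//; lra.
rewrite /= ltr_norml => /andP[+ _].
have rj := exprn_gt0 j rho_gt0.
have : rho ^+ n * (2 / 3) <= rho ^+ n * (2 / 3 + rho ^+ j / 3).
  by rewrite ler_wpM2l ?ltW//; lra.
by lra.
Qed.

End positivity.

Section sign_change.
Variables (N n : nat) (f : R -> R).
Hypothesis gf : forall j, generic_at N (n + j) f.
Hypothesis cf : continuous f.

Lemma generic_neq0 a : dyadic n a -> `|a| <= N%:R -> f a != 0.
Proof.
move=> da aN; have : dyadic (n + 0) a by rewrite addn0.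
move=> /(@gf 0%N a)[//|+ _]; rewrite -normr_gt0; apply: lt_trans.
by rewrite exprn_gt0// rho_gt0.
Qed.

Lemma generic_same_sign a : dyadic n a -> - N%:R <= a -> a + mesh n <= N%:R ->
  0 < f a * f (a + mesh n) -> forall x, a <= x <= a + mesh n -> f x != 0.
Proof.
move=> da aN aN' ff x xa.
have [fa|fa|fa0] := ltgtP (f a) 0; last by move: ff; rewrite fa0 mul0r ltxx.
  have fa' : f (a + mesh n) < 0 by rewrite -(nmulr_rgt0 _ fa).
  have gf' j : generic_at N (n + j) (\- f).
    move=> y dy yN; have [h1 h2] := gf dy yN; rewrite /= normrN; split => //.
    by rewrite -normrN; congr (`|_| <= _) : h2; ring.
  have cf' : continuous (\- f) by move=> y; apply: cvgN; exact: cf.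
  have := generic_pos gf' da aN aN' cf' _ _ xa.
  by rewrite /= !oppr_gt0 => h; rewrite lt_eqF// h.
by rewrite gt_eqF// (generic_pos gf da aN aN')// -(pmulr_rgt0 _ fa).
Qed.

Lemma sign_change_zero (p q : R) : p < q -> f p * f q < 0 -> exists2 x, p < x < q & f x = 0.
Proof.
move=> pq fpq; have [||x xpq fx] := @IVT R f p q 0 (ltW pq).
- exact: continuous_subspaceT.
- by rewrite ge_min le_max; case: (ltgtP (f p) 0) fpq => [fp|fp|->]; rewrite ?mul0r ?ltxx//=;
    rewrite ?(nmulr_rlt0 _ fp) ?(pmulr_rlt0 _ fp) => /ltW ->.
have xp : x != p by apply: contraTneq fpq => xp; rewrite -xp fx mul0r ltxx.
have xq : x != q by apply: contraTneq fpq => xq; rewrite -xq fx mulr0 ltxx.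
by exists x => //; rewrite !lt_neqAle eq_sym xp xq /=; move: xpq; rewrite in_itv.
Qed.

End sign_change.

(** If the midpoint separated the two zeros, both halves would have a sign change, the endpoints of
    the cell would have equal signs, and the cell could contain no zero. *)
Lemma generic_split N n f a : (forall j, generic_at N (n + j) f) -> continuous f ->
  dyadic n a -> - N%:R <= a -> a + mesh n <= N%:R ->
  forall x y, a <= x -> x < y -> y <= a + mesh n -> f x = 0 -> f y = 0 ->
  exists b, [/\ dyadic n.+1 b, a <= b, b + mesh n.+1 <= a + mesh n, b <= x & y <= b + mesh n.+1].
Proof.
move=> gf cf da aN aN' x y ax xy ya fx fy.
have h0 := mesh_gt0 n.+1; have hS := meshS n; pose c := a + mesh n.+1.
have d1 : dyadic n.+1 a by rewrite -addn1; exact: dyadic_refine.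
have dc : dyadic n.+1 c by rewrite /c -[mesh _]mul1r; exact: (dyadicD 1).
have cE : c + mesh n.+1 = a + mesh n by rewrite /c hS; ring.
have aN2 : a <= N%:R by rewrite (le_trans _ aN')// lerDl hS; lra.
have cN1 : - N%:R <= c by rewrite (le_trans aN)// /c lerDl ltW.
have cN2 : c <= N%:R by rewrite (le_trans _ aN')// -cE lerDl ltW.
have gf' j : generic_at N (n.+1 + j) f by rewrite addSnnS; exact: gf.
have fa : f a != 0 by apply: (generic_neq0 gf) => //; rewrite ler_norml aN.
have fc : f c != 0 by apply: (generic_neq0 gf') => //; rewrite ler_norml cN1.
have [yc|cy] := leP y c; first by exists a; split => //; rewrite -cE /c lerDl ltW.
have [cx|xc] := leP c x; first by exists c; split => //; rewrite ?cE// /c lerDl ltW.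
exfalso.
have f1 : f a * f c < 0.
  rewrite lt_neqAle mulf_neq0//= leNgt; apply/negP => ff.
  have := generic_same_sign gf' cf d1 aN cN2 ff (x := x).
  by rewrite fx eqxx => /(_ _)/negP; apply => //; rewrite ax ltW.
have f2 : f c * f (a + mesh n) <= 0.
  rewrite leNgt; apply/negP => ff.
  have := @generic_same_sign _ _ _ gf' cf c dc cN1; rewrite cE => /(_ aN' ff y).
  by rewrite fy eqxx => /(_ _)/negP; apply => //; rewrite ltW.
have f3 : f a * f (a + mesh n) <= 0.
  rewrite leNgt; apply/negP => ff.
  have := generic_same_sign gf cf da aN aN' ff (x := x).
  by rewrite fx eqxx => /(_ _)/negP; apply => //; rewrite ax (le_trans (ltW xy)).
have fe : f (a + mesh n) != 0.
  by rewrite -cE; apply: (generic_neq0 gf'); [rewrite -[mesh _]mul1r; exact: (dyadicD 1)|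
    rewrite cE ler_norml aN' andbT (le_trans cN1)// -cE lerDl ltW].
have [f0|f0|f0] := ltgtP (f a) 0; last by rewrite f0 eqxx in fa.
  move: f1 f3; rewrite nmulr_rlt0// nmulr_rle0// => fc0 fe0.
  by move: f2; rewrite pmulr_rle0// => fe1; move: fe; rewrite eq_le fe0 fe1.
move: f1 f3; rewrite pmulr_rlt0// pmulr_rle0// => fc0 fe0.
by move: f2; rewrite nmulr_rle0// => fe1; move: fe; rewrite eq_le fe0 fe1.
Qed.

(** Two zeros of one cell would share a cell at every finer level, whose length tends to 0. *)
Lemma generic_zero_unique N n f a : (forall j, generic_at N (n + j) f) -> continuous f ->
  dyadic n a -> - N%:R <= a -> a + mesh n <= N%:R ->
  forall x y, a <= x -> x < y -> y <= a + mesh n -> f x = 0 -> f y = 0 -> False.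
Proof.
move=> gf cf da aN aN' x y ax xy ya fx fy.
have H j : exists b, [/\ dyadic (n + j) b, a <= b, b + mesh (n + j) <= a + mesh n, b <= x
    & y <= b + mesh (n + j)].
  elim: j => [|j [b [db ab ba bx yb]]]; first by exists a; rewrite addn0.
  have gf' i : generic_at N (n + j + i) f by rewrite -addnA; exact: gf.
  have [c [dc bc cb cx yc]] := generic_split gf' cf db (le_trans aN ab) (le_trans ba aN') bx xy yb fx fy.
  by exists c; rewrite addnS; split => //; [exact: le_trans bc|exact: le_trans ba].
have xy0 : 0 < y - x by rewrite subr_gt0.
have [j jxy] := mesh_small xy0; have [b [_ _ _ bx yb]] := H j.
have : y - x <= mesh (n + j) by lra.
by rewrite leNgt (le_lt_trans _ jxy)// mesh_le// leq_addl.
Qed.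

Lemma generic_locally_finite f : continuous f -> generic_path f ->
  locally_finite [set t | f t = 0].
Proof.
move=> cf gf a b.
(* The margin of 1 keeps the cells that meet [a, b] inside [-N, N]. *)
pose N := (Num.truncn `|a| + Num.truncn `|b|).+3.
have [n gN] := gf N.
have gNj j : generic_at N (n + j) f by apply: gN; exact: leq_addr.
have h1 : mesh n <= 1 by have := mesh_le (leq0n n); rewrite {2}/mesh expr0.
have h0 := mesh_gt0 n.
have NE : N%:R = (Num.truncn `|a|).+1%:R + (Num.truncn `|b|).+1%:R + 1 :> R.
  by rewrite -!natrD -(natrD _ _ 1) addn1 addSn addnS.
have aN : `|a| + 1 <= N%:R by rewrite NE; have := truncnS_gt `|a|; have : 0 <= (Num.truncn `|b|).+1%:R :> R by []; lra.
have bN : `|b| + 1 <= N%:R by rewrite NE; have := truncnS_gt `|b|; have : 0 <= (Num.truncn `|a|).+1%:R :> R by []; lra.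
pose g x := Num.floor (x / mesh n).
have gP x : (g x)%:~R * mesh n <= x < (g x)%:~R * mesh n + mesh n.
  have /andP[] := floor_itv (x / mesh n); rewrite -/(g x) intrD.
  by rewrite ler_pdivlMr// ltr_pdivrMr// mulrDl mul1r => -> ->.
have ginj x y : f x = 0 -> f y = 0 -> x \in `[a, b] -> y \in `[a, b] -> x < y -> g x = g y -> False.
  rewrite !in_itv/= => fx fy /andP[ax xb] /andP[ay yb] xy gxy.
  have /andP[x1 x2] := gP x; have /andP[y1 y2] := gP y; rewrite -gxy in y1 y2.
  apply: (generic_zero_unique gNj cf _ _ _ x1 xy (ltW y2) fx fy); first by exists (g x).
  - by have := ler_norm (- a); rewrite normrN; lra.
  - by have := ler_norm b; lra.
(* A cell contains at most one zero, so the cell index is injective on the zeros. *)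
have gI : {in [set t | f t = 0] `&` `[a, b] &, injective g}.
  move=> x y /set_mem[/= fx xab] /set_mem[/= fy yab] gxy.
  by have [xy|yx|//] := ltgtP x y; [case: (ginj x y)|case: (ginj y x)].
rewrite -(eq_finite_set (inj_card_eq gI)).
apply: (@sub_finite_set _ _ ((fun m : nat => g a + m%:Z) @` `I_(`|g b - g a|.+1)%N)).
  move=> _ [x [/= _ +] <-]; rewrite in_itv/= => /andP[ax xb].
  have ga : g a <= g x by apply: le_floor; rewrite ler_pM2r ?invr_gt0.
  have gb : g x <= g b by apply: le_floor; rewrite ler_pM2r ?invr_gt0.
  by exists (`|g x - g a|%N) => /=; lia.
exact/finite_image/finite_II.
Qed.

(** The right side involves only relative signs at dyadic neighbours, the information that can be
    recovered from the past. *)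
Lemma generic_zeros_meet f (a b : R) : continuous f -> generic_path f ->
  (points (zeros f) `&` `]a, b[) !=set0 <->
  exists n p, [/\ dyadic n p, a <= p, p + mesh n <= b & f p * f (p + mesh n) < 0].
Proof.
move=> cf gf; rewrite (locally_finite_zeros (generic_locally_finite cf gf)); split.
  move=> [x [/= fx]]; rewrite in_itv/= => /andP[ax xb].
  pose N := (Num.truncn `|x|).+2; have [n0 gN] := gf N.
  have e0 : 0 < Num.min (x - a) (b - x) by rewrite lt_min !subr_gt0 ax.
  have [j] := mesh_small e0; rewrite lt_min => /andP[ja jb].
  pose n := (n0 + j)%N; exists n.
  have gNj i : generic_at N (n + i) f by apply: gN; rewrite /n -addnA leq_addr.
  have h1 : mesh n <= 1 by have := mesh_le (leq0n n); rewrite {2}/mesh expr0.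
  have h0 := mesh_gt0 n; have nj : mesh n <= mesh j by rewrite mesh_le// leq_addl.
  have [p dp /andP[px xp]] := dyadic_floor n x; exists p.
  have xN : `|x| + 1 <= N%:R by rewrite /N -natr1 lerD2r ltW// truncnS_gt.
  have pN : - N%:R <= p by have := ler_norm (- x); rewrite normrN; lra.
  have pN' : p + mesh n <= N%:R by have := ler_norm x; lra.
  have dq : dyadic n (p + mesh n) by rewrite -[mesh n]mul1r; exact: (dyadicD 1).
  split => //; [lra|lra|].
  rewrite lt_neqAle mulf_neq0/=; last 2 first.
  - by apply: (generic_neq0 gNj) => //; rewrite ler_norml pN/= (le_trans _ pN')// lerDl ltW.
  - by apply: (generic_neq0 gNj) => //; rewrite ler_norml pN' andbT (le_trans pN)// lerDl ltW.
  rewrite leNgt; apply/negP => ff.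
  have := generic_same_sign gNj cf dp pN pN' ff (x := x).
  by rewrite fx eqxx => /(_ _)/negP; apply => //; rewrite px ltW.
move=> [n [p [_ ap pb ff]]].
have pq : p < p + mesh n by rewrite ltrDl mesh_gt0.
have [x /andP[px xp] fx] := sign_change_zero cf pq ff.
by exists x; split => //=; rewrite in_itv/= (le_lt_trans ap)//= (lt_le_trans xp).
Qed.

End generic_paths.

(** * Almost sure genericity *)

Lemma summable_integrals_cvg0 (R : realType) (d : measure_display) (T : measurableType d)
    (nu : {measure set T -> \bar R}) (f : nat -> T -> R) (c : nat -> R) (M : R) :
  (forall n, measurable_fun setT (f n)) -> (forall n w, 0 <= f n w) ->
  (forall n, (\int[nu]_w (f n w)%:E <= (c n)%:E)%E) ->
  (forall n, \sum_(0 <= i < n) c i <= M) ->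
  nu.-negligible [set w | ~ (f ^~ w @ \oo --> (0 : R))].
Proof.
move=> mf f0 fc cM.
have mfE n : measurable_fun setT (EFin \o f n) by exact/measurable_EFinP.
pose S w := (\sum_(n <oo) (f n w)%:E)%E.
have S0 w : (0 <= S w)%E by apply: nneseries_ge0 => n _ _; rewrite lee_fin.
have mS : measurable_fun setT S.
  by apply: (@ge0_emeasurable_sum _ _ _ setT (fun n w => (f n w)%:E) xpredT) => [n w _ _|n _];
    [rewrite lee_fin|exact: mfE].
have ES : (\int[nu]_w S w <= M%:E)%E.
  rewrite /S integral_nneseries//; last by move=> n w _; rewrite lee_fin.
  apply: lime_le.
    by apply: is_cvg_nneseries => n _ _; apply: integral_ge0 => w _; rewrite lee_fin.
  apply: nearW => n; apply: (@le_trans _ _ (\sum_(0 <= i < n) (c i)%:E)%E).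
    by apply: lee_sum => i _; exact: fc.
  by rewrite sumEFin lee_fin.
have iS : nu.-integrable setT S.
  apply/integrableP; split => //; apply: le_lt_trans (ltry M).
  by rewrite (eq_integral S) => // w _; rewrite gee0_abs.
have := integrable_ae measurableT iS.
apply: negligibleS => w /= nf; apply: contra_not nf => /(_ I) Sfin.
apply: cvg_series_cvg_0; apply: nondecreasing_is_cvgn.
  by apply/nondecreasing_seqP => n; rewrite seriesSr lerDl.
exists (fine (S w)) => _ [n _ <-].
rewrite -lee_fin fineK// /series/= -sumEFin; apply: nneseries_lim_ge => k _ _.
by rewrite lee_fin.
Qed.

Lemma geometric_partial_sum_le (R : realType) (q a : R) n : 0 <= q -> q < 1 -> 0 <= a ->
  \sum_(0 <= i < n) a * q ^+ i <= a / (1 - q).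
Proof.
move=> q0 q1 a0; rewrite -mulr_sumr ler_wpM2l// big_mkord.
have q1' : 0 < 1 - q by rewrite subr_gt0.
rewrite -(ler_pM2l q1') mulfV ?gt_eqF//.
have := subrX1 q n; have := exprn_ge0 n q0; set S := \sum_(i < n) _; nra.
Qed.

Section generic_gaussian_paths.
Context {R : realType} {d : measure_display} {Omega : measurableType d}.
Variable P : probability Omega R.
Variable X : R -> {RV P >-> measurableTypeR R}.
Variable K : R -> R.
Hypotheses (X_gaussian : gaussian_process P X)
  (X_centered : forall t : R, ('E_P[X t] = 0)%E)
  (X_covariance : forall t s : R, covariance P (X t) (X s) = (K (t - s))%:E)
  (K_even : forall t, K (- t) = K t) (K0 : K 0 = 1)
  (K_diff4 : forall h, 6 - 8 * K h + 2 * K (2 * h) <= (2 * pi * h) ^+ 4).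

Let second_diff (x h : R) : seq (R * R) := [:: (1, x + h); (- 2, x); (1, x - h)].

Let second_diffE x h w :
  lin X (second_diff x h) w = X (x + h) w - 2 * X x w + X (x - h) w.
Proof. by rewrite /lin /path_comb !big_cons big_nil/= !mul1r addr0 mulNr addrA. Qed.

Let second_diff_var x h : cov_form K (second_diff x h) (second_diff x h) <= (2 * pi * h) ^+ 4.
Proof.
apply: le_trans (K_diff4 h); rewrite /cov_form !big_cons !big_nil/=.
have e1 : x + h - x = h by ring.
have e2 : x + h - (x - h) = 2 * h by ring.
have e3 : x - (x + h) = - h by ring.
have e4 : x - (x - h) = h by ring.
have e5 : x - h - (x + h) = - (2 * h) by ring.
have e6 : x - h - x = - h by ring.
rewrite !subrr e1 e2 e3 e4 e5 e6.
by rewrite !K_even K0; lra.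
Qed.

Let point (N n m : nat) : R := m%:R * mesh n - N%:R.

Let dyadic_point N n x : dyadic n x -> `|x| <= N%:R ->
  exists2 m, (m < (2 * N * 2 ^ n).+1)%N & x = point N n m.
Proof.
move=> [k ->]; have h0 : 0 < mesh n :> R by exact: mesh_gt0.
set M := (N * 2 ^ n)%N.
have NE : N%:R = M%:R * mesh n :> R.
  by rewrite natrM -mulrA -[n in mesh n]add0n mesh_expn /mesh expr0 mulr1.
rewrite normrM (gtr0_norm h0) NE ler_pM2r// -intr_norm.
rewrite -[M%:R]/(M%:~R) ler_int => kM; exists (absz (k + M%:Z)).
  by rewrite -mulnA -/M; lia.
rewrite /point NE -mulrBl; congr (_ * _).
have e : Posz (absz (k + M%:Z)) = k + M%:Z by lia.
by rewrite -[(absz _)%:R]/((Posz (absz (k + M%:Z)))%:~R) e intrD addrK.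
Qed.

Let small (N n m : nat) : set Omega := [set w | `|X (point N n m) w : R| <= rho ^+ n].

(** A value below 1 excludes every small value and every large second difference on the grid at
    once, so one summable sequence of expectations covers both conditions of [generic_at]. *)
Let defect (N n : nat) (w : Omega) : R := \sum_(m < (2 * N * 2 ^ n).+1)
  (\1_(small N n m) w + lin X (second_diff (point N n m) (mesh n)) w ^+ 2 / rho ^+ (2 * n)).

Let measurable_small N n m : measurable (small N n m).
Proof.
have mX : measurable_fun setT (fun w => `|X (point N n m) w : R|).
  by apply: measurableT_comp => //; exact: measurable_process.
have := mX measurableT `]-oo, rho ^+ n]%classic (measurable_itv _).
by rewrite setTI (_ : _ @^-1` _ = small N n m).
Qed.

Let small_le N n m : (P (small N n m) <= (rho ^+ n)%:E)%E.
Proof.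
set t := point N n m.
have iX := integrable_process X_centered X_covariance t.
have iX2 := integrable_process_sqr X_centered X_covariance t.
have gX : gaussian_rv P (X t).
  have := gaussian_lin X_gaussian [:: (1, t)].
  by rewrite (_ : lin X _ = X t)//; apply/funext => w; rewrite /lin /path_comb big_seq1 mul1r.
have EX : (\int[P]_w (X t w : R))%R = 0.
  by have := X_centered t; rewrite expectation.unlock /Rintegral => ->.
have EX2 : (\int[P]_w ((X t w : R) ^+ 2))%R = 1.
  under eq_Rintegral do rewrite expr2.
  by rewrite /Rintegral (process_product_expectation X_centered X_covariance) subrr K0.
apply: (gaussian_rv_small_ball gX iX EX iX2 EX2) => //.
by rewrite exprn_ge0// ltW// rho_gt0.
Qed.

Let defect_ge0 N n w : 0 <= defect N n w.
Proof.
apply: sumr_ge0 => m _; rewrite addr_ge0 ?ler0n// mulr_ge0 ?sqr_ge0// invr_ge0.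
by rewrite exprn_ge0// ltW// rho_gt0.
Qed.

Let measurable_defect N n : measurable_fun setT (defect N n).
Proof.
apply: measurable_sum => m; apply: measurable_funD.
  exact: measurable_indic.
by apply: measurable_funM => //; apply: measurable_funX; exact: measurable_lin.
Qed.

(** Each term has expectation of order rho ^ n, and the number of grid points is of order 2 ^ n,
    whence the ratio 2 rho = 4 / 5. *)
Let defect_integral N n :
  (\int[P]_w (defect N n w)%:E <= ((2 * N).+1%:R * (1 + (2 * pi) ^+ 4) * (4 / 5) ^+ n)%:E)%E.
Proof.
pose term m w : R := \1_(small N n m) w +
  lin X (second_diff (point N n m) (mesh n)) w ^+ 2 / rho ^+ (2 * n).
have r0 : 0 < rho ^+ n :> R by rewrite exprn_gt0// rho_gt0.
have i1 m : P.-integrable setT (EFin \o (\1_(small N n m) : Omega -> R)).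
  apply: (@bounded_integrable _ _ _ _ _ 1); first exact: measurable_indic.
  by move=> w; rewrite ger0_norm// indicE; case: (_ \in _).
have i2 m : P.-integrable setT
    (EFin \o (fun w => lin X (second_diff (point N n m) (mesh n)) w ^+ 2 / rho ^+ (2 * n))).
  set s := second_diff _ _.
  have := integrableZr measurableT (rho ^+ (2 * n))^-1 (integrable_lin_product X_centered X_covariance s s).
  by apply: eq_integrable => // w _; rewrite /= expr2.
have iterm m : P.-integrable setT (EFin \o term m).
  by have := integrableD measurableT (i1 m) (i2 m); apply: eq_integrable.
have term_le m : (\int[P]_w term m w)%R <= rho ^+ n * (1 + (2 * pi) ^+ 4).
  rewrite /term RintegralD// mulrDr mulr1; apply: lerD.
    rewrite -lee_fin; apply: le_trans (small_le N n m).
    by rewrite /Rintegral integral_indic// setIT fineK// fin_num_measure.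
  rewrite RintegralZr//; last first.
    have := integrable_lin_product X_centered X_covariance
      (second_diff (point N n m) (mesh n)) (second_diff (point N n m) (mesh n)).
    by apply: eq_integrable => // w _; rewrite /= expr2.
  under eq_Rintegral do rewrite expr2.
  rewrite (Rintegral_lin_product X_centered X_covariance) ler_pdivrMr ?exprn_gt0 ?rho_gt0//.
  apply: (le_trans (second_diff_var _ _)).
  rewrite exprMn [leRHS]mulrAC [leRHS]mulrC ler_wpM2l ?exprn_even_ge0//.
  rewrite -exprD (_ : n + 2 * n = 3 * n)%N; last by lia.
  (* The margin is thin: 1 / 16 <= rho ^ 3 = 8 / 125 is needed here, and 2 rho < 1 for the
     summation. *)
  rewrite /mesh -exprM mulnC !exprM lerXn2r ?nnegrE ?exprn_ge0//; last by rewrite /rho !exprS expr0; lra.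
  exact/ltW/rho_gt0.
have -> : (\int[P]_w (defect N n w)%:E = (\int[P]_w defect N n w)%R%:E)%E.
  rewrite /Rintegral fineK//; apply: integrable_fin_num => //.
  have := integrable_sum measurableT (index_enum 'I_(2 * N * 2 ^ n).+1) (P := xpredT)
    (h := fun m => EFin \o term m) (fun m _ => iterm m).
  by apply: eq_integrable => // w _; rewrite /= sumEFin.
rewrite lee_fin /defect Rintegral_sum//; last by move=> m; exact: iterm.
apply: (@le_trans _ _ (\sum_(m < (2 * N * 2 ^ n).+1) rho ^+ n * (1 + (2 * pi) ^+ 4))).
  by apply: ler_sum => m _; exact: term_le.
have -> : 4 / 5 = 2 * rho :> R by rewrite /rho; ring.
rewrite sumr_const card_ord [(2 * rho) ^+ n]exprMn -[X in X <= _]mulr_natl; set B := 1 + _.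
have B0 : 0 <= B by rewrite addr_ge0// exprn_even_ge0.
have -> : (2 * N).+1%:R * B * (2 ^+ n * rho ^+ n) = ((2 * N).+1%:R * 2 ^+ n) * (rho ^+ n * B) by ring.
rewrite ler_wpM2r ?mulr_ge0 ?(ltW r0)// -natrX -natrM ler_nat mulSn addnC.
by have := expn_gt0 2 n; lia.
Qed.

Lemma generic_gaussian_path : P.-negligible [set w | ~ generic_path (fun t => X t w)].
Proof.
have : P.-negligible (\bigcup_N [set w | ~ (defect N ^~ w @ \oo --> (0 : R))]).
  apply: negligible_bigcup => N.
  apply: (summable_integrals_cvg0 (measurable_defect N) (defect_ge0 N) (defect_integral N)) => n.
  by apply: geometric_partial_sum_le; [lra|lra|rewrite mulr_ge0// addr_ge0// exprn_even_ge0].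
apply: negligibleS => w /= /existsNP[N NG]; exists N => //=; apply: contra_not NG.
move=> /cvgrPdist_lt/(_ _ ltr01)[n0 _ H]; exists n0 => n n0n x dx xN.
have := H n n0n; rewrite /= sub0r normrN ger0_norm// => d1.
have [m mM xm] := dyadic_point dx xN.
have r0 : 0 < rho ^+ n :> R by rewrite exprn_gt0// rho_gt0.
have : \1_(small N n m) w + lin X (second_diff x (mesh n)) w ^+ 2 / rho ^+ (2 * n) < 1.
  apply: le_lt_trans d1; rewrite /defect (bigD1 (Ordinal mM))//= -xm lerDl.
  apply: sumr_ge0 => i _; rewrite addr_ge0 ?ler0n// mulr_ge0 ?sqr_ge0// invr_ge0.
  by rewrite exprn_ge0// ltW// rho_gt0.
have l0 : 0 <= lin X (second_diff x (mesh n)) w ^+ 2 / rho ^+ (2 * n).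
  by rewrite mulr_ge0 ?sqr_ge0// invr_ge0 exprn_ge0// ltW// rho_gt0.
have i0 : 0 <= \1_(small N n m) w :> R by rewrite ler0n.
move=> s1; split.
  rewrite ltNge; apply/negP => sm.
  have : \1_(small N n m) w = 1 :> R by rewrite indicE mem_set// /small/= -xm.
  by move=> E; rewrite E in s1; lra.
have : lin X (second_diff x (mesh n)) w ^+ 2 / rho ^+ (2 * n) < 1 by lra.
rewrite ltr_pdivrMr ?exprn_gt0// ?rho_gt0// mul1r mulnC exprM.
rewrite -(real_normK (num_real (lin _ _ _))) ltr_pXn2r ?nnegrE ?(ltW r0)//.
by rewrite second_diffE => /ltW.
Qed.

End generic_gaussian_paths.

(** * Predictability *)

Section sign_flips.
Context {R : realType}.
Implicit Types (f : R -> R) (p q : R) (n N M : nat).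

(** Parity of the number of i < M with V i, built from the V i by Boolean operations so that it is
    an event when they are. *)
Fixpoint odd_many (V : nat -> Prop) M : Prop :=
  if M is M'.+1 then (odd_many V M' /\ ~ V M') \/ (~ odd_many V M' /\ V M') else False.

Lemma eq_odd_many V W M : (forall i, (i < M)%N -> V i <-> W i) -> odd_many V M <-> odd_many W M.
Proof.
elim: M => [//|M IH] VW /=.
have := VW M (ltnSn _); have := IH (fun i iM => VW i (ltnW iM)).
by tauto.
Qed.

Lemma sign_flip_trans (a b c : R) : a != 0 -> b != 0 -> c != 0 ->
  a * c < 0 <-> (a * b < 0 /\ ~ b * c < 0) \/ (~ a * b < 0 /\ b * c < 0).
Proof.
move=> a0 b0 c0; rewrite !mulr_lt0 a0 b0 c0/=.
by case: (a < 0); case: (b < 0); case: (c < 0) => /=; intuition.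
Qed.

Lemma sign_flip_odd_many (g : nat -> R) M : (forall i, (i <= M)%N -> g i != 0) ->
  g 0%N * g M < 0 <-> odd_many (fun i => g i * g i.+1 < 0) M.
Proof.
elim: M => [|M IH] g0 /=.
  by split => // /lt_geF; rewrite -expr2 sqr_ge0.
rewrite (sign_flip_trans (g0 0%N _) (g0 M _) (g0 M.+1 _))//.
by have := IH (fun i iM => g0 i (leqW iM)); tauto.
Qed.

Lemma generic_flip N n f p : (forall j, generic_at N (n + j) f) -> continuous f ->
  dyadic n p -> - N%:R <= p -> p + mesh n <= N%:R ->
  f p * f (p + mesh n) < 0 <-> ([set t | f t = 0] `&` `]p, p + mesh n[) !=set0.
Proof.
move=> gf cf dp pN pN'; have h0 : 0 < mesh n :> R by exact: mesh_gt0.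
have dq : dyadic n (p + mesh n) by rewrite -[mesh n]mul1r; exact: (dyadicD 1).
have fp : f p != 0.
  by apply: (generic_neq0 gf) => //; rewrite ler_norml pN/= (le_trans _ pN')// lerDl ltW.
have fq : f (p + mesh n) != 0.
  by apply: (generic_neq0 gf) => //; rewrite ler_norml pN' andbT (le_trans pN)// lerDl ltW.
split => [ff|[x [/= fx]]].
  have [|x xpq fx] := @sign_change_zero _ f cf p (p + mesh n) _ ff; first by rewrite ltrDl.
  by exists x; split => //=; rewrite in_itv.
rewrite in_itv/= => /andP[px xq]; rewrite lt_neqAle mulf_neq0//= leNgt; apply/negP => ff.
have := generic_same_sign gf cf dp pN pN' ff (x := x).
by rewrite fx eqxx => /(_ _)/negP; apply => //; rewrite !ltW.
Qed.

(** The level k depends on the path and on the location. Since the equivalence holds at every finer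
    level, the sign can be read by a formula of the form: for some k and all j. *)
Lemma generic_sign_odd_many l f p (L : nat) : continuous f -> generic_path f -> dyadic l p ->
  exists k, forall j, f p * f (p + L%:R * mesh l) < 0 <->
    odd_many (fun i => ([set t | f t = 0] `&`
      `]p + i%:R * mesh (l + (k + j)), p + i.+1%:R * mesh (l + (k + j))[) !=set0) (L * 2 ^ (k + j)).
Proof.
move=> cf gf dp; pose q := p + L%:R * mesh l.
pose N := (Num.truncn `|p| + Num.truncn `|q|).+2.
have NE : N%:R = (Num.truncn `|p|).+1%:R + (Num.truncn `|q|).+1%:R :> R.
  by rewrite -natrD addSn addnS.
have pN : `|p| <= N%:R.
  by rewrite NE ler_wpDr// ltW// truncnS_gt.
have qN : `|q| <= N%:R.
  by rewrite NE ler_wpDl// ltW// truncnS_gt.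
have [n0 gN] := gf N; exists n0 => j.
pose n := (l + (n0 + j))%N; have h0 : 0 < mesh n :> R by exact: mesh_gt0.
have gNj i : generic_at N (n + i) f by apply: gN; rewrite /n; lia.
pose M := (L * 2 ^ (n0 + j))%N; pose g i := p + i%:R * mesh n.
have gM : g M = q by rewrite /g /q /M natrM -mulrA mesh_expn.
have g0 : g 0%N = p by rewrite /g mul0r addr0.
have gS i : g i.+1 = g i + mesh n by rewrite /g -natr1; ring.
have dg i : dyadic n (g i) by apply: dyadicD; exact: dyadic_refine.
have gp i : p <= g i by rewrite /g lerDl mulr_ge0// ltW.
have gq i : (i <= M)%N -> g i <= q by move=> iM; rewrite -gM /g lerD2l ler_wpM2r ?(ltW h0)// ler_nat.
have Np : - N%:R <= p by have := ler_norm (- p); rewrite normrN; lra.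
have Nq : q <= N%:R by have := ler_norm q; lra.
have fg i : (i <= M)%N -> f (g i) != 0.
  move=> iM; apply: (generic_neq0 gNj) => //.
  by rewrite ler_norml (le_trans Np)//= (le_trans (gq _ iM)).
rewrite -/q -{1}g0 -gM (sign_flip_odd_many fg); apply: eq_odd_many => i iM.
rewrite -/n -/(g i) -/(g i.+1) !gS; apply: (generic_flip gNj) => //; first exact: le_trans (gp i).
by rewrite -gS (le_trans (gq _ iM)).
Qed.

End sign_flips.

Lemma measurable_odd_many (d : measure_display) (T : measurableType d) (V : nat -> T -> Prop) M :
  (forall i, measurable [set w | V i w]) -> measurable [set w | odd_many (V^~ w) M].
Proof.
move=> mV; elim: M => [|M IH]; first by rewrite (_ : [set w | _] = set0)//; apply/seteqP.
rewrite (_ : [set w | _] = ([set w | odd_many (V^~ w) M] `&` ~` [set w | V M w]) `|`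
  (~` [set w | odd_many (V^~ w) M] `&` [set w | V M w]))//.
by apply: measurableU; apply: measurableI => //; exact: measurableC.
Qed.

Lemma measurable_meets_event (R : realType) (a b : R) :
  measurable [set z : point_space R | points z `&` `]a, b[ !=set0].
Proof.
have mc : measurable_fun setT (fun z : point_space R => counting (points z `&` `]a, b[) : \bar R).
  move=> _ B mB; apply: sub_sigma_algebra; exists `]a, b[%classic; first exact: measurable_itv.
  by exists B.
have := emeasurable_fun_c_infty measurableT mc 1%:E.
rewrite setTI (_ : [set z | _] = [set z | points z `&` `]a, b[ !=set0])//.
have fz (z : point_space R) : finite_set (points z `&` `]a, b[).
  apply: sub_finite_set (points_locally_finite z a b) => x [zx /=].
  by rewrite in_itv/= => /andP[h1 h2]; split => //=; rewrite in_itv/= !ltW.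
apply/seteqP; split => z /=.
  move=> /(at_least_counting 1 (fz z))/at_leastP[r [+ _]].
  by case: r => [|x [|y r]]// _ H; exists x; apply: H; rewrite inE.
move=> [x zx]; apply/(at_least_counting 1 (fz z))/at_leastP; exists [:: x]; split => // y.
by rewrite inE => /eqP ->.
Qed.

(** * Completed sigma-algebras *)

Section completion.
Context {R : realType} {d : measure_display} {Omega : measurableType d}.
Variable P : probability Omega R.

Lemma measurable_config_restrict (A : set (measurableTypeR R)) : measurable A ->
  measurable_fun setT (config_restrict A : point_space R -> point_space R).
Proof.
move=> mA; apply: (@measurability _ _ _ (point_space R) setT _ (count_events R)) => //.
move=> _ [_ [B mB [C mC <-]] <-]; rewrite !setTI.
apply: sub_sigma_algebra; exists (A `&` B); first exact: measurableI.
by exists C => //; rewrite setTI; apply/seteqP; split => z /=; rewrite setIA.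
Qed.

Lemma sigma_completed_comp d' (T : measurableType d') d'' (T' : measurableType d'')
    (f : Omega -> T) (g : T -> T') : measurable_fun setT g ->
  sigma_completed P (g \o f) `<=` sigma_completed P f.
Proof.
move=> mg; apply: smallest_sub; first exact: smallest_sigma_algebra.
move=> B [[C mC <-]|nB]; apply: sub_sigma_algebra; [left|by right].
exists (g @^-1` C); last by rewrite !setTI.
by have := mg measurableT C mC; rewrite setTI.
Qed.

(** With N the set where E and B differ, E is the union of B minus N and of E inside N, the latter
    negligible. *)
Lemma complete_ae_eq (G : set (set Omega)) (E B : set Omega) :
  sigma_algebra setT G -> P.-negligible `<=` G -> G B ->
  P.-negligible [set w | ~ (E w <-> B w)] -> G E.
Proof.
move=> sG nG GB nEB; set N := [set w | _] in nEB.
have GU C D : G C -> G D -> G (C `|` D).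
  have [G0 _ /(_ (bigcup2 C D)) GU] := sG.
  by move=> GC GD; rewrite -bigcup2E; apply: GU => -[|[|n]].
have GC C : G C -> G (~` C) by case: sG => _ + _ => /[apply]; rewrite setTD.
rewrite (_ : E = ~` (~` B `|` N) `|` (E `&` N)).
  apply: (GU); last by apply: nG; apply: negligibleS nEB => w [].
  by apply: (GC); apply: (GU); [exact: GC|exact: nG].
apply/seteqP; split => w /=; rewrite /N/=; last first.
  by move=> [h|[]//]; apply: contrapT => nE; apply: h; have [Bw|nB] := pselect (B w); [right; tauto|left].
move=> Ew; have [Bw|nB] := pselect (B w); first by left; tauto.
by right; tauto.
Qed.

End completion.

Section predictability.
Context {R : realType} {d : measure_display} {Omega : measurableType d}.
Variable P : probability Omega R.
Variable X : R -> {RV P >-> measurableTypeR R}.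
Variable K : R -> R.
Variables (s : nat -> R) (u : nat -> nat) (c : nat -> R) (M : R).
Hypotheses (X_gaussian : gaussian_process P X)
  (X_centered : forall t : R, ('E_P[X t] = 0)%E)
  (X_covariance : forall t s : R, covariance P (X t) (X s) = (K (t - s))%:E)
  (X_continuous : forall w : Omega, continuous (fun t : R => X t w : R))
  (K_even : forall t, K (- t) = K t) (K0 : K 0 = 1)
  (K_diff4 : forall h, 6 - 8 * K h + 2 * K (2 * h) <= (2 * pi * h) ^+ 4)
  (s_sign : forall n, s n * s n = 1)
  (u_unbounded : forall T : R, exists n0, forall n, (n0 <= n)%N -> T < (u n)%:R)
  (K_near : forall n, 1 - s n * K (u n)%:R <= c n)
  (c_summable : forall n, \sum_(0 <= i < n) c i <= M).

Let cX w : continuous ((fun t => X t w) : R -> R). Proof. exact: X_continuous. Qed.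

(** The mean square of X p - s_n X (p - u_n) is 2 (1 - s_n K (u_n)) <= 2 c_n, which is summable. *)
Lemma shifted_value_cvg p :
  P.-negligible [set w | ~ ((fun n => s n * X (p - (u n)%:R) w) @ \oo --> (X p w : R))].
Proof.
pose l n : seq (R * R) := [:: (1, p); (- s n, p - (u n)%:R)].
have : P.-negligible [set w | ~ ((fun n => lin X (l n) w ^+ 2) @ \oo --> (0 : R))].
  apply: (@summable_integrals_cvg0 _ _ _ P _ (fun n => 2 * c n) (2 * M)).
  - by move=> n; apply: measurable_funX; exact: measurable_lin.
  - by move=> n w; exact: sqr_ge0.
  - move=> n.
    have -> : (\int[P]_w (lin X (l n) w ^+ 2)%:E = (\int[P]_w (lin X (l n) w * lin X (l n) w))%R%:E)%E.
      rewrite /Rintegral fineK//; last first.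
        apply: integrable_fin_num => //; exact: (integrable_lin_product X_centered X_covariance).
    rewrite (Rintegral_lin_product X_centered X_covariance) lee_fin.
    rewrite /cov_form /l !big_cons !big_nil/= !subrr.
    have -> : p - (p - (u n)%:R) = (u n)%:R by ring.
    have -> : p - (u n)%:R - p = - (u n)%:R by ring.
    rewrite K_even K0.
    by have := K_near n; have := s_sign n; set x := s n; nra.
  - by move=> n; rewrite -mulr_sumr ler_wpM2l.
apply: negligibleS => w /=; apply: contra_not => h.
have lE n : lin X (l n) w = X p w - s n * X (p - (u n)%:R) w.
  by rewrite /lin /path_comb /l !big_cons big_nil/= mul1r addr0 mulNr.
apply/cvgrPdist_lt => e e0; have e2 : 0 < e ^+ 2 by rewrite exprn_gt0.
near=> n; rewrite -lE.
have : `|0 - lin X (l n) w ^+ 2| < e ^+ 2 by near: n; move/cvgrPdist_lt : h => /(_ _ e2).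
by rewrite sub0r normrN normrX ltr_pXn2r ?nnegrE// ltW.
Unshelve. all: by end_near.
Qed.

Let generic_value_neq0 w l p : generic_path (fun t => X t w) -> dyadic l p -> X p w != 0 :> R.
Proof.
move=> gf dp; have [n0 gN] := gf (Num.truncn `|p|).+1.
have := @generic_neq0 _ _ (l + n0) _ (fun j => gN _ _) p; apply.
- by move=> i; lia.
- exact: dyadic_refine.
- exact/ltW/truncnS_gt.
Qed.

(** In the product of two shifted values the factor s_n appears squared and disappears; the limit is
    nonzero at dyadic points of a generic path, so the sign of the product stabilises. *)
Let sign_shift l p q : dyadic l p -> dyadic l q ->
  P.-negligible [set w | generic_path (fun t => X t w) /\
    ~ (exists n0, forall n, (n0 <= n)%N ->
       X (p - (u n)%:R) w * X (q - (u n)%:R) w < 0 :> R <-> X p w * X q w < 0 :> R)].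
Proof.
move=> dp dq; apply: negligibleS (negligibleU (shifted_value_cvg p) (shifted_value_cvg q)).
move=> w [/= gw]; apply: contra_notP => /not_orP[/contrapT hp /contrapT hq].
have v0 : X p w * X q w != 0 :> R.
  by rewrite mulf_neq0//; [exact: generic_value_neq0 dp|exact: generic_value_neq0 dq].
have hpq : (fun n => (s n * X (p - (u n)%:R) w) * (s n * X (q - (u n)%:R) w) : R) @ \oo -->
    (X p w * X q w : R) by apply: cvgM; [exact: hp|exact: hq].
move/cvgrPdist_lt : hpq => /(_ `|X p w * X q w|).
rewrite normr_gt0 => /(_ v0)[n0 _ H]; exists n0 => n n0n.
have := H n n0n; rewrite /= mulrACA s_sign mul1r.
move: v0; set v := X p w * X q w; set v' := X _ w * X _ w => v0 vv'.
have [v_lt0|v_gt0|vE] := ltgtP v 0.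
- by split => // _; move: vv'; rewrite (ltr0_norm v_lt0) ltr_norml => /andP[]; lra.
- by split => // ?; move: vv'; rewrite (gtr0_norm v_gt0) ltr_norml => /andP[]; lra.
- by rewrite vE eqxx in v0.
Qed.

Let Z (w : Omega) : point_space R := zeros (fun t => X t w).

Let past t (w : Omega) : point_space R := config_restrict `]-oo, t[ (Z w).

Let past_events t := preimage_set_system setT (past t) measurable `|` P.-negligible.

(** Omega with the completed past as its measurable sets: predictability becomes measurability of
    [Z] on this space. *)
Let past_type t := g_sigma_algebraType (past_events t).

Let past_complete t (E B : set (past_type t)) : measurable B ->
  P.-negligible [set w | ~ (E w <-> B w)] -> measurable E.
Proof.
apply: (@complete_ae_eq _ _ _ P (@measurable _ (past_type t))).
  exact: smallest_sigma_algebra.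
by move=> N nN; apply: sub_sigma_algebra; right.
Qed.

Let measurable_past_meets t a b :
  measurable [set w : past_type t | points (past t w) `&` `]a, b[ !=set0].
Proof.
have := measurable_meets_event a b => mC; apply: sub_sigma_algebra; left.
by exists [set z : point_space R | points z `&` `]a, b[ !=set0] => //; rewrite setTI.
Qed.

Let generic_null := generic_gaussian_path X_gaussian X_centered X_covariance K_even K0 K_diff4.

(** The flip between p and q is eventually that between p - u_n and q - u_n, an interval lying
    before t, where the parity of the number of cells met by the past zeros reveals it. *)
Let measurable_sign_flip t l p L : dyadic l p ->
  measurable [set w : past_type t | (X p w * X (p + L%:R * mesh l) w < 0 :> R)].
Proof.
move=> dp; pose q : R := p + L%:R * mesh l.
have dq : dyadic l q by exact: dyadicD.
pose A n k : set (past_type t) := [set w | odd_many (fun i => points (past t w) `&`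
  `]p - (u n)%:R + i%:R * mesh (l + k), p - (u n)%:R + i.+1%:R * mesh (l + k)[ !=set0) (L * 2 ^ k)].
have mA n k : measurable (A n k) by apply: measurable_odd_many => i; exact: measurable_past_meets.
(* A lower limit over the shifts and one over the refinement levels: both thresholds depend on the
   path. *)
apply: (@past_complete t _ (\bigcup_m \bigcap_n \bigcup_k \bigcap_j A (m + n)%N (k + j)%N)).
  by do 2 (apply: bigcupT_measurable => ?; apply: bigcapT_measurable => ?).
apply: negligibleS (negligibleU generic_null (sign_shift dp dq)) => w /=.
apply: contra_notP => /not_orP[/contrapT gw /not_andP[//|/contrapT[n0 H]]].
(* From n1 on, q - u_n < t, so [Z] and its restriction to the past agree on the cells that are
   counted. *)
have [n1 tn] := u_unbounded (q - t).
(* An integer shift preserves the dyadic grid. *)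
have dpn n : dyadic l (p - (u n)%:R).
  have [k ->] := dp; exists (k - (u n * 2 ^ l)%N%:Z); rewrite intrB mulrBl; congr (_ - _).
  by rewrite -[(Posz _)%:~R]/((u n * 2 ^ l)%:R) natrM -mulrA -[l in mesh l]add0n mesh_expn /mesh expr0 mulr1.
have qn n : q - (u n)%:R = p - (u n)%:R + L%:R * mesh l by rewrite /q; ring.
have AE n k : (n1 <= n)%N -> A n k w <-> odd_many (fun i => ([set x | X x w = 0 :> R] `&`
    `]p - (u n)%:R + i%:R * mesh (l + k), p - (u n)%:R + i.+1%:R * mesh (l + k)[) !=set0) (L * 2 ^ k).
  move=> n1n; apply: eq_odd_many => i iL.
  rewrite /past/= /Z (locally_finite_zeros (generic_locally_finite (@cX w) gw)) -setIA.
  rewrite [X in _ `&` X](_ : _ = `]p - (u n)%:R + i%:R * mesh (l + k), p - (u n)%:R + i.+1%:R * mesh (l + k)[%classic)//.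
  apply/seteqP; split => x /=; first by case.
  move=> xi; split => //; move: xi; rewrite !in_itv/= => /andP[_ /lt_le_trans]; apply.
  have : p - (u n)%:R + i.+1%:R * mesh (l + k) <= q - (u n)%:R.
    have h0 : 0 < mesh (l + k) :> R by exact: mesh_gt0.
    by rewrite qn lerD2l -(mesh_expn l k) mulrA -natrM ler_pM2r// ler_nat.
  by have := tn n n1n; lra.
have signE n : (n1 <= n)%N ->
    (exists k, forall j, A n (k + j)%N w) <-> X (p - (u n)%:R) w * X (q - (u n)%:R) w < 0 :> R.
  move=> n1n; have [k0 Hk] := generic_sign_odd_many L (@cX w) gw (dpn n); rewrite qn.
  split => [[k Ak]|ff]; last by exists k0 => j; apply/AE => //; exact/Hk.
  by apply/(Hk k)/AE => //; rewrite addnC.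
split.
  move=> ff; exists (n0 + n1)%N => // n _.
  have l0 : (n0 <= n0 + n1 + n)%N by lia.
  have l1 : (n1 <= n0 + n1 + n)%N by lia.
  have [k Ak] := (signE _ l1).2 ((H _ l0).2 ff).
  by exists k.
move=> [m _ Am]; apply/(H (m + (n0 + n1))%N); first by lia.
apply/signE; first by lia.
by have [k _ Ak] := Am (n0 + n1)%N I; exists k => j; exact: Ak.
Qed.

Let measurable_meets t a b :
  measurable [set w : past_type t | points (Z w) `&` `]a, b[ !=set0].
Proof.
pose B n (k : int) : set (past_type t) := [set w |
  [/\ a <= k%:~R * mesh n, k%:~R * mesh n + mesh n <= b &
      X (k%:~R * mesh n) w * X (k%:~R * mesh n + mesh n) w < 0 :> R]].
apply: (@past_complete t _ (\bigcup_n \bigcup_k B n k)).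
  apply: bigcupT_measurable => n; apply: countable_bigcupT_measurable => // k.
  have [|nab] := pselect (a <= k%:~R * mesh n /\ k%:~R * mesh n + mesh n <= b); last first.
    by rewrite (_ : B n k = set0)//; apply/seteqP; split => // w [? ? _]; apply: nab.
  move=> [ak kb]; rewrite (_ : B n k =
      [set w : past_type t | X (k%:~R * mesh n) w * X (k%:~R * mesh n + 1%:R * mesh n) w < 0 :> R]).
    by apply: measurable_sign_flip; exists k.
  by apply/seteqP; split => w /=; rewrite mul1r; [case|].
apply: negligibleS generic_null => w /=; apply: contra_not => gw.
rewrite /Z (generic_zeros_meet _ _ (@cX w) gw); split.
  by move=> [n [_ [[k ->] ap pb ff]]]; exists n => //; exists k.
by move=> [n _ [k _ [ap pb ff]]]; exists n, (k%:~R * mesh n); split => //; exists k.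
Qed.

Lemma measurable_from_past t : measurable_fun setT (Z : past_type t -> point_space R).
Proof. by apply: measurable_config => a b; exact: measurable_meets. Qed.

Lemma sigma_completed_past t : sigma_completed P Z `<=` sigma_completed P (past t).
Proof.
apply: smallest_sub; first exact: smallest_sigma_algebra.
move=> B [[C mC <-]|nB]; last by apply: sub_sigma_algebra; right.
by have := @measurable_from_past t measurableT C mC.
Qed.

Theorem completely_predictable_zeros : completely_predictable P Z.
Proof.
apply/seteqP; split => [B ZB t _|B /(_ 0 I)]; first exact: sigma_completed_past.
by apply: sigma_completed_comp; apply: measurable_config_restrict; exact: measurable_itv.
Qed.

Theorem maximally_rigid_zeros : maximally_rigid P Z.
Proof.
move=> phi mphi _ T T0 B mB.
pose A : set (measurableTypeR R) := ~` `[- T, T].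
have mA : measurable A by apply: measurableC; exact: measurable_itv.
have h : sigma_completed P Z [set w | B (phi (config_restrict `[- T, T] (Z w)))].
  apply: sub_sigma_algebra; left.
  exists [set z | B (phi (config_restrict `[- T, T] z))]; last by rewrite setTI.
  have mr := measurable_config_restrict (measurable_itv `[- T, T]).
  have mc : measurable_fun setT (phi \o (config_restrict `[- T, T] : point_space R -> point_space R)).
    exact: measurableT_comp mphi mr.
  by rewrite -[X in measurable X]setTI; exact: mc.
have {h} := @sigma_completed_past (- T) _ h.
(* The points before - T are among those outside [-T, T], so predictability from time - T
   suffices. *)
have pastE : past (- T) = config_restrict `]-oo, (- T)[ \o (fun w => config_restrict A (Z w) : point_space R).
  apply/funext => w; apply: configP; rewrite /past /= -setIA; congr (_ `&` _).
  apply/seteqP; split => x /=; rewrite in_itv/=; last by case.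
  move=> xT; split => //; rewrite /A/= in_itv/= => /andP[Tx _].
  by move: xT; rewrite ltNge Tx.
rewrite pastE; apply: sigma_completed_comp; apply: measurable_config_restrict; exact: measurable_itv.
Qed.

End predictability.

(** * The spectral measure *)

Lemma sum_inv_sqr_le (R : realType) n : \sum_(0 <= i < n) (i.+1%:R ^+ 2)^-1 <= 2 :> R.
Proof.
suff H m : \sum_(0 <= i < m.+1) (i.+1%:R ^+ 2)^-1 <= 2 - m.+1%:R^-1 :> R.
  case: n => [|n]; first by rewrite big_nil.
  by apply: le_trans (H n) _; rewrite gerBl.
elim: m => [|m IH]; first by rewrite big_nat1 expr1n invr1; lra.
rewrite big_nat_recr//=; apply: le_trans (lerD IH (lexx _)) _.
rewrite -subr_ge0 -[m.+2%:R]natr1; set a : R := m.+1%:R.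
have a0 : 0 < a by rewrite /a.
have -> : 2 - (a + 1)^-1 - (2 - a^-1 + ((a + 1) ^+ 2)^-1) = (a * (a + 1) ^+ 2)^-1.
  by field; rewrite !gt_eqF//; lra.
by rewrite invr_ge0 mulr_ge0 ?sqr_ge0// ltW.
Qed.

(** * Lebesgue measure of the set of aligned cosines *)

Section window_orthogonality.
Context {R : realType}.
Let leb := @lebesgue_measure R.
Variable N : nat.
Let b : R := N.+1%:R * (2 * pi).
Let W : set R := `[- b, b].

Let mW : measurable (W : set (measurableTypeR R)). Proof. exact: measurable_itv. Qed.

Let b0 : 0 < b.
Proof. by rewrite mulr_gt0// mulr_gt0// pi_gt0. Qed.

Let lebW : leb W = (b + b)%:E.
Proof.
by rewrite /leb /W lebesgue_measure_itv/= lte_fin (@lt_trans _ _ 0) ?oppr_lt0//= opprK EFinD.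
Qed.

Lemma continuous_cosM (a : R) : continuous (fun x : R => cos (a * x)).
Proof.
move=> x; apply: continuous_comp; last exact: continuous_cos.
by apply: cvgM; [exact: cvg_cst|exact: cvg_id].
Qed.

Lemma cos_window_integral (k : nat) : (0 < k)%N ->
  (\int[leb]_(x in W) cos (k%:R * x))%R = 0.
Proof.
move=> k0; have k0' : k%:R != 0 :> R by rewrite pnatr_eq0 -lt0n.
pose G (x : R) := k%:R^-1 * sin (k%:R * x).
have dG x : is_derive x (1 : R) G (cos (k%:R * x)).
  have := is_derive_mul (is_derive_cst (k%:R^-1 : R) x 1)
    (is_derive_comp (is_derive_sin _) (is_derive_mul (is_derive_cst (k%:R : R) x 1) (is_derive_id x 1))).
  move/is_derive_eq; apply; rewrite /cst; move: (cos _) (sin _) => c s'.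
  by field.
have cG : continuous G.
  by move=> z; apply/differentiable_continuous/derivable1_diffP; case: (dG z).
rewrite /Rintegral (@continuous_FTC2 _ (fun x => cos (k%:R * x)) G)//.
- have s0 : sin (k%:R * b) = 0.
    apply/eqP; rewrite -sqrf_eq0 sin2cos2 /b.
    have -> : k%:R * (N.+1%:R * (2 * pi)) = 0 + (k * N.+1 * 2)%:R * pi :> R by rewrite !natrM; ring.
    by rewrite cos_natpi cos0 mulr1 -exprM -signr_odd oddM muln2 odd_double andbF subrr.
  by rewrite -EFinB /G mulrN sinN s0 oppr0 mulr0 subrr.
- by rewrite (@lt_trans _ _ 0)// oppr_lt0.
- exact: continuous_subspaceT (@continuous_cosM _).
- split.
  + by move=> x _; case: (dG x).
  + by apply: cvg_at_right_filter; exact: cG.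
  + by apply: cvg_at_left_filter; exact: cG.
- by move=> x _; rewrite derive1E; exact: derive_val.
Qed.

Lemma window_integrable (f : R -> R) : continuous f -> leb.-integrable W (EFin \o f).
Proof.
move=> cf; apply: continuous_compact_integrable; first exact: segment_compact.
exact: continuous_subspaceT.
Qed.

Lemma cos_window_product (k l : nat) : (0 < k)%N -> (0 < l)%N ->
  (\int[leb]_(x in W) (cos (k%:R * x) * cos (l%:R * x)))%R = if k == l then b else 0.
Proof.
move=> k0 l0.
wlog kl : k l k0 l0 / (l <= k)%N.
  move=> H; have [|/ltnW kl] := leqP l k; first exact: H.
  by rewrite eq_sym -H//; apply: eq_Rintegral => x _; rewrite mulrC.
have e x : cos (k%:R * x) * cos (l%:R * x) =
    2^-1 * (cos ((k + l)%:R * x) + cos ((k - l)%:R * x)) :> R.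
  by rewrite cosDcosB natrD natrB// mulrC -mulrDl -mulrBl.
under eq_Rintegral do rewrite e.
rewrite RintegralZl//; last first.
  apply: window_integrable => x; apply: cvgD; exact: continuous_cosM.
rewrite RintegralD//; [|exact/window_integrable/continuous_cosM|exact/window_integrable/continuous_cosM].
rewrite cos_window_integral ?addn_gt0 ?k0// add0r.
case: eqP => [->|/eqP nkl]; last by rewrite cos_window_integral ?mulr0// subn_gt0 ltn_neqAle eq_sym nkl.
rewrite subnn; under eq_Rintegral do rewrite mul0r cos0.
have -> : (\int[leb]_(x in W) 1 = b + b)%R.
  by rewrite Rintegral_cst// mul1r; exact: (congr1 fine lebW).
by field.
Qed.

Lemma trig_sum_window (s : nat -> R) (k : nat -> nat) (M : nat) :
  (forall i, s i * s i = 1) -> (forall i, (0 < k i)%N) -> injective k ->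
  (\int[leb]_(x in W) ((\sum_(i < M) s i * cos ((k i)%:R * x)) ^+ 2))%R = M%:R * b.
Proof.
move=> s1 k0 ki.
have e x : (\sum_(i < M) s i * cos ((k i)%:R * x)) ^+ 2 = \sum_(i < M) \sum_(j < M)
    s i * s j * (cos ((k i)%:R * x) * cos ((k j)%:R * x)) :> R.
  rewrite expr2 mulr_suml; apply: eq_bigr => i _; rewrite mulr_sumr.
  by apply: eq_bigr => j _; ring.
under eq_Rintegral do rewrite e.
have cc i j : continuous (fun x : R => cos ((k i)%:R * x) * cos ((k j)%:R * x)).
  by move=> x; apply: cvgM; exact: continuous_cosM.
have it i j : leb.-integrable W (EFin \o (fun x => s i * s j * (cos ((k i)%:R * x) * cos ((k j)%:R * x)))).
  by apply: window_integrable => x; apply: cvgM; [exact: cvg_cst|exact: cc].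
rewrite Rintegral_sum//; last first.
  move=> i.
  have := integrable_sum mW (index_enum 'I_M) (P := xpredT) (fun j _ => it i j).
  by apply: eq_integrable => // x _; rewrite /= sumEFin.
under eq_bigr => i _ do rewrite Rintegral_sum//.
transitivity (\sum_(i < M) b); last by rewrite sumr_const card_ord mulr_natl.
apply: eq_bigr => i _.
rewrite (bigD1 i)//= big1 ?addr0.
  rewrite RintegralZl//; last exact/window_integrable/cc.
  by rewrite cos_window_product// eqxx s1 mul1r.
move=> j ji; rewrite RintegralZl//; last exact/window_integrable/cc.
by rewrite cos_window_product// (inj_eq ki) val_eqE eq_sym (negbTE ji) mulr0.
Qed.

End window_orthogonality.

Section lebesgue_null.
Context {R : realType}.
Variable s : nat -> R.
Hypothesis s_sign : forall i, s i * s i = 1.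

(** Wherever s_n cos (n! x) tends to 1 the point x lies in one of these countably many sets; any
    threshold in ]0, 1[ would do. *)
Let aligned (N m : nat) : set (measurableTypeR R) :=
  [set x | N.+1%:R * (2 * pi) >= `|x| /\
    forall n, (m < n)%N -> 2^-1 <= s n * cos (n`!%:R * x)].

Let measurable_aligned N m : measurable (aligned N m).
Proof.
pose b : R := N.+1%:R * (2 * pi).
rewrite (_ : aligned N m = `[- b, b] `&`
    \bigcap_(n in [set n | (m < n)%N]) [set x | 2^-1 <= s n * cos (n`!%:R * x)]); last first.
  apply/seteqP; split => x /=; rewrite /aligned/= in_itv/= ler_norml.
    by move=> [xb h]; split.
  by move=> [xb h]; split.
apply: measurableI; first exact: measurable_itv.
apply: bigcap_measurable => [|n _]; first by exists m.+1 => /=.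
have mc : measurable_fun setT (fun x : R => s n * cos (n`!%:R * x)).
  apply: continuous_measurable_fun => x.
  by apply: cvgM; [exact: cvg_cst|exact: continuous_cosM].
have := mc measurableT `[2^-1, +oo[%classic (measurable_itv _).
rewrite setTI (_ : _ @^-1` _ = [set x | 2^-1 <= s n * cos (n`!%:R * x)])//.
by apply/seteqP; split => x /=; rewrite in_itv/= andbT.
Qed.

(* The functions cos (n! x) are orthogonal on a window of length a multiple of 2 pi: if
   M of them were all at least 1/2 in modulus on a set E with the signs s, then
   |E| (M / 2) ^ 2 would be at most the integral of the square of their signed sum, which
   is linear in M. *)
Let lebesgue_aligned N m : lebesgue_measure (aligned N m) = 0%E.
Proof.
pose b : R := N.+1%:R * (2 * pi).
have b0 : 0 <= b by rewrite mulr_ge0// mulr_ge0// pi_ge0.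
apply/eqP; rewrite eq_le measure_ge0 andbT.
have bound M : ((M%:R ^+ 2 / 4)%:E * lebesgue_measure (aligned N m) <= (M%:R * b)%:E)%E.
  (* The indices start beyond m, where alignment holds, and are positive, which avoids 0! = 1! and
     makes the frequencies distinct. *)
  pose k i := (m.+1 + i)`!.
  have k0 i : (0 < k i)%N by exact: fact_gt0.
  have ki : injective k.
    move=> i j; rewrite /k; wlog ij : i j / (i < j)%N => [H E|/eqP].
      by have [/H/(_ E)|/H/(_ (esym E))|//] := ltngtP i j.
    by rewrite ltn_eqF// ltn_fact ?ltn_add2l.
  pose S (x : R) := \sum_(i < M) s (m.+1 + i)%N * cos ((k i)%:R * x).
  have cS : continuous S.
    rewrite /S; elim: (M) => [|n IH] x.
      rewrite (_ : (fun x => _) = cst 0); first exact: cvg_cst.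
      by apply/funext => y; rewrite big_ord0.
    rewrite (_ : (fun x => _) = fun x => \sum_(i < n) s (m.+1 + i)%N * cos ((k i)%:R * x) +
      s (m.+1 + n)%N * cos ((k n)%:R * x)); last by apply/funext => y; rewrite big_ord_recr.
    apply: cvgD; first exact: IH.
    by apply: cvgM; [exact: cvg_cst|exact: continuous_cosM].
  have cS2 : continuous (fun x => S x ^+ 2).
    move=> x; apply: (@continuous_comp _ _ _ S (fun y => y ^+ 2)); [exact: cS|exact: exprn_continuous].
  have <- : (\int[lebesgue_measure]_(x in `[(- b)%R, b]) (S x ^+ 2)%:E = (M%:R * b)%:E)%E.
    have := @trig_sum_window R N (fun i => s (m.+1 + i)%N) k M (fun i => s_sign _) k0 ki.
    rewrite -/b => <-; rewrite /Rintegral fineK//.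
    have iS := window_integrable N cS2.
    by apply: (integrable_fin_num _ iS).
  rewrite -integral_cst//.
  apply: (@le_trans _ _ (\int[lebesgue_measure]_(x in aligned N m) (S x ^+ 2)%:E)%E).
    apply: ge0_le_integral => //.
    - by move=> x _; rewrite lee_fin divr_ge0// sqr_ge0.
    - by apply/measurable_EFinP; apply: measurable_funTS; exact: continuous_measurable_fun.
    - move=> x [_ xm]; rewrite lee_fin.
      have SM : M%:R / 2 <= S x.
        rewrite /S -[M in M%:R]card_ord -sumr_const mulr_suml; apply: ler_sum => i _.
        by rewrite mul1r; apply: xm; rewrite leq_addr.
      have -> : M%:R ^+ 2 / 4 = (M%:R / 2) ^+ 2 :> R by field.
      by rewrite lerXn2r// nnegrE ?divr_ge0// (le_trans _ SM)// divr_ge0.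
  apply: ge0_subset_integral => //.
  - by apply/measurable_EFinP; apply: measurable_funTS; exact: continuous_measurable_fun.
  - by move=> x _; rewrite lee_fin sqr_ge0.
  - by move=> x [xb _] /=; rewrite in_itv/= -ler_norml.
have h M : (lebesgue_measure (aligned N m) <= (4 * b / M.+1%:R)%:E)%E.
  have := bound M.+1; rewrite -lee_pdivlMl ?divr_gt0// => /le_trans; apply.
  by rewrite -EFinM lee_fin le_eqVlt; apply/orP; left; apply/eqP; field.
apply/lee_addgt0Pr => e e0; rewrite add0e.
apply: le_trans (h (Num.truncn (4 * b / e))) _; rewrite lee_fin ler_pdivrMr//.
by rewrite [leRHS]mulrC -ler_pdivrMr//; exact/ltW/truncnS_gt.
Qed.

Lemma lebesgue_null_aligned (B : set (measurableTypeR R)) : measurable B ->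
  (forall x, B x -> (fun n => 1 - s n * cos (n`!%:R * x)) @ \oo --> (0 : R)) ->
  lebesgue_measure B = 0%E.
Proof.
move=> mB Bx; apply: measure_negligible => //.
have neg : (@lebesgue_measure R).-negligible (\bigcup_N \bigcup_m aligned N m).
  apply: negligible_bigcup => N; apply: negligible_bigcup => m.
  exists (aligned N m); split => //; exact: lebesgue_aligned.
apply: negligibleS neg => x /Bx/cvgrPdist_lt/(_ 2^-1) []; first by rewrite invr_gt0.
move=> m _ H; exists (Num.truncn `|x|) => //; exists m => //; split.
  apply: (@le_trans _ _ (Num.truncn `|x|).+1%:R); first exact/ltW/truncnS_gt.
  by rewrite ler_peMr//; have := @pi_ge2 R; lra.
move=> n mn; have := H n (ltnW mn); rewrite /= sub0r normrN ltr_norml => /andP[].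
by lra.
Qed.

End lebesgue_null.

Section spectral_measure.
Context {R : realType}.
Variables (mu : {finite_measure set (measurableTypeR R) -> \bar R}) (K : R -> R).
Hypothesis mu_spectral : is_spectral_measure mu K.

Let integrable_cosM (a c : R) : mu.-integrable setT (EFin \o (fun x : R => cos (a * (x - c)))).
Proof.
apply: (@bounded_integrable _ _ _ _ _ 1); last by move=> x; exact: cos_norm_le1.
apply: continuous_measurable_fun => x; apply: continuous_comp; last exact: continuous_cos.
by apply: cvgM; [exact: cvg_cst|apply: cvgB; [exact: cvg_id|exact: cvg_cst]].
Qed.

Let integrable_sinM (a : R) : mu.-integrable setT (EFin \o (fun x : R => sin (a * x))).
Proof.
apply: (@bounded_integrable _ _ _ _ _ 1); last by move=> x; exact: sin_norm_le1.
apply: continuous_measurable_fun => x; apply: continuous_comp; last exact: continuous_sin.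
by apply: cvgM; [exact: cvg_cst|exact: cvg_id].
Qed.

Lemma spectral_cos (a c : R) : (\int[mu]_x cos (a * (x - c)))%R = cos (a * c) * K a.
Proof.
have i0 : mu.-integrable setT (EFin \o (fun x : R => cos (a * x))).
  by have := integrable_cosM a 0; apply: eq_integrable => // x _; rewrite /= subr0.
have e x : cos (a * (x - c)) = cos (a * c) * cos (a * x) + sin (a * c) * sin (a * x).
  by rewrite mulrBr cosB; ring.
under eq_Rintegral do rewrite e.
rewrite RintegralD//; last 2 first.
- by have := integrableZl measurableT (cos (a * c)) i0; apply: eq_integrable.
- by have := integrableZl measurableT (sin (a * c)) (integrable_sinM a); apply: eq_integrable.
rewrite !RintegralZl//; have [hc hs] := mu_spectral a.
have -> : (\int[mu]_x cos (a * x))%R = K a.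
  by rewrite /Rintegral -[RHS]/(fine (K a)%:E) -hc; congr fine; apply: eq_integral => x _; rewrite mulrC.
have -> : (\int[mu]_x sin (a * x))%R = 0.
  by rewrite /Rintegral -[RHS]/(fine 0%E) -hs; congr fine; apply: eq_integral => x _; rewrite mulrC.
by rewrite mulr0 addr0.
Qed.

(** The squared modulus of the sum of the n exponentials exp (i tau_j (x - x0)) integrates to n by
    orthonormality and equals n ^ 2 at x0, so the mass of x0 is at most 1 / n. *)
Lemma spectral_atomless (tau : nat -> R) : K 0 = 1 ->
  (forall i j, i != j -> K (tau i - tau j) = 0) -> atomless mu.
Proof.
move=> K0 tau_orth x0.
pose F n (x : R) := \sum_(i < n) \sum_(j < n) cos ((tau i - tau j) * (x - x0)).
have FE n x : F n x = (\sum_(i < n) cos (tau i * (x - x0))) ^+ 2 +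
    (\sum_(i < n) sin (tau i * (x - x0))) ^+ 2.
  rewrite !expr2 !mulr_suml -big_split/=; apply: eq_bigr => i _.
  rewrite !mulr_sumr -big_split/=; apply: eq_bigr => j _.
  by rewrite mulrBl cosB.
have F0 n x : 0 <= F n x by rewrite FE addr_ge0// sqr_ge0.
have Fx0 n : F n x0 = n%:R ^+ 2.
  rewrite FE subrr; under eq_bigr do rewrite mulr0 cos0.
  under [X in _ + X ^+ 2]eq_bigr do rewrite mulr0 sin0.
  by rewrite sumr_const card_ord big1// expr0n addr0.
have irow n i : mu.-integrable setT
    (EFin \o (fun x => \sum_(j < n) cos ((tau i - tau j) * (x - x0)))).
  have := integrable_sum measurableT (index_enum 'I_n) (P := xpredT)
    (fun j _ => integrable_cosM (tau i - tau j) x0).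
  by apply: eq_integrable => // x _; rewrite /= sumEFin.
have iF n : mu.-integrable setT (EFin \o F n).
  have := integrable_sum measurableT (index_enum 'I_n) (P := xpredT) (fun i _ => irow n i).
  by apply: eq_integrable => // x _; rewrite /= sumEFin.
have intF n : (\int[mu]_x (F n x)%:E = (n%:R)%:E)%E.
  transitivity ((\int[mu]_x F n x)%R%:E).
    by rewrite /Rintegral fineK//; exact: (integrable_fin_num measurableT (iF n)).
  congr EFin; rewrite /F Rintegral_sum//.
  transitivity (\sum_(i < n) (1 : R)); last by rewrite sumr_const card_ord.
  apply: eq_bigr => i _; rewrite Rintegral_sum//.
  rewrite (bigD1 i)//= spectral_cos subrr mul0r cos0 K0 mulr1 big1 ?addr0// => j ji.
  by rewrite spectral_cos tau_orth ?mulr0// eq_sym.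
have m1 : measurable [set x0 : measurableTypeR R] by exact: measurable_set1.
have bound n : ((n%:R ^+ 2)%:E * mu [set x0] <= (n%:R)%:E)%E.
  rewrite -integral_cst// -intF.
  have -> : (\int[mu]_(x in [set x0]) cst (n%:R ^+ 2)%:E x = \int[mu]_(x in [set x0]) (F n x)%:E)%E.
    by apply: eq_integral => x /set_mem -> /=; rewrite Fx0.
  apply: ge0_subset_integral => //; last by move=> x _; rewrite lee_fin.
  by have /measurable_int := iF n.
apply/eqP; rewrite eq_le measure_ge0 andbT; apply/lee_addgt0Pr => e e0; rewrite add0e.
have := bound (Num.truncn e^-1).+1; set n := _.+1 => bn.
have n0 : 0 < n%:R :> R by [].
have : (mu [set x0] <= (n%:R^-1)%:E)%E.
  move: bn; rewrite -lee_pdivlMl ?exprn_gt0// => /le_trans; apply.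
  by rewrite -EFinM lee_fin expr2 invfM mulrVK// unitfE gt_eqF.
move=> /le_trans; apply; rewrite lee_fin -[leRHS]invrK lef_pV2 ?posrE ?invr_gt0//.
exact/ltW/truncnS_gt.
Qed.

(** As [mu] has mass K 0 = 1, the nonnegative functions 1 - s_n cos (n! x) have integrals 1 - s_n K
    (n!), which are summable and so force convergence to 0 [mu]-almost everywhere. *)
Lemma spectral_singular (s c : nat -> R) (M : R) : (forall n, s n * s n = 1) -> K 0 = 1 ->
  (forall n, 1 - s n * K n`!%:R <= c n) -> (forall n, \sum_(0 <= i < n) c i <= M) ->
  purely_singular mu.
Proof.
move=> s1 K0 sK cM.
pose g n (x : measurableTypeR R) : R := 1 - s n * cos (n`!%:R * x).
have icos n : mu.-integrable setT (EFin \o (fun x : R => cos (n`!%:R * x))).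
  by have := integrable_cosM n`!%:R 0; apply: eq_integrable => // x _; rewrite /= subr0.
have i1 : mu.-integrable setT (EFin \o cst (1 : R)) by exact: finite_measure_integrable_cst.
have isc n : mu.-integrable setT (EFin \o (fun x : R => s n * cos (n`!%:R * x))).
  by have := integrableZl measurableT (s n) (icos n); apply: eq_integrable.
have ig n : mu.-integrable setT (EFin \o g n).
  by have := integrableB measurableT i1 (isc n); apply: eq_integrable.
have mg n : measurable_fun (setT : set (measurableTypeR R)) (g n) by apply/measurable_EFinP; have /measurable_int := ig n.
have sn1 n : `|s n| = 1.
  by apply/eqP; rewrite -sqrp_eq1//; apply/eqP; rewrite real_normK ?num_real// expr2.
have g0 n x : 0 <= g n x.
  by rewrite subr_ge0 (le_trans (ler_norm _))// normrM sn1 mul1r cos_norm_le1.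
have gc n : (\int[mu]_x (g n x)%:E <= (c n)%:E)%E.
  have -> : (\int[mu]_x (g n x)%:E = (\int[mu]_x g n x)%R%:E)%E.
    by rewrite /Rintegral fineK//; exact: (integrable_fin_num measurableT (ig n)).
  rewrite lee_fin; apply: le_trans (sK n); rewrite /g RintegralB// RintegralZl//.
  have -> : (\int[mu]_x cos (n`!%:R * x))%R = K n`!%:R.
    have := spectral_cos n`!%:R 0; rewrite mulr0 cos0 mul1r => <-.
    by apply: eq_Rintegral => x _; rewrite subr0.
  have -> // : (\int[mu]_x 1)%R = 1 :> R.
  have h0 := spectral_cos 0 0; rewrite mul0r cos0 mul1r K0 in h0; rewrite -[RHS]h0.
  by apply: eq_Rintegral => x _; rewrite mul0r cos0.
have [B [mB B0 gB]] := @summable_integrals_cvg0 _ _ (measurableTypeR R) mu g c M mg g0 gc cM.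
(* B is a [mu]-null measurable set containing every point where convergence fails; its complement
   carries [mu] and is Lebesgue-null by alignment. *)
exists (~` B); split; [exact: measurableC| |by rewrite setCK].
apply: (lebesgue_null_aligned s1); first exact: measurableC.
by move=> x nBx; apply: contrapT => nx; apply: nBx; exact: gB.
Qed.

End spectral_measure.

Lemma cosprod_fact_summable (R : realType) n :
  \sum_(0 <= i < n) rate_cst / i.+1%:R ^+ 2 <= rate_cst * 2 :> R.
Proof.
rewrite -mulr_sumr ler_wpM2l ?sum_inv_sqr_le//.
by rewrite /rate_cst addr_ge0// sqr_ge0.
Qed.

Lemma cosprod_fact_cvg (R : realType) :
  (fun n => (-1) ^+ n.+1 * cos_product (@lambda_ R) (n`!)%:R) @ \oo --> (1 : R).
Proof.
apply: (@squeeze_cvgr _ _ _ _ (fun n => 1 - rate_cst / n.+1%:R ^+ 2) (fun=> 1)).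
- apply: nearW => n; rewrite lerBlDr -lerBlDl cosprod_fact/=.
  by rewrite (le_trans (ler_norm _))// normrM normr_sign mul1r cosprod_norm_le1.
- rewrite -[X in _ --> X]subr0; apply: cvgB; first exact: cvg_cst.
  rewrite -[X in _ --> X](mulr0 rate_cst); apply: cvgM; first exact: cvg_cst.
  rewrite (_ : (fun n => _) = fun n => (n.+1%:R^-1 : R) * n.+1%:R^-1); last first.
    by apply/funext => n; rewrite expr2 invfM.
  by rewrite -[X in _ --> X](mulr0 0); apply: cvgM; exact: cvg_harmonic.
- exact: cvg_cst.
Qed.

Theorem proposition9 (R : realType) (d : measure_display)
    (Omega : measurableType d) (P : probability Omega R)
    (X : R -> {RV P >-> measurableTypeR R})
    (mu : {finite_measure set (measurableTypeR R) -> \bar R})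
    (C := cos_product (@lambda_ R))
    (Z := fun w : Omega => zeros (fun t => X t w) : point_space R)
    (X_gaussian : gaussian_process P X)
    (X_centered : forall t : R, ('E_P[X t] = 0)%E)
    (X_covariance : forall t s : R, covariance P (X t) (X s) = (C (t - s))%:E)
    (X_continuous : forall w : Omega, continuous (fun t : R => X t w : R))
    (mu_spectral : is_spectral_measure mu C) :
  [/\ (fun n => (-1) ^+ n.+1 * C (n`!)%:R) @ \oo --> (1 : R),
      completely_predictable P Z /\ maximally_rigid P Z,
      [/\ purely_singular mu, atomless mu,
          weakly_mixing_process P X & weakly_mixing_points P Z] &
      {ae P, forall w, ereal_sup [set (`|X t w|)%:E | t in [set: R]] = +oo%E}].
Proof.
have C_even t : C (- t) = C t by exact: cosprodN.
have C0 : C 0 = 1 by exact: cosprod0.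
have sign2 n : (-1) ^+ n.+1 * (-1) ^+ n.+1 = 1 :> R by rewrite -expr2 sqrr_sign.
have fact_unbounded (T : R) : exists n0, forall n, (n0 <= n)%N -> T < n`!%:R.
  exists (Num.truncn `|T|).+1 => n nT; apply: le_lt_trans (ler_norm _) _.
  by apply: (lt_le_trans (truncnS_gt _)); rewrite ler_nat (leq_trans nT)// fact_geq.
have orth_time_ge0 j : 0 <= orth_time j :> R by rewrite divr_ge0.
have X_mixing : weakly_mixing_process P X.
  exact: (weakly_mixing_stationary_gaussian X_gaussian X_centered X_covariance C_even C0
    (@measurable_cosprod R) orth_time_ge0 (@cosprod_orth_time R)).
split.
- exact: cosprod_fact_cvg.
- split.
  + exact: (completely_predictable_zeros X_gaussian X_centered X_covariance X_continuous C_even C0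
      (@cosprod_diff4 R) sign2 fact_unbounded (@cosprod_fact R) (@cosprod_fact_summable R)).
  + exact: (maximally_rigid_zeros X_gaussian X_centered X_covariance X_continuous C_even C0
      (@cosprod_diff4 R) sign2 fact_unbounded (@cosprod_fact R) (@cosprod_fact_summable R)).
- split.
  + exact: (spectral_singular mu_spectral sign2 C0 (@cosprod_fact R) (@cosprod_fact_summable R)).
  + exact: (spectral_atomless mu_spectral C0 (@cosprod_orth_time R)).
  + exact: X_mixing.
  + exact: weakly_mixing_zeros.
- exact: (sup_path_infinite X_gaussian X_centered X_covariance C_even C0
    (@measurable_cosprod R) orth_time_ge0 (@cosprod_orth_time R) X_continuous).
Qed.
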